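(* Let $\kappa>0$ and $M_0>0$ be any numbers and let $u_0$ be any element of $H$. Then the set $Z(\kappa,M_0,u_0)$ is relatively compact in $L^p(0,T;H)$. Moreover, the closed convex hull of $Z(\kappa,M_0,u_0)$ in $L^p(0,T;V)$, denoted $\mathrm{conv}[Z(\kappa,M_0,u_0)]$, is compact in $L^p(0,T;H)$.
   Context: Setting: $V$ is a real reflexive Banach space which is dense and compactly embedded in a Hilbert space $H$; $H$ is identified with its dual, so $V\subset H\subset V^*$ with compact embeddings. $W$ is a reflexive and separable Banach space which is dense and continuously embedded in $V$; thus $V\subset H\subset W^*$ with compact embeddings. The spaces $V,V^*,W,W^*$ are strictly convex. Fix $1<p<\infty$, $p'=\frac{p}{p-1}$, $0<T<\infty$. $\langle\cdot,\cdot\rangle$ denotes the duality pairing between $V^*$ and $V$, $B_W(0)$ is the closed unit ball of $W$ centered at the origin, and $'$ denotes the time derivative. A function $\eta\in L^p(0,T;V)$ with $\eta'\in L^{p'}(0,T;V^* )$ is identified with its representative in $C([0,T];H)$. For $\kappa>0$, $M_0>0$, $u_0\in H$, the set $Z(\kappa,M_0,u_0)\subset L^p(0,T;V)\cap L^\infty(0,T;H)$ consists of all $u$ such that $|u|_{L^p(0,T;V)}\le M_0$, $|u|_{L^\infty(0,T;H)}\le M_0$, and there exists $f\in L^{p'}(0,T;V^* )$ with $$\int_0^T\langle f,u\rangle dt\le M_0,\qquad |f|_{L^1(0,T;W^* )}\le M_0,$$ and $$\int_0^T\langle \eta'-f,u-\eta\rangle dt\le \tfrac12|u_0-\eta(0)|_H^2$$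 for all $\eta\in L^p(0,T;V)$ with $\eta'\in L^{p'}(0,T;V^* )$ and $\eta(t)\in\kappa B_W(0)$ for all $t\in[0,T]$. *)

(* Defs.v *)
From HB Require Import structures.
From mathcomp Require Import all_boot all_order all_algebra sesquilinear.
From mathcomp Require Import all_classical all_reals all_analysis.
From mathcomp Require Import measurable_realfun ess_sup_inf.

Set Implicit Arguments.
Unset Strict Implicit.
Unset Printing Implicit Defensive.
Import Order.TTheory GRing.Theory Num.Theory.
Import numFieldNormedType.Exports.
Local Open Scope classical_set_scope.
Local Open Scope ring_scope.
Local Open Scope quotient_scope.

Section ContinuousLinear.
Context (R : realType) (E F : normedModType R).

Definition clin_pred : {pred E -> F} :=
  mem [set f : E -> F | linear f /\ continuous f].

Record clin := Clin { clin_fun :> E -> F ; clin_funP : clin_fun \in clin_pred }.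

HB.instance Definition _ := [isSub for clin_fun].
HB.instance Definition _ := [Choice of clin by <:].

Lemma clin_submod_closed : submod_closed clin_pred.
Proof.
split=> [|a f g]; rewrite !inE.
  split=> [c x y|]; first by rewrite scaler0 addr0.
  by move=> x; exact: cvg_cst.
move=> [fl fc] [gl gc]; split=> [c x y|x].
  rewrite /= !fctE fl gl !scalerDr !scalerA (mulrC c a) -!addrA; congr (_ + _).
  by rewrite addrCA.
by apply: cvgD; [apply: cvgZl_tmp; exact: fc | exact: gc].
Qed.

HB.instance Definition _ := GRing.isSubmodClosed.Build R (E -> F) clin_pred
  clin_submod_closed.
HB.instance Definition _ := [SubChoice_isSubLmodule of clin by <:].

Lemma clin_linear (f : clin) : linear f.
Proof. by have := clin_funP f; rewrite inE => -[]. Qed.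

HB.instance Definition _ (f : clin) :=
  GRing.isLinear.Build R E F *:%R (clin_fun f) (@clin_linear f).

Lemma clin_continuous (f : clin) : continuous f.
Proof. by have := clin_funP f; rewrite inE => -[]. Qed.

Definition opnorm (f : clin) : R := sup [set `|f x| | x in [set x | `|x| <= 1]].

Lemma clin_bounded (f : clin) : exists2 C, 0 < C & forall x, `|f x| <= C * `|x|.
Proof.
have /linear_boundedP/pinfty_ex_gt0[C C0 fC] :=
  continuous_linear_bounded 0 (@clin_continuous f 0).
by exists C.
Qed.

Lemma opnorm_has_sup (f : clin) :
  has_sup [set `|f x| | x in [set x | `|x| <= 1]].
Proof.
have [C C0 fC] := clin_bounded f; split.
  by exists `|f 0|, 0 => //=; rewrite normr0.
exists C => _ [x /= x1 <-]; apply: le_trans (fC x) _.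
by rewrite ger_pMr.
Qed.

Lemma opnorm_ub (f : clin) x : `|x| <= 1 -> `|f x| <= opnorm f.
Proof. by move=> x1; apply: (ub_le_sup (opnorm_has_sup f).2); exists x. Qed.

Lemma opnorm_le (f : clin) M :
  (forall x, `|x| <= 1 -> `|f x| <= M) -> opnorm f <= M.
Proof.
move=> fM; apply: (ge_sup (opnorm_has_sup f).1) => _ [x /= x1 <-].
exact: fM.
Qed.

Lemma opnormP (f : clin) x : `|f x| <= opnorm f * `|x|.
Proof.
have [->|x0] := eqVneq x 0; first by rewrite linear0 !normr0 mulr0.
have nx : 0 < `|x| by rewrite normr_gt0.
rewrite -ler_pdivrMr// mulrC -[`|x|^-1]gtr0_norm ?invr_gt0// -normrZ -linearZ.
by apply: opnorm_ub; rewrite normrZ normfV normr_id mulVf// gt_eqF.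
Qed.

Lemma ler_opnormD (f g : clin) : opnorm (f + g) <= opnorm f + opnorm g.
Proof.
apply: opnorm_le => x x1; apply: le_trans (ler_normD _ _) _.
by apply: lerD; exact: opnorm_ub.
Qed.

Lemma opnorm_ge0 (f : clin) : 0 <= opnorm f.
Proof.
by apply: le_trans (opnorm_ub f (x := 0) _) => //; rewrite normr0.
Qed.

Lemma opnorm_leZ (a : R) (f : clin) : opnorm (a *: f) <= `|a| * opnorm f.
Proof.
apply: opnorm_le => x x1.
by rewrite [(a *: f) x]/= normrZ ler_wpM2l// opnorm_ub.
Qed.

Lemma opnormZ (a : R) (f : clin) : opnorm (a *: f) = `|a| * opnorm f.
Proof.
apply/eqP; rewrite eq_le opnorm_leZ/=.
have [->|a0] := eqVneq a 0; first by rewrite normr0 mul0r opnorm_ge0.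
have := opnorm_leZ a^-1 (a *: f).
by rewrite scalerA mulVf// scale1r normfV ler_pdivlMl// normr_gt0.
Qed.

Lemma opnorm_eq0 (f : clin) : opnorm f = 0 -> f = 0.
Proof.
move=> f0; apply/val_inj/funext => x; apply/eqP.
by rewrite -normr_le0 (le_trans (opnormP f x))// f0 mul0r.
Qed.

HB.instance Definition _ := Lmodule_isNormed.Build R clin
  ler_opnormD opnormZ opnorm_eq0.

End ContinuousLinear.

Notation dual E := (clin E (GRing.regular _)).

Section StrongMeasurability.
Context d (X : measurableType d) (R : realType).

Definition simple_map (E : Type) (s : X -> E) :=
  finite_set (range s) /\ forall y, measurable (s @^-1` [set y]).

(** Pointwise limits of simple maps everywhere, not just a.e.: every a.e. limit of
   simple maps is a.e. equal to such a map, so this yields the same [Lp] classes,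
   and norms of such maps are measurable without completing the measure. *)
Definition strongly_measurable (E : normedModType R) (f : X -> E) :=
  exists2 s : nat -> X -> E, forall n, simple_map (s n) &
    forall x, s n x @[n --> \oo] --> f x.

Lemma simple_map_preimage (E : Type) (s : X -> E) (B : set E) :
  simple_map s -> measurable (s @^-1` B).
Proof.
move=> [fs ms].
have -> : s @^-1` B = \bigcup_(y in range s `&` B) s @^-1` [set y].
  apply/seteqP; split=> [x Bx|x [y [_ By] /= sxy]].
    by exists (s x) => //; split=> //; exists x.
  by rewrite sxy.
by apply: fin_bigcup_measurable => //; exact: finite_setIl.
Qed.

Lemma simple_map_comp (E F : Type) (h : E -> F) (s : X -> E) :
  simple_map s -> simple_map (h \o s).
Proof.
move=> ss; split=> [|y]; last exact: (simple_map_preimage (h @^-1` [set y]) ss).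
apply: (sub_finite_set _ (finite_image h ss.1)) => _ [x _ <-].
by exists (s x) => //; exists x.
Qed.

Lemma simple_map_pair (E F : Type) (s : X -> E) (t : X -> F) :
  simple_map s -> simple_map t -> simple_map (fun x => (s x, t x)).
Proof.
move=> [fs ms] [ft mt]; split=> [|[a b]].
  apply: (sub_finite_set _ (finite_setX fs ft)) => _ [x _ <-].
  by split; exists x.
have -> : (fun x => (s x, t x)) @^-1` [set (a, b)] =
    s @^-1` [set a] `&` t @^-1` [set b].
  by apply/seteqP; split=> x /= [-> ->].
exact: measurableI.
Qed.

Lemma simple_map_cst (E : Type) (c : E) : simple_map (fun=> c).
Proof.
split=> [|y]; last by rewrite (_ : _ @^-1` _ = if c \in [set y] then setT else set0);
    [case: ifP | exact: preimage_cst].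
by apply: (sub_finite_set _ (finite_set1 c)) => _ [x _ <-].
Qed.

Lemma strongly_measurable_cst (E : normedModType R) (c : E) :
  strongly_measurable (fun=> c).
Proof.
exists (fun _ _ => c) => [n|x]; [exact: simple_map_cst | exact: cvg_cst].
Qed.

Lemma strongly_measurable_lin (E : normedModType R) (a : R) (f g : X -> E) :
  strongly_measurable f -> strongly_measurable g ->
  strongly_measurable (fun x => a *: f x + g x).
Proof.
move=> [s ss sf] [t st tg]; exists (fun n x => a *: s n x + t n x) => [n|x].
  exact: (simple_map_comp (fun p => a *: p.1 + p.2) (simple_map_pair (ss n) (st n))).
by apply: cvgD; [apply: cvgZl_tmp; exact: sf | exact: tg].
Qed.

Lemma strongly_measurable_comp (E F : normedModType R) (h : E -> F)
    (f : X -> E) :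
  continuous h -> strongly_measurable f -> strongly_measurable (h \o f).
Proof.
move=> hc [s ss sf]; exists (fun n => h \o s n) => [n|x].
  exact: simple_map_comp.
by apply: continuous_cvg; [exact: hc | exact: sf].
Qed.

Lemma measurable_normr_strongly (E : normedModType R) (f : X -> E) :
  strongly_measurable f -> measurable_fun [set: X] (fun x => `|f x|).
Proof.
move=> [s ss sf].
apply: (@measurable_fun_cvg _ _ _ _ (fun n x => `|s n x|)) => [n|x _].
  move=> _ B mB; rewrite setTI.
  exact: (simple_map_preimage B (simple_map_comp (fun y => `|y|) (ss n))).
by apply: cvg_norm; exact: sf.
Qed.

End StrongMeasurability.

Section BochnerNorm.
Context d (X : measurableType d) (R : realType).
Variables (mu : {measure set X -> \bar R}) (p : \bar R).

Definition bochner_norm (E : normedModType R) (f : X -> E) : \bar R :=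
  'N[mu]_p[(fun x => `|f x|%:E)]%E.

Definition in_Lp (E : normedModType R) (f : X -> E) :=
  strongly_measurable f /\ (bochner_norm f < +oo)%E.

Hypothesis p1 : (1 <= p)%E.

Lemma le_Lnorm (f g : X -> R) :
  measurable_fun setT f -> measurable_fun setT g -> (forall x, 0 <= f x) ->
  {ae mu, forall x, f x <= g x} -> ('N[mu]_p[EFin \o f] <= 'N[mu]_p[EFin \o g])%E.
Proof.
move=> mf mg f0 fg; rewrite unlock /Lnorm.
case: p p1 => [r|_|//]; last first.
  case: ifPn => // _; apply: le_ess_sup; apply: filterS fg => x fgx /=.
  by rewrite lee_fin !ger0_norm// (le_trans (f0 x)).
rewrite lee_fin => r1; have r0 : 0 <= r by exact: le_trans r1.
have mpow (h : X -> R) : measurable_fun setT h ->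
    measurable_fun setT (fun x : X => (`|(EFin \o h) x| `^ r)%E).
  move=> mh; apply: (measurableT_comp (measurable_poweR _)).
  by apply: measurableT_comp => //; exact/measurable_EFinP.
have pow0 (h : X -> R) x : setT x -> (0 <= `|(EFin \o h) x| `^ r)%E.
  by move=> _; exact: poweR_ge0.
apply: gt0_ler_poweR; first by rewrite invr_ge0.
- by rewrite in_itv/= leey integral_ge0.
- by rewrite in_itv/= leey integral_ge0.
apply: ae_ge0_le_integral; [exact: measurableT | exact: pow0 | exact: mpow
  | exact: pow0 | exact: mpow |].
apply: filterS fg => x fgx _; apply: gt0_ler_poweR => //.
- by rewrite in_itv/= leey lee_fin normr_ge0.
- by rewrite in_itv/= leey lee_fin normr_ge0.
- by rewrite lee_fin !ger0_norm// (le_trans (f0 x)).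
Qed.

Section OneSpace.
Variable E : normedModType R.
Implicit Types f g : X -> E.

Lemma bochner_norm_ge0 f : (0 <= bochner_norm f)%E.
Proof. exact: Lnorm_ge0. Qed.

Lemma bochner_normZ a f : in_Lp f ->
  bochner_norm (fun x => a *: f x) = (`|a|%:E * bochner_norm f)%E.
Proof.
move=> [mf ff].
have nf : (fun x => `|f x|) \in Lfun mu p.
  rewrite inE; apply/andP; split; rewrite inE//=.
  exact: measurable_normr_strongly.
have := LnormZ (Lfun_Sub p1 nf) `|a|; rewrite normr_id => <-.
by rewrite /bochner_norm; congr Lnorm; apply/funext => x /=; rewrite normrZ.
Qed.

Lemma bochner_normD f g : strongly_measurable f -> strongly_measurable g ->
  (bochner_norm (fun x => f x + g x)%R <= bochner_norm f + bochner_norm g)%E.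
Proof.
move=> mf mg.
have mnf := measurable_normr_strongly mf; have mng := measurable_normr_strongly mg.
apply: le_trans (eminkowski _ mnf mng p1); apply: le_Lnorm => //.
- apply: measurable_normr_strongly.
  by have := strongly_measurable_lin 1 mf mg; under eq_fun do rewrite scale1r.
- exact: measurable_funD.
- by apply: nearW => x; exact: ler_normD.
Qed.

Lemma bochner_norm0 : bochner_norm (fun=> 0 : E) = 0%E.
Proof.
rewrite /bochner_norm -[RHS](Lnorm0 mu (p := p)); last first.
  by rewrite gt_eqF// (lt_le_trans _ p1).
by congr Lnorm; apply/funext => x; rewrite normr0.
Qed.

Lemma bochner_norm_ae f g : strongly_measurable f -> strongly_measurable g ->
  {ae mu, forall x, f x = g x} -> bochner_norm f = bochner_norm g.
Proof.
move=> /measurable_normr_strongly mf /measurable_normr_strongly mg fg.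
apply/eqP; rewrite eq_le; apply/andP; split; apply: le_Lnorm => //;
  by apply: filterS fg => x ->.
Qed.

Lemma bochner_norm_eq0 f : strongly_measurable f -> bochner_norm f = 0%E ->
  {ae mu, forall x, f x = 0}.
Proof.
move=> mf f0.
have : (fun x => `|f x|%:E) = \0%E %[ae mu].
  apply: Lnorm_eq0_eq0 f0; last by rewrite (lt_le_trans _ p1).
  by apply/measurable_EFinP; exact: measurable_normr_strongly.
by apply: filterS => x /(_ I)[] /eqP; rewrite normr_eq0 => /eqP.
Qed.

Lemma in_Lp_submod_closed : submod_closed (mem [set f | in_Lp f] : {pred X -> E}).
Proof.
split=> [|a f g]; rewrite !inE.
  by split; [exact: strongly_measurable_cst | rewrite bochner_norm0].
move=> [mf ff] [mg fg]; split; first exact: strongly_measurable_lin.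
have maf : strongly_measurable (fun x => a *: f x).
  have := strongly_measurable_lin a mf (strongly_measurable_cst X (0 : E)).
  by under eq_fun do rewrite addr0.
apply: (le_lt_trans (bochner_normD maf mg)); rewrite lte_add_pinfty//.
by rewrite bochner_normZ// lte_mul_pinfty.
Qed.

End OneSpace.
End BochnerNorm.

Section LpFunctions.
Context d (X : measurableType d) (R : realType).
Variables (mu : {measure set X -> \bar R}) (p : \bar R) (p1 : (1 <= p)%E).
Variable E : normedModType R.

(** The argument [1 <= p] is a phantom: it lets the closure instance below, which
   needs Minkowski's inequality, be inferred from the predicate. *)
Definition in_Lp_pred of (1 <= p)%E : {pred X -> E} := mem [set f | in_Lp mu p f].

Record Lp_fun := LpFun {
  Lp_val :> X -> E ; Lp_valP : Lp_val \in in_Lp_pred p1 }.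

HB.instance Definition _ := [isSub for Lp_val].
HB.instance Definition _ := [Choice of Lp_fun by <:].
HB.instance Definition _ := GRing.isSubmodClosed.Build R (X -> E)
  (in_Lp_pred p1) (@in_Lp_submod_closed _ _ _ mu _ p1 E).
HB.instance Definition _ := [SubChoice_isSubLmodule of Lp_fun by <:].

Definition ae_zero : {pred Lp_fun} :=
  mem [set f : Lp_fun | {ae mu, forall x, f x = 0}].

Lemma ae_zero_zmod_closed : zmod_closed ae_zero.
Proof.
split=> [|f g]; rewrite !inE; first exact: nearW.
by apply: filterS2 => x fx gx; rewrite -[LHS]/(f x - g x) fx gx subr0.
Qed.

HB.instance Definition _ := GRing.isZmodClosed.Build Lp_fun ae_zero
  ae_zero_zmod_closed.

(** [L^p(mu; E)]: classes of functions modulo a.e. equality. *)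
Definition Lp := Quotient.quot ae_zero.

HB.instance Definition _ := GRing.Zmodule.on Lp.
HB.instance Definition _ := EqQuotient.on Lp.

Lemma Lp_eqP (f g : Lp_fun) :
  reflect {ae mu, forall x, f x = g x} (\pi_Lp f == \pi_Lp g).
Proof.
have -> : (\pi_Lp f == \pi_Lp g) = (f - g \in ae_zero).
  by rewrite Quotient.idealrBE.
apply: (iffP idP) => [/set_mem|] fg; [|apply: mem_set]; apply: filterS fg => x.
- by rewrite -[(f - g) x]/(f x - g x) => /eqP; rewrite subr_eq0 => /eqP.
- by rewrite -[(f - g) x]/(f x - g x) => ->; rewrite subrr.
Qed.

Definition Lp_repr (u : Lp) : X -> E := repr u.
Coercion Lp_repr : Lp >-> Funclass.

Lemma Lp_repr_pi (f : Lp_fun) : {ae mu, forall x, (\pi_Lp f : Lp) x = f x}.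
Proof. by apply/Lp_eqP; rewrite reprK. Qed.

Lemma Lp_in_Lp (u : Lp) : in_Lp mu p u.
Proof. by have := Lp_valP (repr u); rewrite inE. Qed.

Lemma LpD (u v : Lp) : {ae mu, forall x, (u + v : Lp) x = u x + v x}.
Proof.
have := Lp_repr_pi (repr u + repr v).
by rewrite raddfD/= !reprK.
Qed.

Definition Lp_scale (a : R) (u : Lp) : Lp := \pi_Lp (a *: repr u).

Lemma Lp_scale_pi a f : Lp_scale a (\pi_Lp f) = \pi_Lp (a *: f).
Proof.
apply/eqP/Lp_eqP; apply: filterS (Lp_repr_pi f) => x fx.
by rewrite -[LHS]/(a *: Lp_repr _ x) fx.
Qed.

Let Lp_scalerA a b u : Lp_scale a (Lp_scale b u) = Lp_scale (a * b) u.
Proof. by rewrite {2}/Lp_scale Lp_scale_pi scalerA. Qed.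

Let Lp_scale1r : left_id 1 Lp_scale.
Proof. by move=> u; rewrite /Lp_scale scale1r reprK. Qed.

Let Lp_scalerDr : right_distributive Lp_scale +%R.
Proof.
move=> a u v; rewrite -[u]reprK -[v]reprK -raddfD !Lp_scale_pi scalerDr.
by rewrite raddfD.
Qed.

Let Lp_scalerDl u : {morph Lp_scale^~ u : a b / a + b}.
Proof. by move=> a b; rewrite /Lp_scale scalerDl raddfD. Qed.

HB.instance Definition _ := GRing.Zmodule_isLmodule.Build R Lp
  Lp_scalerA Lp_scale1r Lp_scalerDr Lp_scalerDl.

Lemma LpZ a (u : Lp) : {ae mu, forall x, (a *: u : Lp) x = a *: u x}.
Proof. exact: (Lp_repr_pi (a *: repr u)). Qed.

Definition Lp_norm (u : Lp) : R := fine (bochner_norm mu p u).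

Lemma Lp_normE u : (Lp_norm u)%:E = bochner_norm mu p u.
Proof. by rewrite fineK// ge0_fin_numE ?bochner_norm_ge0// (Lp_in_Lp u).2. Qed.

Let Lp_normD (u v : Lp) : Lp_norm (u + v) <= Lp_norm u + Lp_norm v.
Proof.
have [[mu_ _] [mv _] [muv _]] := And3 (Lp_in_Lp u) (Lp_in_Lp v) (Lp_in_Lp (u + v)).
have muDv : strongly_measurable (fun x => u x + v x).
  by have := strongly_measurable_lin 1 mu_ mv; under eq_fun do rewrite scale1r.
rewrite -lee_fin EFinD !Lp_normE (bochner_norm_ae p1 muv muDv (LpD u v)).
exact: bochner_normD.
Qed.

Let Lp_normZ a (u : Lp) : Lp_norm (a *: u) = `|a| * Lp_norm u.
Proof.
have mau : strongly_measurable (fun x => a *: u x).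
  have := strongly_measurable_lin a (Lp_in_Lp u).1 (strongly_measurable_cst X (0 : E)).
  by under eq_fun do rewrite addr0.
apply: EFin_inj; rewrite EFinM !Lp_normE.
rewrite (bochner_norm_ae p1 (Lp_in_Lp _).1 mau (LpZ a u)).
by rewrite bochner_normZ//; exact: Lp_in_Lp.
Qed.

Let Lp_norm_eq0 (u : Lp) : Lp_norm u = 0 -> u = 0.
Proof.
move=> u0; rewrite -[u]reprK -[0](raddf0 (\pi_Lp)); apply/eqP/Lp_eqP.
by apply: (bochner_norm_eq0 p1 (Lp_in_Lp u).1); rewrite -Lp_normE u0.
Qed.

HB.instance Definition _ := Lmodule_isNormed.Build R Lp
  Lp_normD Lp_normZ Lp_norm_eq0.

End LpFunctions.

Section ClinOperations.
Context (R : realType) (E F G : normedModType R).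

Lemma clin_comp_subproof (g : clin F G) (f : clin E F) :
  (g \o f : E -> G) \in @clin_pred R E G.
Proof.
rewrite inE; split=> [a x y|x]; first by rewrite /= !linearP.
by apply: continuous_comp; exact: clin_continuous.
Qed.

Definition clin_comp g f : clin E G := Clin (clin_comp_subproof g f).

Context d (X : measurableType d) (mu : {measure set X -> \bar R}).
Variables (p : \bar R) (p1 : (1 <= p)%E).

Lemma Lp_map_subproof (i : clin E F) (u : Lp mu p1 E) :
  (i \o u : X -> F) \in in_Lp_pred mu p1.
Proof.
have [mu_ ufin] := Lp_in_Lp u.
have miu : strongly_measurable (i \o u).
  by apply: strongly_measurable_comp mu_; exact: clin_continuous.
rewrite inE; split=> //; have [C C0 iC] := clin_bounded i.
have mCu : strongly_measurable (fun x => C *: u x).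
  have := strongly_measurable_lin C mu_ (strongly_measurable_cst X (0 : E)).
  by under eq_fun do rewrite addr0.
have : (bochner_norm mu p (fun x => C *: u x) < +oo)%E.
  by rewrite (bochner_normZ p1 C (Lp_in_Lp u)) lte_mul_pinfty// lee_fin.
apply: le_lt_trans; apply: le_Lnorm => //; try exact: measurable_normr_strongly.
by apply: nearW => x; rewrite normrZ gtr0_norm// iC.
Qed.

(** The map [L^p(mu; E) -> L^p(mu; F)] induced by [i : E -> F]. *)
Definition Lp_map (i : clin E F) (u : Lp mu p1 E) : Lp mu p1 F :=
  \pi_(Lp mu p1 F) (LpFun (Lp_map_subproof i u)).

End ClinOperations.

Section Geometry.
Context (R : realType).

Definition reflexive_space (E : normedModType R) :=
  forall Phi : dual (dual E), exists x : E, forall f : dual E, Phi f = f x.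

Definition strictly_convex (E : normedModType R) :=
  forall x y : E, `|x| = 1 -> `|y| = 1 -> x != y -> `|x + y| < 2.

Definition separable_space (E : topologicalType) :=
  exists2 D : set E, countable D & dense D.

Definition compact_operator (E F : normedModType R) (i : clin E F) :=
  forall A : set E, bounded_set A -> precompact (i @` A).

Definition dense_embedding (E F : normedModType R) (i : clin E F) :=
  injective i /\ dense (range i).

Definition closed_convex_hull (E : normedModType R) (A : set E) : set E :=
  smallest [set B | closed B /\ convex_set B] A.

End Geometry.

Lemma lee1_EFin (R : realType) (p : R) : 1 < p -> (1 <= p%:E)%E.
Proof. by move=> p1; rewrite lee_fin ltW. Qed.

Section TimeInterval.
Context (R : realType) (T : R).

(** Functions of time are defined on the whole line; as [dt] only charges
   [`]0, T[], their values elsewhere are irrelevant. *)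
Definition dt : {measure set (measurableTypeR R) -> \bar R} :=
  mrestr lebesgue_measure (measurable_itv `]0, T[).

Definition test_function (phi : R -> R) :=
  (forall n t, derivable (phi^`(n))%classic t 1) /\
  closure [set t | phi t != 0] `<=` `]0, T[.

Variables (V W H : completeNormedModType R) (ip : {dot H for idfun}).
Variables (i : clin V H) (j : clin W V).

(** [g] is the derivative of [eta] in the sense of [V^*]-valued distributions on
   [`]0, T[]; [eta t] acts on [V] by [v |-> ip (i (eta t)) (i v)] because [H] is
   identified with its dual. *)
Definition is_time_derivative (eta : R -> V) (g : R -> dual V) :=
  forall phi, test_function phi -> forall v,
  \int[dt]_t ((phi^`())%classic t * ip (i (eta t)) (i v)) =
  - \int[dt]_t (phi t * g t v).

Definition is_continuous_version (eta : R -> V) (etaH : R -> H) :=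
  {within `[0, T], continuous etaH} /\ {ae dt, forall t, etaH t = i (eta t)}.

Variables (p : R) (p_gt1 : 1 < p).
Let p' : R := p / (p - 1).

(** Functions [f], [eta], [eta'] stand for their classes; the constraint on [eta]
   at every time is on its continuous [H]-valued version [etaH]. [clin_comp (f t) j]
   is the image of [f t] under [V^* -> W^*], restriction along [j]. *)
Definition Z (kappa M0 : R) (u0 : H) : set (Lp dt (lee1_EFin p_gt1) V) :=
  [set u : Lp dt (lee1_EFin p_gt1) V | [/\ `|u| <= M0,
    (bochner_norm dt +oo (fun t => i (u t)) <= M0%:E)%E &
    exists f : R -> dual V, [/\ in_Lp dt p'%:E f,
      \int[dt]_t f t (u t) <= M0,
      (bochner_norm dt 1 (fun t => clin_comp (f t) j) <= M0%:E)%E &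
      forall (eta : R -> V) (eta' : R -> dual V) (etaH : R -> H),
        in_Lp dt p%:E eta -> in_Lp dt p'%:E eta' ->
        is_time_derivative eta eta' -> is_continuous_version eta etaH ->
        (forall t, t \in `[0, T] ->
          exists2 w : W, `|w| <= kappa & etaH t = i (j w)) ->
        \int[dt]_t (eta' t - f t) (u t - eta t) <=
          2^-1 * `|u0 - etaH 0| ^+ 2]]].

End TimeInterval.

Arguments Z {R} T {V W H} ip i j {p} p_gt1 kappa M0 u0 _.

(* Main.v *)
Require Import Defs.
From HB Require Import structures.
From mathcomp Require Import all_boot all_order all_algebra sesquilinear.
From mathcomp Require Import all_classical all_reals all_analysis.
From mathcomp Require Import measurable_realfun ess_sup_inf ring lra.

Set Implicit Arguments.
Unset Strict Implicit.
Unset Printing Implicit Defensive.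
Import Order.TTheory GRing.Theory Num.Theory.
Import numFieldNormedType.Exports.
Local Open Scope classical_set_scope.
Local Open Scope ring_scope.

(** Testing the inequality with [eta t = psi t *: w], where [psi] is a Lipschitz
   function vanishing at [0] and [T] with [|psi| |w| <= kappa], shows that for every
   [u] in [Z] and [w] in [W] the function [<u, w>] has variation bounded in terms of
   [w] only, since [int <f, u>] and the norm of [f] in [L^1(0, T; dual W)] are bounded
   by [M0]. Bounds of this kind, on norms and on integrals of [u] against test
   functions, are stable under convex combinations and limits, so the whole closed
   convex hull satisfies them. Since functions of bounded variation are determined up
   to a small [L^1] error by their averages on a grid, Ehrling's inequality makes the
   hull totally bounded in [L^p(0, T; H)].

   That its image in [L^p(0, T; H)] is closed is a weak closedness property of closed
   convex sets in [L^p(0, T; V)]. As the dual of [V] is strictly convex, the [p]-th power of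
   the norm is Gateaux differentiable, which yields explicit separating functionals
   at almost minimizers of the distance; no duality theory of Bochner spaces is
   needed. *)

(** * Separation in normed spaces *)

(** In the test with [psi t *: j w], the only term quadratic in the test function is a multiple of
    the integral of [psi psi'], which is 0 because [psi] vanishes at both ends; what is left is
    affine in [u]. The conditions of [Z] that involve [f], above all the one on the integral of
    [<f, u>], are not visibly stable under convex combinations, so [f] has to be eliminated before
    the hull is formed.

    The obstacle to compactness of the image is that a limit in [L^p(0, T; H)] of images of [u n]
    has to be lifted to [L^p(0, T; V)], and the lift has to be located in the hull. Reflexivity acts
    at fixed times, on [V] itself: it makes [H] dense in the dual of [V] and the images of balls of
    [V] closed in [H]. The distance to a closed convex set of [L^p(0, T; V)] is not known to be
    attained; Ekeland's principle supplies a point of the set where the first-order condition holds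
    up to an error chosen small against that distance. *)

Section HahnBanach.
Context (R : realType) (E : lmodType R).
Implicit Types q : E -> R.

Definition sublinear q :=
  (forall x y, q (x + y) <= q x + q y) /\ (forall a x, 0 <= a -> q (a *: x) = a * q x).

Lemma sublinear0 q : sublinear q -> q 0 = 0.
Proof. by move=> [_ qZ]; rewrite -(scale0r (0 : E)) qZ// mul0r. Qed.

Lemma sublinear_opp q x : sublinear q -> - q (- x) <= q x.
Proof.
move=> sq; have [qD _] := sq.
by rewrite lerNl -subr_ge0 opprK addrC -(sublinear0 sq) -(subrr x) qD.
Qed.

(** The largest sublinear functional below [q] that is additive in the direction [v]. *)
Definition straighten q (v x : E) : R :=
  inf [set q (x + s *: v) - s * q v | s in [set s : R | 0 <= s]].

Lemma straighten_lb q v x s : sublinear q -> 0 <= s ->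
  - q (- x) <= q (x + s *: v) - s * q v.
Proof.
move=> sq s0; have [qD qZ] := sq.
have := qD (x + s *: v) (- x).
by rewrite addrAC subrr add0r qZ//; lra.
Qed.

Lemma straighten_le_at q v x s : sublinear q -> 0 <= s ->
  straighten q v x <= q (x + s *: v) - s * q v.
Proof.
move=> sq s0; apply: ge_inf; last by exists s.
by exists (- q (- x)) => _ [t /= t0 <-]; exact: straighten_lb.
Qed.

Lemma straighten_le q v x : sublinear q -> straighten q v x <= q x.
Proof.
move=> sq; have := straighten_le_at v x sq (lexx 0).
by rewrite scale0r addr0 mul0r subr0.
Qed.

Lemma le_straighten q v x M : (forall s, 0 <= s -> M <= q (x + s *: v) - s * q v) ->
  M <= straighten q v x.
Proof.
move=> Mq; apply: lb_le_inf; first by exists (q (x + 0 *: v) - 0 * q v), 0 => /=.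
by move=> _ [s /= s0 <-]; exact: Mq.
Qed.

Lemma straighten_sublinear q v : sublinear q -> sublinear (straighten q v).
Proof.
move=> sq; have [qD qZ] := sq; split=> [x y|a x].
  rewrite -lerBlDr; apply: le_straighten => s s0.
  rewrite lerBlDr -lerBlDl; apply: le_straighten => t t0.
  rewrite lerBlDl (le_trans (straighten_le_at v (x + y) sq (addr_ge0 s0 t0)))//.
  by have := qD (x + s *: v) (y + t *: v); rewrite addrACA -scalerDl; lra.
rewrite le_eqVlt => /predU1P[<-|a0].
  rewrite scale0r mul0r; apply/eqP; rewrite eq_le -{1}(sublinear0 sq) straighten_le//=.
  by apply: le_straighten => s s0; rewrite add0r qZ// subrr.
have aE s : a * (q (x + s *: v) - s * q v) = q (a *: x + (a * s) *: v) - a * s * q v.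
  by rewrite mulrBr -(qZ _ _ (ltW a0)) scalerDr scalerA mulrA.
apply/eqP; rewrite eq_le; apply/andP; split.
  rewrite -ler_pdivrMl//; apply: le_straighten => s s0.
  rewrite ler_pdivrMl// aE; apply: straighten_le_at => //.
  by rewrite mulr_ge0// ltW.
apply: le_straighten => s s0.
have -> : s = a * (s / a) by rewrite mulrCA divff ?gt_eqF// mulr1.
rewrite -aE ler_pM2l//; apply: straighten_le_at => //.
by rewrite divr_ge0// ltW.
Qed.

(** Zorn's lemma: the pointwise infimum of a chain is finite, because every member dominates
    [- q (- x)], and subadditive, because of any two members one lies below the other. *)
Lemma exists_minimal_sublinear q : sublinear q -> exists f : E -> R,
  [/\ sublinear f, forall x, f x <= q x &
      forall g, sublinear g -> (forall x, g x <= f x) -> g = f].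
Proof.
move=> sq.
pose T := {f : E -> R | sublinear f /\ forall x, f x <= q x}.
(* The order is reversed: a maximal element for [le] is a minimal functional. *)
pose le (f g : T) : bool := `[< forall x, sval g x <= sval f x >].
have [f fmin] : exists f : T, forall g, le f g -> g = f.
  apply: Zorn => [f|f g h /asboolP fg /asboolP gh|f g /asboolP fg /asboolP gf|A Atot].
  - by apply/asboolP.
  - by apply/asboolP => x; exact: le_trans (gh x) (fg x).
  - have fgE : sval f = sval g by apply/funext => x; apply/eqP; rewrite eq_le fg gf.
    case: f g fgE {fg gf} => [f Pf] [g Pg] /= fg; subst g.
    by congr exist; exact: Prop_irrelevance.
  have [->|/set0P[f0 Af0]] := eqVneq A set0.
    by exists (exist _ q (conj sq (fun x => lexx (q x)))).
  pose m x := inf [set sval f x | f in A].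
  have lbm x : has_lbound [set sval f x | f in A].
    exists (- q (- x)) => _ [f _ <-]; have [sf fq] := svalP f.
    by apply: le_trans (sublinear_opp x sf); rewrite lerN2.
  have mle f x : A f -> m x <= sval f x by move=> Af; apply: ge_inf => //; exists f.
  have m_ge M x : (forall f, A f -> M <= sval f x) -> M <= m x.
    move=> Mf; apply: lb_le_inf; first by exists (sval f0 x), f0.
    by move=> _ [f Af <-]; exact: Mf.
  have sm : sublinear m.
    split=> [x y|a x].
      rewrite -lerBlDr; apply: (m_ge) => f Af; rewrite lerBlDr -lerBlDl.
      apply: (m_ge) => g Ag; rewrite lerBlDl.
      have [h [Ah hf hg]] : exists h, [/\ A h, forall x, sval h x <= sval f x &
          forall x, sval h x <= sval g x].
        by have [/asboolP fg|/asboolP gf] := Atot f g Af Ag; [exists g|exists f].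
      apply: le_trans (mle h (x + y) Ah) _.
      have [[hD _] _] := svalP h.
      by apply: le_trans (hD x y) _; apply: lerD.
    rewrite le_eqVlt => /predU1P[<-|a0].
      rewrite scale0r mul0r; apply/eqP; rewrite eq_le; apply/andP; split.
        by apply: le_trans (mle f0 _ Af0) _; rewrite (sublinear0 (svalP f0).1).
      by apply: (m_ge) => f Af; rewrite (sublinear0 (svalP f).1).
    apply/eqP; rewrite eq_le; apply/andP; split.
      rewrite -ler_pdivrMl//; apply: (m_ge) => f Af; rewrite ler_pdivrMl//.
      by have [[_ fZ] _] := svalP f; rewrite -(fZ _ _ (ltW a0)) mle.
    apply: (m_ge) => f Af; have [[_ fZ] _] := svalP f; rewrite (fZ _ _ (ltW a0)).
    by rewrite ler_pM2l// mle.
  have mq x : m x <= q x by apply: le_trans (mle f0 x Af0) _; exact: (svalP f0).2.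
  exists (exist _ m (conj sm mq)) => f Af; apply/asboolP => x /=; exact: mle.
exists (sval f); have [sf fq] := svalP f; split=> // g sg gf.
have gq x : g x <= q x by exact: le_trans (gf x) (fq x).
by apply: (congr1 sval (fmin (exist _ g (conj sg gq)) _)); apply/asboolP => x /=.
Qed.

(** A minimal sublinear [f] equals each of its straightenings, which gives [f (- x) <= - f x], so
    [f] is odd and hence linear. Minimality is taken below [straighten q v] instead of [q], because
    this forces [f (- v) <= - q v], that is, equality at [v]. *)
Lemma hahn_banach_sublinear q v : sublinear q -> exists f : E -> R,
  [/\ forall a x y, f (a *: x + y) = a * f x + f y, forall x, f x <= q x & f v = q v].
Proof.
move=> sq.
have [f [sf fq fmin]] := exists_minimal_sublinear (straighten_sublinear v sq).
have fN x : f (- x) = - f x.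
  apply/eqP; rewrite eq_le; apply/andP; split; last first.
    by have := sublinear_opp (- x) sf; rewrite opprK.
  rewrite -[in leLHS](fmin _ (straighten_sublinear x sf) (fun y => straighten_le x y sf)).
  apply: le_trans (straighten_le_at x (- x) sf ler01) _.
  by rewrite scale1r addNr (sublinear0 sf) mul1r sub0r.
have [fD fZ] := sf.
have fD' x y : f (x + y) = f x + f y.
  apply/eqP; rewrite eq_le fD/=.
  by have := fD (- x) (- y); rewrite -opprD !fN -opprD lerN2.
exists f; split.
- move=> a x y; rewrite fD'; congr (_ + _).
  have [a0|a0] := leP 0 a; first exact: fZ.
  by rewrite -[a *: x]opprK fN -scaleNr fZ ?mulNr ?opprK// oppr_ge0 ltW.
- by move=> x; exact: le_trans (fq x) (straighten_le v x sq).
- apply/eqP; rewrite eq_le (le_trans (fq v) (straighten_le v v sq))/=.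
  rewrite -lerN2 -fN; apply: le_trans (fq (- v)) _.
  apply: le_trans (straighten_le_at v (- v) sq ler01) _.
  by rewrite scale1r addNr (sublinear0 sq) mul1r sub0r.
Qed.

End HahnBanach.

(** * Continuous functionals on normed spaces *)

Section NormedDual.
Context (R : realType).
Implicit Types E F : normedModType R.

Lemma bounded_clin E F (f : E -> F) C : linear f -> (forall x, `|f x| <= C * `|x|) ->
  exists g : clin E F, forall x, g x = f x.
Proof.
move=> fl fC.
pose fL := GRing.isLinear.Build R E F *:%R f fl.
pose g : {linear E -> F} := HB.pack f fL.
have fP : f \in @clin_pred R E F.
  rewrite inE; split=> //; apply: (@bounded_linear_continuous _ _ _ g).
  by apply/linear_boundedP; near=> r => x; apply: le_trans (fC x) _; rewrite ler_wpM2r.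
by exists (Clin fP).
Unshelve. all: by end_near. Qed.

Lemma dominated_functional E (q : E -> R) (v : E) : sublinear q ->
  (exists C, forall x, q x <= C * `|x|) ->
  exists f : dual E, (forall x, (f x : R) <= q x) /\ (f v : R) = q v.
Proof.
move=> sq [C qC]; have [f [fl fq fv]] := hahn_banach_sublinear v sq.
have fN x : f (- x) = - f x.
  have f0 : f 0 = 0 by have := fl (-1) 0 0; rewrite scaler0 addr0 mulN1r addNr.
  by have := fl (-1) x 0; rewrite scaleN1r addr0 mulN1r f0 addr0.
have [|g gE] := @bounded_clin E R^o f C fl.
  move=> x; rewrite ler_norml lerNl -fN (le_trans (fq _)) ?(le_trans (qC _)) ?normrN//=.
  by rewrite (le_trans (fq _)).
by exists g; split=> [x|]; rewrite gE.
Qed.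

Lemma norming_functional E (x : E) : exists f : dual E,
  `|f| <= 1 /\ (f x : R) = `|x|.
Proof.
have [| |f [fq fx]] := @dominated_functional E (fun y => `|y|) x.
- by split=> [y z|a y a0]; [exact: ler_normD | rewrite normrZ ger0_norm].
- by exists 1 => y; rewrite mul1r.
exists f; split=> //; apply: opnorm_le => y y1.
by rewrite ler_norml lerNl -linearN (le_trans (fq _)) ?normrN//= (le_trans (fq _)).
Qed.

(** The dominating sublinear functional is the distance to [M]: it is 0 on the subspace [M], and the
    functional found equals it at [v], where it is at least [d]. *)
Lemma annihilating_functional E (M : set E) (v : E) (d : R) :
  M 0 -> (forall a x y, M x -> M y -> M (a *: x + y)) -> 0 < d ->
  (forall x, M x -> d <= `|v - x|) ->
  exists f : dual E, (forall x, M x -> f x = 0) /\ 0 < (f v : R).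
Proof.
move=> M0 Ml d0 dv.
pose q x := inf [set `|x - m| | m in M].
have q_le x m : M m -> q x <= `|x - m|.
  move=> Mm; apply: ge_inf; last by exists m.
  by exists 0 => _ [y _ <-].
have q_ge c x : (forall m, M m -> c <= `|x - m|) -> c <= q x.
  move=> H; apply: lb_le_inf; first by exists `|x - 0|, 0.
  by move=> _ [y My <-]; exact: H.
have MZ a x : M x -> M (a *: x) by move=> Mx; rewrite -[_ *: _]addr0; exact: Ml.
have MD x y : M x -> M y -> M (x + y) by move=> Mx; rewrite -[x]scale1r; exact: Ml.
have q0 m : M m -> q m <= 0.
  by move=> Mm; rewrite (le_trans (q_le _ _ Mm))// subrr normr0.
have sq : sublinear q.
  split=> [x y|a x].
    rewrite -lerBlDr; apply: (q_ge) => m Mm; rewrite lerBlDr -lerBlDl.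
    apply: (q_ge) => n Mn; rewrite lerBlDl (le_trans (q_le _ _ (MD _ _ Mm Mn)))//.
    by rewrite opprD addrACA ler_normD.
  rewrite le_eqVlt => /predU1P[<-|a0].
    rewrite scale0r mul0r; apply/eqP; rewrite eq_le q0//=.
    by apply: (q_ge) => m _.
  apply/eqP; rewrite eq_le; apply/andP; split.
    rewrite -ler_pdivrMl//; apply: (q_ge) => m Mm; rewrite ler_pdivrMl//.
    rewrite (le_trans (q_le _ _ (MZ a m Mm)))// -scalerBr normrZ gtr0_norm//.
  apply: (q_ge) => m Mm.
  have -> : a *: x - m = a *: (x - a^-1 *: m).
    by rewrite scalerBr scalerA divff ?gt_eqF// scale1r.
  by rewrite normrZ gtr0_norm// ler_pM2l// q_le//; exact: MZ.
have [|f [fq fv]] := dominated_functional v sq.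
  by exists 1 => x; rewrite mul1r (le_trans (q_le x 0 M0))// subr0.
exists f; split=> [m Mm|]; last by rewrite fv (lt_le_trans d0)// q_ge.
apply/eqP; rewrite eq_le (le_trans (fq m) (q0 m Mm))/= -oppr_le0 -linearN.
by rewrite (le_trans (fq _))// q0// -scaleN1r; exact: MZ.
Qed.

Lemma seq_cauchy_cvg (E : completeNormedModType R) (u : nat -> E) :
  (forall e, 0 < e -> exists N, forall n m, (N <= n)%N -> (N <= m)%N -> `|u n - u m| <= e) ->
  cvgn u.
Proof.
move=> H; apply: cauchy_cvg; apply: cauchy_exP => e e0.
have [N HN] := H (e / 2) (divr_gt0 e0 (ltr0Sn _ 1)).
exists (u N); exists N => // n /= Nn; rewrite -ball_normE/=.
by rewrite (le_lt_trans (HN _ _ (leqnn N) Nn))// ltr_pdivrMr// ltr_pMr// ltr1n.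
Qed.

Lemma closure_seq E (A : set E) z : closure A z ->
  exists u : nat -> E, (forall n, A (u n)) /\ u @ \oo --> z.
Proof.
move=> Az.
have /choice[u Hu] : forall n : nat, exists x, A x /\ `|x - z| < n.+1%:R^-1.
  move=> n; have n0 : 0 < n.+1%:R^-1 :> R by rewrite invr_gt0.
  have [x [Ax]] := Az _ (nbhsx_ballx z _ n0).
  by rewrite -ball_normE/= distrC => xz; exists x.
exists u; split=> [n|]; first exact: (Hu n).1.
apply/cvgrPdist_lt => e e0; near=> n.
rewrite distrC (lt_le_trans (Hu n).2)// ltW//; near: n.
exact: near_infty_natSinv_lt (PosNum e0).
Unshelve. all: by end_near. Qed.

End NormedDual.

(** * The inner product of [H] *)

Section InnerProduct.
Context (R : realType) (H : normedModType R) (ip : {dot H for idfun}).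
Hypothesis ip_norm : forall x : H, ip x x = `|x| ^+ 2.

Lemma ip_sym x y : ip x y = ip y x.
Proof. by rewrite hermC /= expr0 mul1r. Qed.

Lemma ip_norm_le x y : `|ip x y| <= `|x| * `|y|.
Proof.
have unit (a b : H) : `|a| <= 1 -> `|b| <= 1 -> ip a b <= 1.
  move=> a1 b1.
  have : 0 <= ip (a - b) (a - b) by rewrite ip_norm sqr_ge0.
  rewrite linearBl !linearBr/= (ip_sym b a) !ip_norm.
  have : `|a| ^+ 2 <= 1 by rewrite expr_le1.
  have : `|b| ^+ 2 <= 1 by rewrite expr_le1.
  lra.
have [->|x0] := eqVneq x 0; first by rewrite linear0l !normr0 mul0r.
have [->|y0] := eqVneq y 0; first by rewrite linear0r !normr0 mulr0.
have key a b : a != 0 -> b != 0 -> ip a b <= `|a| * `|b|.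
  move=> a0 b0.
  have na : 0 < `|a| by rewrite normr_gt0.
  have nb : 0 < `|b| by rewrite normr_gt0.
  have n1 (c : H) : c != 0 -> `| `|c|^-1 *: c| <= 1.
    by move=> c0; rewrite normrZ normfV normr_id mulVf// normr_eq0.
  have := unit _ _ (n1 a a0) (n1 b b0).
  rewrite linearZl_LR/= linearZr_LR/= !/GRing.scale/= mulrA -invfM -ler_pdivlMl ?invr_gt0 ?mulr_gt0//.
  by rewrite invrK mulr1.
rewrite ler_norml key// andbT lerNl -linearNl -[`|x|]normrN.
by rewrite key// oppr_eq0.
Qed.

Lemma ip_eq0 x : (forall y, ip y x = 0) -> x = 0.
Proof.
move=> /(_ x)/eqP; rewrite ip_norm expf_eq0/= normr_eq0 => /eqP //.
Qed.

Lemma riesz_clin (h : H) : exists f : dual H, forall x, f x = ip h x.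
Proof.
apply: (@bounded_clin _ H R^o (ip h) `|h|) => [a x y|x]; last exact: ip_norm_le.
by rewrite linearPr.
Qed.

End InnerProduct.

(** * Differentiability of powers of the norm *)

Section PowR.
Context (R : realType).
Implicit Types a b p r : R.

Lemma powR_le r a b : 0 <= r -> 0 <= a -> a <= b -> a `^ r <= b `^ r.
Proof. by move=> r0 a0 ab; apply: ge0_ler_powR; rewrite ?nnegrE//; exact: le_trans ab. Qed.

Lemma powRKV r a : 0 < r -> 0 <= a -> (a `^ r^-1) `^ r = a.
Proof. by move=> r0 a0; rewrite -powRrM mulVf ?gt_eqF// powRr1. Qed.

Lemma powRK r a : 0 < r -> 0 <= a -> (a `^ r) `^ r^-1 = a.
Proof. by move=> r0 a0; rewrite -powRrM mulfV ?gt_eqF// powRr1. Qed.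

Lemma powR_cvg r a (u : nat -> R) : 0 < r -> 0 <= a -> (forall n, 0 <= u n) ->
  u @ \oo --> a -> u n `^ r @[n --> \oo] --> a `^ r.
Proof.
move=> r0 + u0 ua; rewrite le_eqVlt => /predU1P[a0|a0].
  subst a; rewrite powR0 ?gt_eqF//.
  apply/cvgr0Pnorm_le => e e0; near=> n.
  rewrite ger0_norm ?powR_ge0// -[e](powRKV r0 (ltW e0)).
  apply: powR_le => //; first exact: ltW.
  rewrite -[u n]ger0_norm//; near: n.
  by move/cvgr0Pnorm_le : ua; apply; rewrite powR_gt0.
apply: (@continuous_cvg _ _ _ _ _ u (fun x => x `^ r) a) => //.
apply/differentiable_continuous/derivable1_diffP; apply: derivable_powR.
by rewrite in_itv/= andbT.
Unshelve. all: by end_near. Qed.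

(** Young's inequality [p a b^(p-1) <= a^p + (p-1) b^p], read as convexity of [x^p]. *)
Lemma powR_tangent p a b : 1 < p -> 0 <= a -> 0 <= b ->
  b `^ p - a `^ p <= p * b `^ (p - 1) * (b - a).
Proof.
move=> p1 a0 b0.
have p0 : 0 < p by rewrite (lt_trans ltr01).
have q0 : 0 < p / (p - 1) by rewrite divr_gt0// subr_gt0.
have pq : p^-1 + (p / (p - 1))^-1 = 1.
  by field; rewrite !gt_eqF ?subr_gt0.
have := conjugate_powR a0 (powR_ge0 b (p - 1)) p0 q0 pq.
have -> : (b `^ (p - 1)) `^ (p / (p - 1)) = b `^ p.
  by rewrite -powRrM mulrCA divff ?mulr1// gt_eqF// subr_gt0.
move=> /(ler_wpM2l (ltW p0)).
rewrite mulrDr.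
have -> : p * (a `^ p / p) = a `^ p by field; rewrite gt_eqF.
have -> : p * (b `^ p / (p / (p - 1))) = (p - 1) * b `^ p.
  by field; rewrite !gt_eqF ?subr_gt0.
have := mulr_powRB1 b0 p0.
by nra.
Qed.

(** Both powers are compared with the tangent at the convex combination [c], where the linear parts
    cancel. *)
Lemma powR_convex p a b t : 1 < p -> 0 <= a -> 0 <= b -> 0 <= t <= 1 ->
  (t * a + (1 - t) * b) `^ p <= t * a `^ p + (1 - t) * b `^ p.
Proof.
move=> p1 a0 b0 /andP[t0 t1].
set c := t * a + (1 - t) * b.
have c0 : 0 <= c by rewrite addr_ge0// mulr_ge0// subr_ge0.
have ha := powR_tangent p1 a0 c0; have hb := powR_tangent p1 b0 c0.
have : t * (c `^ p - a `^ p) + (1 - t) * (c `^ p - b `^ p) <=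
   t * (p * c `^ (p - 1) * (c - a)) + (1 - t) * (p * c `^ (p - 1) * (c - b)).
  by apply: lerD; apply: ler_wpM2l => //; rewrite subr_ge0.
have -> : t * (p * c `^ (p - 1) * (c - a)) + (1 - t) * (p * c `^ (p - 1) * (c - b)) =
  p * c `^ (p - 1) * (c - (t * a + (1 - t) * b)) by ring.
by rewrite subrr mulr0; lra.
Qed.

Lemma powRD_le p a b : 1 < p -> 0 <= a -> 0 <= b ->
  (a + b) `^ p <= 2 `^ p * (a `^ p + b `^ p).
Proof.
move=> p1 a0 b0; have p0 : 0 <= p by rewrite ltW// (lt_trans ltr01).
apply: (@le_trans _ _ ((2 * Num.max a b) `^ p)).
  apply: powR_le => //; first exact: addr_ge0.
  by rewrite mulr2n mulrDl mul1r lerD// le_max lexx ?orbT.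
have [ab|ba] := leP a b.
  by rewrite powRM// ler_wpM2l ?powR_ge0// lerDr powR_ge0.
by rewrite powRM// ler_wpM2l ?powR_ge0// lerDl powR_ge0.
Qed.

Lemma powR_diff_le p a b c : 1 < p -> 0 <= a -> 0 <= b -> `|a - b| <= c ->
  `|a `^ p - b `^ p| <= p * (Num.max a b) `^ (p - 1) * c.
Proof.
move=> p1 a0 b0 abc; have p0 : 0 <= p by rewrite ltW// (lt_trans ltr01).
have key x y : 0 <= x -> 0 <= y -> x <= y -> `|x - y| <= c -> `|y `^ p - x `^ p| <= p * y `^ (p - 1) * c.
  move=> x0 y0 xy xyc.
  rewrite ger0_norm ?subr_ge0 ?powR_le//.
  apply: le_trans (powR_tangent p1 x0 y0) _.
  rewrite ler_wpM2l ?mulr_ge0 ?powR_ge0//.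
  by rewrite (le_trans _ xyc)// distrC ler_norm.
have [ab|/ltW ba] := leP a b; first by rewrite distrC; exact: key.
by apply: key => //; rewrite distrC.
Qed.

End PowR.

(** * Gateaux differentiability of the [p]-th power of a norm *)

Section Smoothness.
Context (R : realType) (E : normedModType R) (p : R) (p1 : 1 < p).
Implicit Types x y v : E.

Let p0 : 0 < p. Proof. exact: lt_trans ltr01 p1. Qed.

Let N x := `|x| `^ p.

Let Nconv x y (t : R) : 0 <= t <= 1 -> N (t *: x + (1 - t) *: y) <= t * N x + (1 - t) * N y.
Proof.
move=> /[dup] t01 /andP[t0 t1]; apply: le_trans (powR_convex p1 (normr_ge0 _) (normr_ge0 _) t01).
apply: powR_le => //; first exact: ltW.
apply: le_trans (ler_normD _ _) _.
by rewrite !normrZ !ger0_norm// subr_ge0.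
Qed.

Let quot y v (s : R) := (N (y + s *: v) - N y) / s.

Let quot_mono y v (s t : R) : 0 < s -> s <= t -> quot y v s <= quot y v t.
Proof.
move=> s0 st; have t0 : 0 < t by exact: lt_le_trans st.
rewrite /quot ler_pdivrMr// mulrAC.
have st01 : 0 <= s / t <= 1.
  by apply/andP; split; [rewrite divr_ge0// ltW | rewrite ler_pdivrMr// mul1r].
have := Nconv (y + t *: v) y st01.
have -> : (s / t) *: (y + t *: v) + (1 - s / t) *: y = y + s *: v.
  rewrite scalerDr scalerA mulfVK ?gt_eqF// addrAC -scalerDl.
  by rewrite subrKC scale1r.
rewrite [X in _ -> _ <= X](_ : _ = s / t * (N (y + t *: v) - N y)); last by ring.
lra.
Qed.

(** By convexity: [y] is the combination of [y + s *: v] and [y - v] with weights [1 / (1 + s)] and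
    [s / (1 + s)]. *)
Let quot_lb y v (s : R) : 0 < s -> N y - N (y - v) <= quot y v s.
Proof.
move=> s0; rewrite /quot ler_pdivlMr//.
have s1 : 0 < 1 + s by rewrite addr_gt0.
have t01 : 0 <= (1 + s)^-1 <= 1 by rewrite invr_ge0 ltW//= invf_le1// lerDl ltW.
have := Nconv (y + s *: v) (y - v) t01.
have -> : (1 + s)^-1 *: (y + s *: v) + (1 - (1 + s)^-1) *: (y - v) = y.
  have -> : 1 - (1 + s)^-1 = (1 + s)^-1 * s by field; rewrite gt_eqF.
  rewrite -scalerA -scalerDr scalerBr addrACA subrr addr0.
  by rewrite -{1}[y]scale1r -scalerDl scalerA mulVf ?scale1r// gt_eqF.
have -> : 1 - (1 + s)^-1 = (1 + s)^-1 * s by field; rewrite gt_eqF.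
rewrite -mulrA -mulrDr ler_pdivlMl//; lra.
Qed.

(** The one-sided directional derivative of [N]: the quotients are nondecreasing in [s], so their
    limit at 0 is an infimum. *)
Let dir y v := inf [set quot y v s | s in [set s : R | 0 < s]].

Let dir_le y v (s : R) : 0 < s -> dir y v <= quot y v s.
Proof.
move=> s0; apply: ge_inf; last by exists s.
by exists (N y - N (y - v)) => _ [t /= t0 <-]; exact: quot_lb.
Qed.

Let le_dir y v (M : R) : (forall s : R, 0 < s -> M <= quot y v s) -> M <= dir y v.
Proof.
move=> H; apply: lb_le_inf; first by exists (quot y v 1), 1 => //=.
by move=> _ [s /= s0 <-]; exact: H.
Qed.

Let dir_sublinear y : sublinear (dir y).
Proof.
have dir0 : dir y 0 = 0.
  apply/eqP; rewrite eq_le; apply/andP; split.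
    by have := dir_le y 0 ltr01; rewrite /quot scaler0 addr0 subrr mul0r.
  by apply: le_dir => s s0; rewrite /quot scaler0 addr0 subrr mul0r.
split=> [u v|a v].
  rewrite -lerBlDr; apply: le_dir => s s0; rewrite lerBlDr -lerBlDl.
  apply: le_dir => t t0; rewrite lerBlDl.
  pose m := Num.min s t.
  have m0 : 0 < m by rewrite lt_min s0.
  have m2 : 0 < m / 2 by rewrite divr_gt0.
  apply: le_trans (dir_le y (u + v) m2) _.
  apply: (@le_trans _ _ (quot y u m + quot y v m)); last first.
    by apply: lerD; apply: quot_mono; rewrite // ge_min lexx ?orbT.
  have h : 0 <= (2^-1 : R) <= 1 by lra.
  have := Nconv (y + m *: u) (y + m *: v) h.
  have e2 : 1 - 2^-1 = 2^-1 :> R by lra.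
  have e3 : 2^-1 + 2^-1 = 1 :> R by lra.
  rewrite e2 !scalerDr addrACA -scalerDl e3 scale1r !scalerA [2^-1 * m]mulrC -scalerDr => H.
  have qE (x : R) : (x - N y) / (m / 2) = 2 * (x - N y) / m by field; rewrite gt_eqF.
  by rewrite /quot qE -mulrDl ler_pM2r ?invr_gt0//; lra.
rewrite le_eqVlt => /predU1P[<-|a0]; first by rewrite scale0r mul0r dir0.
have qE s : quot y (a *: v) s = a * quot y v (s * a).
  have [->|s0] := eqVneq s 0; first by rewrite mul0r /quot !invr0 !mulr0.
  rewrite /quot scalerA; field; rewrite s0 gt_eqF//.
apply/eqP; rewrite eq_le; apply/andP; split.
  rewrite -ler_pdivrMl//; apply: le_dir => s s0; rewrite ler_pdivrMl//.
  rewrite -[s](mulfVK (lt0r_neq0 a0)) -qE; apply: dir_le.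
  by rewrite divr_gt0.
apply: le_dir => s s0; rewrite qE ler_pM2l//; apply: dir_le.
by rewrite mulr_gt0.
Qed.

Let dir_bound y v : dir y v <= (`|y| + 1) `^ p * `|v|.
Proof.
have [->|v0] := eqVneq v 0.
  by rewrite (sublinear0 (dir_sublinear y)) normr0 mulr0.
have nv : 0 < `|v| by rewrite normr_gt0.
have nv' : 0 < `|v|^-1 by rewrite invr_gt0.
(* The step [1 / |v|] makes the increment a unit vector. *)
apply: le_trans (dir_le y v nv') _.
rewrite /quot invrK ler_pM2r//.
rewrite lerBlDr; apply: (@le_trans _ _ ((`|y| + 1) `^ p)).
  apply: powR_le => //; first exact: ltW.
  apply: le_trans (ler_normD _ _) _.
  by rewrite normrZ normfV normr_id mulVf ?gt_eqF.
by rewrite lerDl powR_ge0.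
Qed.

Definition subgradient y (f : dual E) :=
  forall (s : R) v, 0 < s -> (f v : R) <= (`|y + s *: v| `^ p - `|y| `^ p) / s.

(** With the step [1 / (n + 1)] the increment is estimated by the tangent of the power at
    [|y| + 1 / (n + 1)]; the sharp constant appears in the limit. *)
Lemma subgradient_norm y f : subgradient y f -> `|f| <= p * `|y| `^ (p - 1).
Proof.
move=> fy; apply: opnorm_le => v v1.
have key w : `|w| <= 1 -> (f w : R) <= p * `|y| `^ (p - 1).
  move=> w1.
  have H (n : nat) : (f w : R) <= p * (`|y| + n.+1%:R^-1) `^ (p - 1).
    have n0 : 0 < n.+1%:R^-1 :> R by rewrite invr_gt0.
    apply: le_trans (fy _ w n0) _; rewrite ler_pdivrMr//.
    have yn : 0 <= `|y| + n.+1%:R^-1 by rewrite addr_ge0// ltW.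
    apply: (@le_trans _ _ ((`|y| + n.+1%:R^-1) `^ p - `|y| `^ p)).
      rewrite lerD2r; apply: powR_le => //; first exact: ltW.
      apply: le_trans (ler_normD _ _) _; rewrite lerD2l normrZ gtr0_norm//.
      by rewrite ger_pMr.
    by apply: le_trans (powR_tangent p1 (normr_ge0 y) yn) _; rewrite addrAC subrr add0r.
  have lim : p * (`|y| + n.+1%:R^-1) `^ (p - 1) @[n --> \oo] --> p * `|y| `^ (p - 1).
    apply: cvgMr; apply: powR_cvg => [|//|n|]; first by rewrite subr_gt0.
      by rewrite addr_ge0// ltW// invr_gt0.
    rewrite -[X in _ --> X]addr0; apply: cvgD; first exact: cvg_cst.
    exact: cvg_harmonic.
  apply: (ler_cvg_to _ lim); first exact: (cvg_cst (f w : R)).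
  exact: nearW.
by rewrite ler_norml key// andbT lerNl -linearN key// normrN.
Qed.

(** The upper bound is the norm estimate; the lower one comes from the direction [- y], along which
    the norm decreases linearly. *)
Lemma subgradient_self y f : subgradient y f -> (f y : R) = p * `|y| `^ p.
Proof.
move=> fy; apply/eqP; rewrite eq_le; apply/andP; split.
  apply: le_trans (ler_norm _) _; apply: le_trans (opnormP f y) _.
  apply: le_trans (ler_wpM2r (normr_ge0 _) (subgradient_norm fy)) _.
  by rewrite -mulrA [_ * `|y|]mulrC mulr_powRB1.
have H (n : nat) : p * `|y| * (`|y| - `|y| * n.+2%:R^-1) `^ (p - 1) <= (f y : R).
  have n0 : 0 < n.+2%:R^-1 :> R by rewrite invr_gt0.
  have n1 : n.+2%:R^-1 <= 1 :> R by rewrite invf_le1// ler1n.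
  have yn : 0 <= `|y| - `|y| * n.+2%:R^-1 by rewrite subr_ge0 ler_piMr.
  have := fy _ (- y) n0; rewrite linearN/= lerNl => /(le_trans _); apply.
  rewrite -[leRHS]mulNr ler_pdivlMr// opprB.
  have -> : `|y + n.+2%:R^-1 *: - y| = `|y| - `|y| * n.+2%:R^-1.
    rewrite scalerN -{1}[y]scale1r -scalerBl normrZ ger0_norm ?subr_ge0//.
    by rewrite mulrBl mul1r mulrC.
  have := powR_tangent p1 (normr_ge0 y) yn.
  rewrite addrAC subrr add0r -lerN2 opprB => /(le_trans _); apply.
  by rewrite le_eqVlt; apply/orP; left; apply/eqP; ring.
have lim : p * `|y| * (`|y| - `|y| * n.+2%:R^-1) `^ (p - 1) @[n --> \oo] --> p * `|y| `^ p.
  rewrite -(mulr_powRB1 (normr_ge0 y) p0) mulrA.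
  apply: cvgMr; apply: powR_cvg => [|//|n|]; first by rewrite subr_gt0.
    by rewrite subr_ge0 ler_piMr ?normr_ge0 ?invf_le1// ler1n.
  rewrite -[X in _ --> X]subr0; apply: cvgB; first exact: cvg_cst.
  rewrite -(mulr0 `|y|); apply: cvgMr.
  have := @cvg_harmonic R; rewrite -cvg_shiftS; exact.
apply: (ler_cvg_to lim); first exact: (cvg_cst (f y : R)).
exact: nearW.
Qed.

Hypothesis dual_convex : strictly_convex (dual E).

(** Divided by [c], two subgradients at [y != 0] are unit vectors of the dual taking the value [|y|]
    at [y], so their sum has norm at least 2; strict convexity then makes them equal. *)
Lemma subgradient_unique y f g : subgradient y f -> subgradient y g -> f = g.
Proof.
move=> fy gy.
have [y0|y0] := eqVneq y 0.
  have n0 h : subgradient y h -> h = 0.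
    move=> hy; apply/eqP; rewrite -normr_le0 (le_trans (subgradient_norm hy))//.
    by rewrite y0 normr0 powR0 ?mulr0// subr_eq0 gt_eqF.
  by rewrite (n0 f)// (n0 g).
have ny : 0 < `|y| by rewrite normr_gt0.
pose c := p * `|y| `^ (p - 1).
have c0 : 0 < c by rewrite mulr_gt0// powR_gt0.
have self h : subgradient y h -> (h y : R) = c * `|y|.
  by move=> /subgradient_self ->; rewrite /c -mulrA [_ * `|y|]mulrC mulr_powRB1.
have n1 h : subgradient y h -> `|c^-1 *: h| = 1.
  move=> hy; rewrite normrZ gtr0_norm ?invr_gt0//; apply: (mulfI (lt0r_neq0 c0)).
  rewrite mulrA divff ?gt_eqF// mul1r mulr1; apply/eqP.
  rewrite eq_le subgradient_norm//= -(ler_pM2r ny) -(self _ hy).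
  by apply: le_trans (ler_norm _) _; exact: opnormP.
apply/eqP; apply: contraT => fg.
have := dual_convex (n1 f fy) (n1 g gy).
have -> : c^-1 *: f != c^-1 *: g.
  by apply: contra fg => /eqP/(scalerI (invr_neq0 (lt0r_neq0 c0)))/eqP.
move=> /(_ isT); rewrite ltNge => /negP[].
rewrite -scalerDr -(ler_pM2r ny).
apply: le_trans (opnormP _ _); apply: le_trans (ler_norm _).
rewrite -[leRHS]/(c^-1 * ((f y : R) + (g y : R))) !self//.
by rewrite -mulrDr mulrA mulVf ?gt_eqF// mul1r mulr_natl mulr2n.
Qed.

(** Hahn-Banach gives, for each direction [v], a subgradient equal to the directional derivative at
    [v]. By uniqueness it is the same one for all [v], so the directional derivative is linear. *)
Lemma powR_norm_gateaux y : exists f : dual E, [/\ `|f| <= p * `|y| `^ (p - 1),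
  (f y : R) = p * `|y| `^ p &
  forall v, n.+1%:R * (`|y + n.+1%:R^-1 *: v| `^ p - `|y| `^ p) @[n --> \oo] --> (f v : R)].
Proof.
have bd : exists C, forall v, dir y v <= C * `|v|.
  by exists ((`|y| + 1) `^ p) => v; exact: dir_bound.
have sub v : exists f, subgradient y f /\ (f v : R) = dir y v.
  have [f [fd fv]] := dominated_functional v (dir_sublinear y) bd.
  by exists f; split=> // s w s0; apply: le_trans (fd w) (dir_le y w s0).
have [f [fy _]] := sub 0.
have fE v : (f v : R) = dir y v.
  by have [g [gy <-]] := sub v; rewrite (subgradient_unique fy gy).
exists f; split=> [||v]; [exact: subgradient_norm | exact: subgradient_self |].
rewrite fE; apply/cvgrPdist_le => e e0.
have hi : has_inf [set quot y v s | s in [set s : R | 0 < s]].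
  split; first by exists (quot y v 1), 1 => //=.
  by exists (N y - N (y - v)) => _ [t /= t0 <-]; exact: quot_lb.
have [_ [s /= s0 <-] sd] := inf_adherent e0 hi.
near=> n.
have n0 : 0 < n.+1%:R^-1 :> R by rewrite invr_gt0.
have -> : n.+1%:R * (`|y + n.+1%:R^-1 *: v| `^ p - `|y| `^ p) = quot y v n.+1%:R^-1.
  by rewrite /quot invrK mulrC.
rewrite distrC ger0_norm ?subr_ge0 ?dir_le// lerBlDl.
apply: le_trans (quot_mono y v n0 _) (ltW sd).
by apply: ltW; near: n; exact: near_infty_natSinv_lt (PosNum s0).
Unshelve. all: by end_near. Qed.

End Smoothness.

(** * Variational principle, pivot space and Ehrling's inequality *)

(** Ekeland's variational principle. *)
Lemma almost_minimizer (R : realType) (E : normedModType R) (K : set E) (F : E -> R)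
    (e : R) (x0 : E) :
  0 < e -> K x0 -> (forall x, 0 <= F x) ->
  (forall u : nat -> E, (forall n, K (u n)) ->
    (forall d, 0 < d -> exists N, forall n m, (N <= n)%N -> (N <= m)%N -> `|u n - u m| <= d) ->
    exists2 l, K l & u @ \oo --> l) ->
  (forall (u : nat -> E) l, u @ \oo --> l -> F (u n) @[n --> \oo] --> F l) ->
  exists2 v, K v & forall c, K c -> F v <= F c + e * `|c - v|.
Proof.
move=> e0 Kx0 F0 Kc Fc.
(* The points of [K] for which the decrease of [F] from [v] pays for the distance at rate [e]. *)
pose S v := [set c | K c /\ F c + e * `|c - v| <= F v].
have Sself v : K v -> S v v by move=> Kv; split=> //; rewrite subrr normr0 mulr0 addr0.
(* [g] selects from [S v] a point minimizing [F] up to [1 / (n + 1)]. *)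
have /choice[g Hg] : forall nv : nat * E, exists c, K nv.2 -> S nv.2 c /\
    forall c', S nv.2 c' -> F c <= F c' + nv.1.+1%:R^-1.
  move=> [n v] /=.
  have [Kv|nKv] := pselect (K v); last by exists v.
  have hi : has_inf [set F c | c in S v].
    split; first by exists (F v), v => //; exact: Sself.
    by exists 0 => _ [c _ <-].
  have n0 : 0 < n.+1%:R^-1 :> R by rewrite invr_gt0.
  have [_ [c Sc <-] cI] := inf_adherent n0 hi.
  exists c => _; split=> // c' Sc'; apply: le_trans (ltW cI) _.
  by rewrite lerD2r; apply: ge_inf; [exact: hi.2 | exists c'].
pose v := fix v n := if n is m.+1 then g (m, v m) else x0.
have Kv n : K (v n) by elim: n => //= n IH; have [[]] := Hg (n, v n) IH.
have vS n : S (v n) (v n.+1) by have [] := Hg (n, v n) (Kv n).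
have vmin n c : S (v n) c -> F (v n.+1) <= F c + n.+1%:R^-1.
  by move=> Sc; have [_] := Hg (n, v n) (Kv n); apply.
have dec n k : F (v (n + k)%N) + e * `|v (n + k)%N - v n| <= F (v n).
  elim: k => [|k IH]; first by rewrite addn0 subrr normr0 mulr0 addr0.
  rewrite addnS; apply: le_trans IH.
  have [_ vk] := vS (n + k)%N.
  have : `|v (n + k).+1 - v n| <= `|v (n + k).+1 - v (n + k)%N| + `|v (n + k)%N - v n|.
    by rewrite (le_trans _ (ler_normD _ _))// addrA subrK.
  by rewrite -(ler_pM2l e0) mulrDr; lra.
have hi : has_inf (range (F \o v)).
  by split; [exists (F (v 0%N)), 0%N | exists 0 => _ [n _ <-]; exact: F0].
have [l Kl vl] : exists2 l, K l & v @ \oo --> l.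
  apply: Kc => // d d0.
  have ed : 0 < e * (d / 2) by rewrite mulr_gt0// divr_gt0.
  have [_ [N _ <-] vN] := inf_adherent ed hi.
  exists N => n m Nn Nm.
  have key k : (N <= k)%N -> `|v k - v N| <= d / 2.
    move=> Nk; rewrite -(ler_pM2l e0).
    have := dec N (k - N)%N; rewrite subnKC// => H.
    have : inf (range (F \o v)) <= F (v k) by apply: ge_inf; [exact: hi.2 | exists k].
    by move: vN => /=; lra.
  have -> : v n - v m = (v n - v N) - (v m - v N) by rewrite opprB addrA subrK.
  by rewrite (le_trans (ler_normB _ _))//; have := key n Nn; have := key m Nm; lra.
have lS n : F l + e * `|l - v n| <= F (v n).
  have cv : F (v (m + n)%N) + e * `|v (m + n)%N - v n| @[m --> \oo] --> F l + e * `|l - v n|.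
    apply: cvgD; first by apply: Fc; rewrite cvg_shiftn.
    apply: cvgMr; apply: cvg_norm; apply: cvgB; last exact: cvg_cst.
    by rewrite cvg_shiftn.
  apply: (ler_cvg_to cv (cvg_cst (F (v n)))); apply: nearW => m.
  by rewrite addnC.
(* A point [c] violating the inequality would lie in every [S (v n)]; the near minimality of the
   iterates then gives [F l <= F c] in the limit, a contradiction. *)
exists l => // c Kc'; rewrite leNgt; apply/negP => cl.
have Sc n : S (v n) c.
  split=> //; apply: le_trans (lS n).
  have : `|c - v n| <= `|c - l| + `|l - v n|.
    by rewrite (le_trans _ (ler_normD _ _))// addrA subrK.
  by rewrite -(ler_pM2l e0) mulrDr; lra.
have : F l <= F c.
  have c1 : F (v n.+1) @[n --> \oo] --> F l.
    by apply: Fc; have := vl; rewrite -cvg_shiftS.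
  have c2 : F c + n.+1%:R^-1 @[n --> \oo] --> F c.
    rewrite -[X in _ --> X]addr0; apply: cvgD; first exact: cvg_cst.
    exact: cvg_harmonic.
  by apply: (ler_cvg_to c1 c2); apply: nearW => n; exact: vmin.
have : 0 <= e * `|c - l| by rewrite mulr_ge0// ltW.
lra.
Qed.

(** * The embedding of [H] in the dual of [V], adjoint to [i] *)

Section Pivot.
Context (R : realType) (V H : completeNormedModType R) (ip : {dot H for idfun}).
Hypothesis ip_norm : forall x : H, ip x x = `|x| ^+ 2.
Variable i : clin V H.

Definition pivot (h : H) : dual V := clin_comp (sval (cid (riesz_clin ip_norm h))) i.

Lemma pivotE h v : pivot h v = ip h (i v).
Proof. by rewrite /pivot; case: cid => f /= ->. Qed.

Lemma pivot_linear a h k : pivot (a *: h + k) = a *: pivot h + pivot k.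
Proof.
apply/val_inj/funext => v /=.
rewrite -[RHS]/(a *: (pivot h v : R^o) + pivot k v).
by rewrite -[LHS]/(pivot _ v) !pivotE linearPl.
Qed.

Lemma pivotB h k : pivot (h - k) = pivot h - pivot k.
Proof. by rewrite addrC -scaleN1r pivot_linear scaleN1r addrC. Qed.

Lemma pivot_norm h : `|pivot h| <= `|h| * opnorm i.
Proof.
apply: opnorm_le => v v1; rewrite pivotE (le_trans (ip_norm_le ip_norm _ _))//.
by rewrite ler_wpM2l// opnorm_ub.
Qed.

Hypothesis V_reflexive : reflexive_space V.
Hypothesis i_inj : injective i.

(** Otherwise some nonzero functional on [dual V] kills the range of [pivot]. By reflexivity it is
    the evaluation at some [x]; then [i x] is orthogonal to [H], and [x = 0] by injectivity. *)
Lemma pivot_dense (f : dual V) e : 0 < e -> exists h, `|f - pivot h| < e.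
Proof.
move=> e0; apply: contrapT => nh.
have far h : e <= `|f - pivot h| by rewrite leNgt; apply/negP => he; apply: nh; exists h.
have p0 : pivot 0 = 0.
  by rewrite -(subrr (0 : H)) pivotB subrr.
have [|a x y [h _ <-] [k _ <-]|_ [h _ <-]|Phi [Phi0 Phif]] :=
    @annihilating_functional _ _ (range pivot) f e _ _ e0.
- by exists 0.
- by exists (a *: h + k) => //; exact: pivot_linear.
- exact: far.
have [x xE] := V_reflexive Phi.
have x0 : x = 0.
  apply: i_inj; rewrite linear0; apply: (ip_eq0 ip_norm) => h.
  by rewrite -pivotE -xE; apply: Phi0; exists h.
by move: Phif; rewrite xE x0 linear0 ltxx.
Qed.

(** A bounded sequence of [V] whose image converges in [H] converges weakly in [V]: first against
    functionals from [H], then by density against all. Reflexivity represents the limit functional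
    by a vector, and a norming functional shows that this vector lies in the ball. *)
Lemma closed_image_ball x r : closed (i @` [set v | `|v - x| <= r]).
Proof.
move=> z /closure_seq[z_ [zi zz]].
have /choice[y Hy] : forall n, exists v, `|v - x| <= r /\ i v = z_ n.
  by move=> n; have [v vr <-] := zi n; exists v.
have r0 : 0 <= r by apply: le_trans (Hy 0%N).1.
have iyz : i (y n) @[n --> \oo] --> z by under eq_fun do rewrite (Hy _).2.
have ipc h : (ip h (i (y n)) : R) @[n --> \oo] --> (ip h z : R).
  have [g gE] := riesz_clin ip_norm h.
  rewrite -gE; under eq_fun do rewrite -gE.
  by apply: continuous_cvg iyz; exact: clin_continuous.
(* [r * 2] bounds the distance of two terms; the added 1 keeps the divisor positive when [r = 0]. *)
have cv (f : dual V) : cvgn (fun n => f (y n) : R).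
  apply: (@seq_cauchy_cvg R R^o) => e e0.
  have e1 : 0 < e / (2 * (r * 2 + 1)) by rewrite divr_gt0// mulr_gt0// ltr_wpDl// mulr_ge0.
  have [h fh] := pivot_dense f e1.
  have /cvgrPdist_le/(_ (e / 4)) := ipc h.
  case; first by rewrite divr_gt0.
  move=> N _ HN; exists N => n m Nn Nm.
  have Hyy : `|y n - y m| <= r * 2.
    have -> : y n - y m = (y n - x) - (y m - x) by rewrite opprB addrA subrK.
    by rewrite (le_trans (ler_normB _ _))//; have := (Hy n).1; have := (Hy m).1; lra.
  have -> : (f (y n) : R) - f (y m) = (f - pivot h) (y n - y m) +
      ((ip h z - ip h (i (y m))) - (ip h z - ip h (i (y n)))).
    rewrite -[(f - pivot h) _]/((f (y n - y m) : R) - pivot h (y n - y m)) pivotE !linearB/=.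
    by ring.
  apply: le_trans (ler_normD _ _) _.
  have b1 : `|(f - pivot h) (y n - y m) : R| <= e / 2.
    apply: le_trans (opnormP _ _) _.
    apply: (@le_trans _ _ (e / (2 * (r * 2 + 1)) * (r * 2 + 1))).
      by apply: ler_pM => //; [exact: opnorm_ge0 | exact: ltW | lra].
    by rewrite le_eqVlt; apply/orP; left; apply/eqP; field; lra.
  have b2 := ler_normB (ip h z - ip h (i (y m))) (ip h z - ip h (i (y n))).
  have := HN n Nn; have := HN m Nm => /=; lra.
have [Y [Yl Yb]] : exists Y : dual V -> R, (forall f : dual V, (f (y n) : R) @[n --> \oo] --> Y f) /\
    forall f : dual V, `|Y f| <= (`|x| + r) * `|f|.
  exists (fun f => limn (fun n => f (y n) : R)); split=> f; first exact: cv.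
  apply: (ler_cvg_to (cvg_norm (cv f)) (cvg_cst ((`|x| + r) * `|f|))).
  apply: nearW => n; rewrite mulrC; apply: le_trans (opnormP _ _) _.
  rewrite ler_wpM2l ?opnorm_ge0// -[y n](subrK x) addrC (le_trans (ler_normD _ _))//.
  by rewrite lerD2l; exact: (Hy n).1.
have [|Phi PhiE] := @bounded_clin R (dual V) R^o Y _ _ Yb.
  move=> a f g; apply: (cvg_unique _ (Yl (a *: f + g))) => //=.
  have -> : (fun n => (a *: f + g) (y n) : R) = (fun n => a * (f (y n) : R) + g (y n)) by [].
  by apply: cvgD; [apply: cvgMr; exact: Yl | exact: Yl].
have [v vE] := V_reflexive Phi.
have fv (f : dual V) : (f (y n) : R) @[n --> \oo] --> (f v : R).
  by rewrite -vE PhiE; exact: Yl.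
exists v => /=.
  have [f [f1 <-]] := norming_functional (v - x).
  have c : (f (y n - x) : R) @[n --> \oo] --> (f (v - x) : R).
    rewrite linearB/=; under eq_fun do rewrite linearB/=.
    by apply: cvgB; [exact: fv | exact: cvg_cst].
  apply: (ler_cvg_to c (cvg_cst r)); apply: nearW => n.
  rewrite (le_trans (ler_norm _))// (le_trans (opnormP _ _))//.
  rewrite (le_trans _ (_ : 1 * r <= r))//; last by rewrite mul1r.
  by apply: ler_pM => //; [exact: opnorm_ge0 | exact: (Hy n).1].
apply/eqP; rewrite -subr_eq0; apply/eqP; apply: (ip_eq0 ip_norm) => h.
rewrite linearBr/= -pivotE; apply/eqP; rewrite subr_eq0; apply/eqP.
apply: (cvg_unique _ (fv (pivot h))) => //=.
have -> : (fun n => pivot h (y n) : R) = (fun n => ip h (i (y n))).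
  by apply/funext => n; exact: pivotE.
exact: ipc.
Qed.

End Pivot.

Lemma countable_sub_range (T : Type) (D : set T) (t0 : T) : countable D ->
  exists w : nat -> T, D `<=` range w.
Proof.
move=> /countable_injP[f finj].
have /choice[w Hw] : forall n, exists x, forall y, D y -> f y = n -> x = y.
  move=> n; have [[x [Dx fx]]|nx] := pselect (exists x, D x /\ f x = n).
    by exists x => y Dy fy; apply: finj; rewrite ?inE// fx.
  by exists t0 => y Dy fy; case: nx; exists y.
by exists w => x Dx; exists (f x) => //; apply: Hw.
Qed.

Lemma countable_range (T : countType) (U : Type) (f : T -> U) : countable (range f).
Proof. exact: sub_countable (card_image_le _ _) (countableP _). Qed.

Definition dense_seq (R : realType) (E : normedModType R) (w : nat -> E) :=
  forall x e, 0 < e -> exists n, `|x - w n| < e.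

Lemma separable_dense_seq (R : realType) (E : normedModType R) :
  separable_space E -> exists w : nat -> E, dense_seq w.
Proof.
move=> [D cD Dd]; have [w wD] := countable_sub_range 0 cD.
exists w => x e e0.
have [y [xy /wD[n _ wny]]] : (ball x e)^° `&` D !=set0.
  apply: Dd; last exact: open_interior.
  by exists x; apply: nbhsx_ballx.
exists n; rewrite wny.
by move/interior_subset : xy; rewrite -ball_normE.
Qed.

Lemma dense_seq_comp (R : realType) (E F : normedModType R) (f : clin E F) (w : nat -> E) :
  dense (range f) -> dense_seq w -> dense_seq (f \o w).
Proof.
move=> fd wd x e e0.
have e2 : 0 < e / 2 by rewrite divr_gt0.
have [y [xy [z _ zy]]] : (ball x (e / 2))^° `&` range f !=set0.
  apply: fd; last exact: open_interior.
  by exists x; apply: nbhsx_ballx.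
have [C C0 fC] := clin_bounded f.
have [n zn] := wd z (e / 2 / C) (divr_gt0 e2 C0).
exists n => /=.
have -> : x - f (w n) = (x - f z) + f (z - w n) by rewrite linearB/= addrA subrK.
rewrite (le_lt_trans (ler_normD _ _))//.
move/interior_subset : xy; rewrite -ball_normE/= zy => xy.
have : `|f (z - w n)| < e / 2.
  by rewrite (le_lt_trans (fC _))// mulrC -ltr_pdivlMr.
by rewrite -zy in xy *; lra.
Qed.

Section Ehrling.
Context (R : realType) (V H : completeNormedModType R) (ip : {dot H for idfun}).
Hypothesis ip_norm : forall x : H, ip x x = `|x| ^+ 2.
Variables (i : clin V H) (h : nat -> H).
Hypotheses (i_compact : compact_operator i) (h_dense : dense_seq h).

Lemma dense_ip_eq0 x : (forall n, ip (h n) x = 0) -> x = 0.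
Proof.
move=> hx; apply/eqP; apply: contraT => x0.
have nx : 0 < `|x| by rewrite normr_gt0.
have [n hn] := h_dense x nx.
have : `|x| ^+ 2 <= `|x - h n| * `|x|.
  rewrite -ip_norm -[X in X <= _]subr0 -(hx n) -linearBl.
  by rewrite (le_trans (ler_norm _))// ip_norm_le.
by rewrite expr2 ler_pM2r// leNgt hn.
Qed.

(** Ehrling's inequality, with the norm of the largest space replaced by finitely
   many functionals. *)
Lemma ehrling e : 0 < e -> exists N : nat, forall v,
  `|i v| <= e * `|v| + N%:R * \sum_(k < N) `|ip (h k) (i v)|.
Proof.
move=> e0; apply: contrapT => nN.
(* By homogeneity a failure can be moved into the unit ball. The same [N] is the number of
   functionals and their weight. *)
have bad N : exists v, `|v| <= 1 /\ e + N%:R * \sum_(k < N) `|ip (h k) (i v)| < `|i v|.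
  apply: contrapT => nv; apply: nN; exists N => v.
  have [->|v0] := eqVneq v 0.
    by rewrite linear0 normr0 addr_ge0 ?mulr_ge0 ?sumr_ge0// ltW.
  have nv0 : 0 < `|v| by rewrite normr_gt0.
  rewrite leNgt; apply/negP => vN; apply: nv; exists (`|v|^-1 *: v).
  rewrite normrZ normfV normr_id mulVf ?gt_eqF//; split=> //.
  rewrite linearZ/= normrZ normfV normr_id ltr_pdivlMl//.
  rewrite mulrDr [_ * e]mulrC; apply: le_lt_trans vN.
  rewrite lerD2l mulrCA ler_wpM2l// mulr_sumr ler_sum// => k _.
  by rewrite linearZr_LR/= normrM normfV normr_id mulrA divff ?mul1r// gt_eqF.
have [v Hv] := choice bad.
have cA : compact (closure (i @` [set v | `|v| <= 1])).
  rewrite -precompactE; apply: i_compact.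
  by exists 1; split=> // M M1 x /= x1; rewrite (le_trans x1)// ltW.
have [z [_ zc]] : closure (i @` [set v | `|v| <= 1]) `&` cluster ((fun n => i (v n)) @ \oo) !=set0.
  apply: cA; exists 0%N => // n _; apply: subset_closure.
  by exists (v n) => //; exact: (Hv n).1.
have freq d N : 0 < d -> exists2 n, (N <= n)%N & `|z - i (v n)| < d.
  move=> d0.
  have [_ [[n Nn <-] zn]] : (fun n => i (v n)) @` [set n | (N <= n)%N] `&` ball z d !=set0.
    apply: zc; last exact: nbhsx_ballx.
    by exists N => // n /= Nn; exists n.
  by exists n => //; move: zn; rewrite -ball_normE.
have iv n : `|i (v n)| <= opnorm i by apply: opnorm_ub; exact: (Hv n).1.
(* For [k < n] the term of index [k] occurs in the sum, so its value at [v n] is at most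
   [opnorm i / n]. The index chosen below exceeds [k] and makes this quotient smaller than
   [d / 2]. *)
have z0 : z = 0.
  apply: dense_ip_eq0 => k; apply/eqP; rewrite -normr_le0; apply/ler_addgt0Pr => d d0.
  rewrite add0r.
  pose c := `|h k| + 1.
  have c0 : 0 < c by rewrite ltr_wpDl.
  have [n Nn zn] := freq (d / 2 / c) (maxn k.+1 (Num.truncn (2 * opnorm i / d)).+1) (divr_gt0 (divr_gt0 d0 (ltr0Sn _ 1)) c0).
  have kn : (k < n)%N by rewrite (leq_trans _ Nn)// leq_max leqnn.
  have nd : 2 * opnorm i / d < n%:R.
    rewrite (lt_le_trans (truncnS_gt _))// ler_nat (leq_trans _ Nn)// leq_max leqnn orbT//.
  have -> : ip (h k) z = ip (h k) (z - i (v n)) + ip (h k) (i (v n)).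
    by rewrite linearBr/= subrK.
  rewrite (le_trans (ler_normD _ _))//.
  have b1 : `|ip (h k) (z - i (v n))| <= d / 2.
    rewrite (le_trans (ip_norm_le ip_norm _ _))//.
    rewrite (le_trans (_ : _ <= c * (d / 2 / c)))//.
      by apply: ler_pM => //; [rewrite /c lerDl | exact: ltW].
    by rewrite mulrC divfK ?gt_eqF.
  have b2 : `|ip (h k) (i (v n))| <= d / 2.
    have n0 : 0 < n%:R :> R by rewrite ltr0n (leq_trans _ kn).
    have H1 : n%:R * `|ip (h k) (i (v n))| <= opnorm i.
      apply: le_trans (iv n); apply: le_trans (ltW (Hv n).2).
      rewrite -[leLHS]add0r lerD ?(ltW e0)// ler_wpM2l ?(ltW n0)//.
      rewrite (bigD1 (Ordinal kn))//= lerDl sumr_ge0//.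
    move: nd; rewrite ltr_pdivrMr// => nd.
    rewrite -(ler_pM2l n0) (le_trans H1)//; lra.
  lra.
have [n _ zn] := freq e 0%N e0.
move: zn; rewrite z0 sub0r normrN ltNge => /negP; apply.
apply: le_trans (ltW (Hv n).2); rewrite lerDl.
by rewrite mulr_ge0// sumr_ge0.
Qed.

End Ehrling.

(** * Bochner measurability and Lp spaces *)

Section StrongMeasurability.
Context d (X : measurableType d) (R : realType).
Implicit Types E F : normedModType R.

(** Pettis' criterion: [f] is the limit of the maps sending [x] to a point nearest to
   [f x] among [w 0, ..., w n]. *)
Lemma strongly_measurable_dist E (f : X -> E) (w : nat -> E) :
  (forall x e, 0 < e -> exists n, `|f x - w n| < e) ->
  (forall n, measurable_fun setT (fun x => `|f x - w n|)) ->
  strongly_measurable f.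
Proof.
move=> fw mfw.
pose s := fix s n := if n is m.+1 then
  fun x => if `|f x - w n| < `|f x - s m x| then w n else s m x else fun=> w 0%N.
have ms n : measurable_fun setT (fun x => `|f x - s n x|).
  elim: n => [|n IH]; first exact: mfw.
  apply: (eq_measurable_fun (fun x => Num.min `|f x - w n.+1| `|f x - s n x|)).
    by move=> x _ /=; case: ltP.
  exact: measurable_minr.
have slt n : measurable [set x | `|f x - w n.+1| < `|f x - s n x|].
  have := measurable_fun_ltr (mfw n.+1) (ms n).
  by move=> /(_ measurableT [set true] I); rewrite setTI.
exists s => [n|x].
  elim: n => [|n IH]; first exact: simple_map_cst.
  have sb : simple_map (fun x => `|f x - w n.+1| < `|f x - s n x|).
    split=> [|b]; first exact: finite_finset.
    case: b; first exact: slt.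
    rewrite (_ : _ @^-1` _ = ~` [set x | `|f x - w n.+1| < `|f x - s n x|]).
      exact: measurableC.
    by apply/seteqP; split=> x /=; [move=> -> | move/negP/negbTE].
  exact: (simple_map_comp (fun p : bool * E => if p.1 then w n.+1 else p.2) (simple_map_pair sb IH)).
have sw n m : (m <= n)%N -> `|f x - s n x| <= `|f x - w m|.
  elim: n => [|n IH]; first by rewrite leqn0 => /eqP ->.
  rewrite leq_eqVlt => /predU1P[->|/IH mn] /=; first by case: ltP.
  by case: ltP => // /ltW/le_trans; apply.
apply/cvgrPdist_lt => e e0; have [N fN] := fw x e e0.
by exists N => // n /= Nn; apply: le_lt_trans fN; exact: sw.
Qed.

Lemma strongly_measurable_range E (f : X -> E) : strongly_measurable f ->
  exists w : nat -> E, forall x e, 0 < e -> exists n, `|f x - w n| < e.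
Proof.
move=> [s ss sf].
have [|w Hw] := @countable_sub_range E (\bigcup_n range (s n)) 0.
  apply: bigcup_countable => // n _; apply: finite_set_countable; exact: (ss n).1.
exists w => x e e0; have /cvgrPdist_lt/(_ e e0)[N _ HN] := sf x.
have [n _ wn] : range w (s N x) by apply: Hw; exists N => //; exists x.
by exists n; rewrite wn; exact: (HN N (leqnn N)).
Qed.

Lemma strongly_measurable_sub E (f g : X -> E) : strongly_measurable f ->
  strongly_measurable g -> strongly_measurable (fun x => f x - g x).
Proof.
move=> mf mg; rewrite (_ : (fun x => _) = fun x => (-1) *: g x + f x).
  exact: strongly_measurable_lin.
by apply/funext => x; rewrite scaleN1r addrC.
Qed.

(** A sequence that approximates the values of all [f n] also approximates those of the limit, so
    Pettis' criterion applies. *)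
Lemma strongly_measurable_lim E (f : nat -> X -> E) (g : X -> E) :
  (forall n, strongly_measurable (f n)) -> (forall x, f n x @[n --> \oo] --> g x) ->
  strongly_measurable g.
Proof.
move=> mf fg.
have [w Hw] := choice (fun n => strongly_measurable_range (mf n)).
have [|v Hv] := @countable_sub_range E (\bigcup_n range (w n)) 0.
  apply: bigcup_countable => // n _; exact: countable_range.
apply: (strongly_measurable_dist (w := v)) => [x e e0|n].
  have e2 : 0 < e / 2 by rewrite divr_gt0.
  have /cvgrPdist_lt/(_ _ e2)[N _ HN] := fg x.
  have [k wk] := Hw N x _ e2.
  have [n _ vn] : range v (w N k) by apply: Hv; exists N => //; exists k.
  exists n; rewrite vn.
  have -> : g x - w N k = (g x - f N x) + (f N x - w N k) by rewrite addrA subrK.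
  rewrite (le_lt_trans (ler_normD _ _))//.
  by have := HN N (leqnn N) => /=; lra.
apply: (@measurable_fun_cvg _ _ _ _ (fun m x => `|f m x - v n|)) => [m|x _].
  by apply: measurable_normr_strongly; apply: strongly_measurable_sub => //; exact: strongly_measurable_cst.
by apply: cvg_norm; apply: cvgB; [exact: fg | exact: cvg_cst].
Qed.

Lemma strongly_measurable_real (f : X -> R) : measurable_fun setT f ->
  strongly_measurable (f : X -> R^o).
Proof.
move=> mf.
have [|w Hw] := @countable_sub_range R (range (@ratr R)) 0.
  exact: countable_range.
apply: (strongly_measurable_dist (w := w)) => [x e e0|n].
  have [|q] := @rat_in_itvoo R (f x) (f x + e); first by rewrite ltrDl.
  rewrite in_itv/= => /andP[q1 q2].
  have [n _ wn] : range w (ratr q) by apply: Hw; exists q.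
  exists n; rewrite wn ltr_distlC; lra.
apply: measurableT_comp => //; exact: measurable_funB.
Qed.

Lemma measurable_fun_strongly (f : X -> R) : strongly_measurable (f : X -> R^o) ->
  measurable_fun setT f.
Proof.
move=> [s ss sf].
apply: (@measurable_fun_cvg _ _ _ _ s) => [n|x _]; last exact: sf.
by move=> _ B mB; rewrite setTI; exact: simple_map_preimage.
Qed.

Lemma strongly_measurable_bilin E F (G : normedModType R) (b : E -> F -> G) (f : X -> E) (g : X -> F) :
  (forall (u : nat -> E) (v : nat -> F) x y, u @ \oo --> x -> v @ \oo --> y ->
    b (u n) (v n) @[n --> \oo] --> b x y) ->
  strongly_measurable f -> strongly_measurable g -> strongly_measurable (fun x => b (f x) (g x)).
Proof.
move=> bc [s ss sf] [t st tg]; exists (fun n x => b (s n x) (t n x)) => [n|x].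
  exact: (simple_map_comp (fun p => b p.1 p.2) (simple_map_pair (ss n) (st n))).
exact: bc.
Qed.

Lemma strongly_measurable_scale E (a : X -> R) (f : X -> E) : measurable_fun setT a ->
  strongly_measurable f -> strongly_measurable (fun x => a x *: f x).
Proof.
move=> /strongly_measurable_real ma; apply: (strongly_measurable_bilin (b := fun (a : R^o) x => (a : R) *: x)) ma.
by move=> u v x y ux vy; apply: cvgZ.
Qed.

Lemma measurable_apply E (f : X -> dual E) (u : X -> E) : strongly_measurable f ->
  strongly_measurable u -> measurable_fun setT (fun x => f x (u x) : R).
Proof.
move=> mf mu; apply: measurable_fun_strongly.
apply: (strongly_measurable_bilin (b := fun (f : dual E) x => f x)) mf mu.
move=> f_ u_ g v fg uv.
have fgv : (fun n => (g - f_ n) (u_ n)) @ \oo --> (0 : R^o).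
  have H : `|g - f_ n| * `|u_ n| @[n --> \oo] --> (0 : R).
    rewrite -(mul0r `|v|); apply: cvgM; last exact: cvg_norm.
    rewrite -(normr0 (dual E)) -(subrr g); apply: cvg_norm; apply: cvgB => //; exact: cvg_cst.
  apply/cvgr0Pnorm_le => e e0; move/cvgr0Pnorm_le : H => /(_ e e0); apply: filterS => n.
  rewrite ger0_norm ?mulr_ge0//; apply: le_trans; exact: opnormP.
have -> : (fun n => f_ n (u_ n)) = (fun n => g (u_ n) - (g - f_ n) (u_ n)).
  by apply/funext => n; rewrite -[(g - f_ n) _]/(g (u_ n) - f_ n (u_ n)) opprB addrCA subrr addr0.
rewrite -[X in _ --> X]subr0; apply: cvgB => //.
by apply: continuous_cvg uv; exact: clin_continuous.
Qed.

(** A closed set is the zero set of the distance to it, and the distance of [f] to it is a limit of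
    real simple functions. *)
Lemma measurable_preimage_closed E (f : X -> E) (C : set E) : strongly_measurable f ->
  closed C -> measurable (f @^-1` C).
Proof.
move=> mf cC.
have [->|/set0P[c0 Cc0]] := eqVneq C set0; first by rewrite preimage_set0.
pose dist y := inf [set `|y - c| | c in C].
have hi y : has_inf [set `|y - c| | c in C].
  by split; [exists `|y - c0|, c0 | exists 0 => _ [c _ <-]].
have dist0 y : (dist y <= 0) = (y \in C).
  apply/idP/idP => [d0|]; last first.
    rewrite inE => Cy; rewrite -(normr0 E) -(subrr y).
    by apply: ge_inf; [exact: (hi y).2 | exists y].
  rewrite inE; apply: cC => B /nbhs_ballP[e /= e0 yB].
  have [_ [c Cc <-] ce] := inf_adherent e0 (hi y).
  exists c; split=> //; apply: yB; rewrite -ball_normE/=.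
  by rewrite (lt_le_trans ce)// -/(dist y); lra.
have dist_lip y z : dist y <= dist z + `|y - z|.
  rewrite -lerBlDr; apply: lb_le_inf; first exact: (hi z).1.
  move=> _ [c Cc <-]; rewrite lerBlDr; apply: (@le_trans _ _ `|y - c|).
    by apply: ge_inf; [exact: (hi y).2 | exists c].
  have -> : y - c = (z - c) + (y - z) by rewrite [RHS]addrC addrA subrK.
  exact: ler_normD.
have mdist : measurable_fun setT (dist \o f).
  have [s ss sf] := mf.
  apply: (@measurable_fun_cvg _ _ _ _ (fun n x => dist (s n x))) => [n|x _].
    move=> _ B mB; rewrite setTI.
    exact: (simple_map_preimage B (simple_map_comp dist (ss n))).
  apply/cvgrPdist_le => e e0; have /cvgrPdist_le/(_ e e0) := sf x.
  apply: filterS => n xn; rewrite ler_norml.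
  have := dist_lip (f x) (s n x); have := dist_lip (s n x) (f x); rewrite distrC.
  by move: xn => /= xn h1 h2; apply/andP; split=> /=; lra.
have -> : f @^-1` C = (dist \o f) @^-1` `]-oo, 0].
  by apply/seteqP; split=> x /=; rewrite in_itv/= dist0 inE.
by rewrite -[_ @^-1` _]setTI; apply: mdist => //; exact: measurable_itv.
Qed.

End StrongMeasurability.

(** * Real integrals and almost everywhere relations *)

Section RealIntegrals.
Context d (X : measurableType d) (R : realType) (mu : {measure set X -> \bar R}).
Implicit Types f g : X -> R.

Lemma ae_le_integrable f g : measurable_fun setT f -> mu.-integrable setT (EFin \o g) ->
  {ae mu, forall x, `|f x| <= g x} -> mu.-integrable setT (EFin \o f).
Proof.
move=> mf ig fg; have [mg gfin] := integrableP _ _ _ ig.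
have mf' : measurable_fun setT (EFin \o f) by exact/measurable_EFinP.
apply/integrableP; split=> //; apply: le_lt_trans gfin.
apply: ae_ge0_le_integral => //.
- by apply: measurableT_comp.
- by apply: measurableT_comp.
apply: filterS fg => x fgx _; rewrite /= lee_fin (le_trans fgx)//.
by rewrite ler_norm.
Qed.

Lemma EFin_Rintegral f : mu.-integrable setT (EFin \o f) ->
  (\int[mu]_x f x)%:E = (\int[mu]_x (f x)%:E)%E.
Proof. by move=> intf; rewrite fineK//; apply: (integrable_fin_num measurableT intf). Qed.

Lemma eq_Rintegral_ae f g : measurable_fun setT f -> measurable_fun setT g ->
  {ae mu, forall x, f x = g x} -> \int[mu]_x f x = \int[mu]_x g x.
Proof.
move=> mf mg fg; congr fine; apply: ae_eq_integral => //; try exact/measurable_EFinP.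
by apply: filterS fg => x -> _.
Qed.

Lemma le_Rintegral_ae f g : mu.-integrable setT (EFin \o f) ->
  mu.-integrable setT (EFin \o g) -> {ae mu, forall x, f x <= g x} ->
  \int[mu]_x f x <= \int[mu]_x g x.
Proof.
move=> intf intg fg.
have mf : measurable_fun setT f by apply/measurable_EFinP; exact: measurable_int intf.
have mg : measurable_fun setT g by apply/measurable_EFinP; exact: measurable_int intg.
(* [g] is changed on a null set so that the inequality holds everywhere. *)
pose h x := Num.max (f x) (g x).
have mh : measurable_fun setT h by exact: measurable_maxr.
have gh : {ae mu, forall x, g x = h x} by apply: filterS fg => x fgx; rewrite /h max_r.
rewrite (eq_Rintegral_ae mg mh gh); apply: le_Rintegral => //.
  apply: (ae_le_integrable mh (integrable_norm intg)).
  by apply: filterS gh => x <-.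
by move=> x _; rewrite /h le_max lexx.
Qed.

Lemma Rintegral_le_cst f C : (forall x, 0 <= f x) -> measurable_fun setT f ->
  (\int[mu]_x (f x)%:E <= C%:E)%E ->
  mu.-integrable setT (EFin \o f) /\ \int[mu]_x f x <= C.
Proof.
move=> f0 mf fC.
have intf : mu.-integrable setT (EFin \o f).
  apply/integrableP; split; first exact/measurable_EFinP.
  rewrite (eq_integral (fun x => (f x)%:E)); first exact: le_lt_trans fC (ltry _).
  by move=> x _ /=; rewrite ger0_norm.
by split=> //; rewrite -lee_fin EFin_Rintegral.
Qed.

(** The last hypothesis spells out that [g] is almost everywhere at most the lower limit of [f n];
    it can be checked where [f n x] itself has no limit. *)
Lemma fatou_le (f : nat -> X -> R) g C : (forall n, measurable_fun setT (f n)) ->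
  measurable_fun setT g -> (forall n x, 0 <= f n x) -> (forall x, 0 <= g x) ->
  (forall n, (\int[mu]_x (f n x)%:E <= C%:E)%E) ->
  {ae mu, forall x, forall c, c < g x -> exists N, forall n, (N <= n)%N -> c <= f n x} ->
  (\int[mu]_x (g x)%:E <= C%:E)%E.
Proof.
move=> mf mg f0 g0 fC fg.
apply: (@le_trans _ _ (\int[mu]_x limn_einf (fun n => (f n x)%:E))%E).
  have mlim : measurable_fun setT (fun x => limn_einf (fun n => (f n x)%:E)).
    rewrite /limn_einf; apply: measurableT_comp => //.
    apply: (measurable_fun_limn_esup (f := fun n x => (- (f n x)%:E)%E)) => n.
    by apply: measurableT_comp => //; exact/measurable_EFinP.
  have lim_ge x c N : (forall n, (N <= n)%N -> (c <= f n x)) ->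
      (c%:E <= limn_einf (fun n => (f n x)%:E))%E.
    move=> cN; rewrite -[limn_einf _]/(limf_einf _ \oo) limf_einfE.
    have : (c%:E <= ereal_inf [set (f n x)%:E | n in [set n | (N <= n)%N]])%E.
      by apply: le_ereal_inf_tmp => _ [n /= Nn <-]; rewrite lee_fin cN.
    move=> /le_trans; apply; apply: ereal_sup_ubound => /=.
    by exists [set n | (N <= n)%N] => //; exists N.
  have lim0 x : (0 <= limn_einf (fun n => (f n x)%:E))%E by apply: (lim_ge x 0 0%N).
  apply: ae_ge0_le_integral => //.
  - by move=> x _; rewrite lee_fin.
  - exact/measurable_EFinP.
  apply: filterS fg => x fgx _; apply/lee_subgt0Pr => e e0.
  have [N HN] := fgx (g x - e) (ltac:(by rewrite ltrBlDr ltrDl)).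
  exact: lim_ge HN.
apply: le_trans (fatou _ _ _ _) _ => //.
- by move=> n; exact/measurable_EFinP.
- by move=> n x _; rewrite lee_fin.
rewrite -[limn_einf _]/(limf_einf _ \oo) limf_einfE; apply: ge_ereal_sup => _ [A [N _ NA] <-].
apply: ge_ereal_inf; exists (\int[mu]_x (f N x)%:E)%E => //.
by exists N => //; apply: NA => /=.
Qed.

(** The integral of the sum of the series is at most 2, so the series converges almost everywhere
    and its terms tend to 0. *)
Lemma ae_cvg0 (g : nat -> X -> R) : (forall n, measurable_fun setT (g n)) ->
  (forall n x, 0 <= g n x) -> (forall n, (\int[mu]_x (g n x)%:E <= (2^-1 ^+ n)%:E)%E) ->
  {ae mu, forall x, g n x @[n --> \oo] --> (0 : R)}.
Proof.
move=> mg g0 gle.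
pose S x := (\big[+%E/0%E]_(0 <= n <oo) (g n x)%:E)%E.
have mS : measurable_fun setT S.
  apply: ge0_emeasurable_sum => [n x _ _|n _]; first by rewrite lee_fin.
  exact/measurable_EFinP.
have S0 x : (0 <= S x)%E by apply: nneseries_ge0 => n _ _; rewrite lee_fin.
have intS : mu.-integrable setT S.
  apply/integrableP; split=> //.
  rewrite (eq_integral S); last by move=> x _; rewrite gee0_abs.
  rewrite integral_nneseries//; last first.
  - by move=> n x _; rewrite lee_fin.
  - by move=> n; exact/measurable_EFinP.
  apply: (@le_lt_trans _ _ (\big[+%E/0%E]_(0 <= n <oo) (2^-1 ^+ n)%:E)%E).
    by apply: lee_nneseries => [n _ _|n _]; [apply: integral_ge0 => x _; rewrite lee_fin | exact: gle].
  apply: (@le_lt_trans _ _ 2%:E); last exact: ltry.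
  apply: lime_le; first by apply: is_cvg_nneseries => n _ _; rewrite lee_fin exprn_ge0.
  apply: nearW => n; rewrite sumEFin lee_fin.
  have -> : \sum_(0 <= k < n) 2^-1 ^+ k = 2 - 2 * 2^-1 ^+ n :> R.
    elim: n => [|n IH]; first by rewrite big_nil expr0; ring.
    by rewrite big_nat_recr//= IH exprS; field.
  by rewrite gerBl mulr_ge0// exprn_ge0.
have := integrable_ae measurableT intS.
apply: filterS => x /(_ I) Sx.
apply: (@cvg_series_cvg_0 R R^o); apply: nondecreasing_is_cvgn.
  apply/nondecreasing_seqP => n; rewrite /series/= big_nat_recr//= lerDl.
  exact: g0.
exists (fine (S x)) => _ [n _ <-]; rewrite -lee_fin fineK// /series/= -sumEFin.
by apply: nneseries_lim_ge => k _; rewrite lee_fin.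
Qed.

End RealIntegrals.

(** * Norms and almost everywhere convergence in [Lp] *)

Section LpNorm.
Local Open Scope quotient_scope.
Context d (X : measurableType d) (R : realType) (mu : {measure set X -> \bar R}).
Variables (p : R) (p1 : (1 <= p%:E)%E) (E : normedModType R).
Implicit Types f g : X -> E.
Local Notation Lp := (Lp mu p1 E).

Let p_ge1 : 1 <= p. Proof. by move: p1; rewrite lee_fin. Qed.
Let p0 : 0 < p. Proof. exact: lt_le_trans p_ge1. Qed.

Lemma bochner_normE f :
  bochner_norm mu p%:E f = ((\int[mu]_x (`|f x| `^ p)%:E) `^ p^-1)%E.
Proof.
rewrite /bochner_norm unlock /Lnorm; congr (_ `^ _)%E; apply: eq_integral => x _.
by rewrite abse_EFin normr_id poweR_EFin.
Qed.

Lemma measurable_pow_norm f : strongly_measurable f ->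
  measurable_fun setT (fun x => `|f x| `^ p).
Proof.
by move=> mf; apply: (measurableT_comp (@measurable_powR R p)); exact: measurable_normr_strongly.
Qed.

Lemma in_Lp_integrable f : in_Lp mu p%:E f ->
  mu.-integrable setT (EFin \o (fun x => `|f x| `^ p)).
Proof.
move=> [mf]; rewrite bochner_normE => ff.
apply/integrableP; split; first by apply/measurable_EFinP; exact: measurable_pow_norm.
rewrite (eq_integral (fun x => (`|f x| `^ p)%:E)); last first.
  by move=> x _ /=; rewrite ger0_norm ?powR_ge0.
by apply: lty_poweRy ff; rewrite invr_neq0// gt_eqF.
Qed.

Lemma integrable_in_Lp f : strongly_measurable f ->
  mu.-integrable setT (EFin \o (fun x => `|f x| `^ p)) -> in_Lp mu p%:E f.
Proof.
move=> mf /integrable_lty intf; split=> //; rewrite bochner_normE poweR_lty//.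
exact: intf.
Qed.

Lemma in_Lp_Lp f : in_Lp mu p%:E f -> exists u : Lp, {ae mu, forall x, u x = f x}.
Proof.
move=> ff; have fP : f \in in_Lp_pred mu p1 (E := E) by rewrite inE.
by exists (\pi_Lp (LpFun fP)); exact: Lp_repr_pi.
Qed.

Lemma Lp_integrable (u : Lp) : mu.-integrable setT (EFin \o (fun x => `|u x| `^ p)).
Proof. exact: in_Lp_integrable (Lp_in_Lp u). Qed.

Lemma Lp_norm_pow (u : Lp) : `|u| `^ p = \int[mu]_x (`|u x| `^ p).
Proof.
apply: EFin_inj; rewrite (EFin_Rintegral (Lp_integrable u)) -poweR_EFin.
have -> : (`|u|%:E = bochner_norm mu p%:E u)%E := Lp_normE u.
by rewrite bochner_normE -poweRrM mulVf ?gt_eqF// poweRe1// integral_ge0// => x _; rewrite lee_fin powR_ge0.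
Qed.

Lemma Lp_norm_le (u : Lp) C : 0 <= C -> (`|u| <= C) = (\int[mu]_x (`|u x| `^ p) <= C `^ p).
Proof.
move=> C0; rewrite -Lp_norm_pow; apply/idP/idP => [|H]; first exact: powR_le (ltW p0) _.
rewrite -[`|u|](powRK p0)// -[C](powRK p0)//; apply: powR_le => //; first by rewrite invr_ge0 ltW.
Qed.

Lemma LpB (u v : Lp) : {ae mu, forall x, (u - v : Lp) x = u x - v x}.
Proof.
have h := LpZ (-1) v; rewrite scaleN1r in h.
apply: filterS2 (LpD u (- v)) h => x -> ->; by rewrite scaleN1r.
Qed.

Lemma Lp_ae_eq (u v : Lp) : {ae mu, forall x, u x = v x} -> u = v.
Proof. by move=> uv; rewrite -[u]reprK -[v]reprK; apply/eqP/Lp_eqP. Qed.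

(** On a null set [f] is unconstrained, so the limit is modified there. *)
Lemma strongly_measurable_ae_lim (f : nat -> X -> E) :
  (forall n, strongly_measurable (f n)) -> {ae mu, forall x, cvgn (fun n => f n x)} ->
  exists g, strongly_measurable g /\ {ae mu, forall x, f n x @[n --> \oo] --> g x}.
Proof.
move=> mf [N [mN N0 fN]].
pose ind (x : X) : R := \1_(~` N) x.
have cv x : cvgn (fun n => ind x *: f n x).
  have [xN|nxN] := pselect (N x).
    have -> : (fun n => ind x *: f n x) = fun=> 0.
      by apply/funext => n; rewrite /ind indicE memNset ?scale0r// => /(_ xN).
    exact: is_cvg_cst.
  apply: is_cvgZr; apply: contrapT => nf; apply: nxN; exact: fN.
exists (fun x => limn (fun n => ind x *: f n x)); split.
  apply: (strongly_measurable_lim (f := fun n x => ind x *: f n x)) => [n|x]; last exact: cv.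
  apply: strongly_measurable_scale => //; exact: measurable_indic (measurableC mN).
exists N; split=> // x /= nx; apply: contrapT => xN; apply: nx.
have -> : (fun n => f n x) = fun n => ind x *: f n x.
  by apply/funext => n; rewrite /ind indicE mem_set// scale1r.
exact: cv.
Qed.

(** Fatou's lemma for the [p]-th powers of the norms. Only these norms are compared, which fits
    limits taken in a larger space than [E]. *)
Lemma Lp_fatou (f : nat -> Lp) g C : 0 <= C -> strongly_measurable g ->
  (forall n, `|f n| <= C) ->
  {ae mu, forall x c, c < `|g x| -> exists N, forall n, (N <= n)%N -> c <= `|f n x|} ->
  exists u : Lp, `|u| <= C /\ {ae mu, forall x, u x = g x}.
Proof.
move=> C0 mg fC fg.
have H : (\int[mu]_x (`|g x| `^ p)%:E <= (C `^ p)%:E)%E.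
  apply: (@fatou_le _ _ _ _ (fun n x => `|f n x| `^ p)).
  - by move=> n; exact: measurable_pow_norm (Lp_in_Lp _).1.
  - exact: measurable_pow_norm.
  - by move=> n x; exact: powR_ge0.
  - by move=> x; exact: powR_ge0.
  - by move=> n; rewrite -EFin_Rintegral ?lee_fin -?Lp_norm_le//; exact: Lp_integrable.
  apply: filterS fg => x fgx c cg.
  have [c0|c0] := leP c 0; first by exists 0%N => n _; rewrite (le_trans c0)// powR_ge0.
  have [|N HN] := fgx (c `^ p^-1).
    rewrite -[ltRHS](powRK p0)//; apply: gt0_ltr_powR; rewrite ?nnegrE ?powR_ge0 ?invr_gt0 ?ltW//.
  exists N => n Nn; rewrite -[c](powRKV p0 (ltW c0)); apply: powR_le (HN n Nn) => //.
  - exact: ltW.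
  - exact: powR_ge0.
have [intg gC] := Rintegral_le_cst (fun x => powR_ge0 _ _) (measurable_pow_norm mg) H.
have [u ug] := in_Lp_Lp (integrable_in_Lp mg intg).
exists u; split=> //; rewrite Lp_norm_le// (le_trans _ gC)//.
rewrite le_eqVlt; apply/orP; left; apply/eqP; apply: eq_Rintegral_ae.
- exact: measurable_pow_norm (Lp_in_Lp _).1.
- exact: measurable_pow_norm.
by apply: filterS ug => x ->.
Qed.

(** The [p]-th powers have integral at most [(2^n 4^-n)^p <= 2^-n]. The factor [2 ^+ n] records a
    geometric pointwise decay, which makes increments summable. *)
Lemma Lp_ae_cvg0 (u : nat -> Lp) : (forall n, `|u n| <= 4^-1 ^+ n) ->
  {ae mu, forall x, 2 ^+ n * `|u n x| @[n --> \oo] --> (0 : R)}.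
Proof.
move=> un.
have : {ae mu, forall x, (2 ^+ n * `|u n x|) `^ p @[n --> \oo] --> (0 : R)}.
  apply: ae_cvg0 => [n|n x|n].
  - apply: (measurableT_comp (@measurable_powR R p)); apply: measurable_funM => //.
    exact: measurable_normr_strongly (Lp_in_Lp _).1.
  - exact: powR_ge0.
  have n0 : 0 <= 2 ^+ n :> R by rewrite exprn_ge0.
  rewrite (eq_integral (fun x => ((2 ^+ n) `^ p)%:E * (`|u n x| `^ p)%:E)%E); last first.
    by move=> x _; rewrite -EFinM powRM.
  rewrite integralZl//; last exact: Lp_integrable.
  rewrite -EFin_Rintegral; last exact: Lp_integrable.
  rewrite -EFinM lee_fin -Lp_norm_pow -powRM//.
  apply: (@le_trans _ _ ((2^-1 ^+ n) `^ p)).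
    apply: powR_le; rewrite ?mulr_ge0 ?(ltW p0)//.
    apply: (@le_trans _ _ (2 ^+ n * 4^-1 ^+ n)); first by rewrite ler_wpM2l.
    rewrite -exprMn (_ : 2 * 4^-1 = 2^-1 :> R)//; by field.
  have h1 : 0 < (2^-1 ^+ n : R) <= 1 by rewrite exprn_gt0//= exprn_ile1// invf_le1// ler1n.
  exact: ge1r_powR.
apply: filterS => x xc.
have := @powR_cvg R p^-1 0 _ _ _ _ xc.
rewrite invr_gt0 powR0 ?invr_eq0 ?gt_eqF// => /(_ p0 (lexx 0) (fun n => powR_ge0 _ _)).
by under eq_fun do rewrite powRK ?mulr_ge0 ?exprn_ge0//.
Qed.

Lemma Lp_ae_subseq (u : nat -> Lp) (l : Lp) : u @ \oo --> l ->
  exists phi : nat -> nat, (forall n, n <= phi n)%N /\ {ae mu, forall x, u (phi n) x @[n --> \oo] --> l x}.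
Proof.
move=> ul.
have /choice[phi Hphi] : forall n, exists m, (n <= m)%N /\ `|u m - l| <= 4^-1 ^+ n.
  move=> n; have e0 : 0 < 4^-1 ^+ n :> R by rewrite exprn_gt0.
  have /cvgrPdist_le/(_ _ e0)[N _ HN] := ul.
  exists (maxn n N); rewrite leq_maxl; split=> //.
  by rewrite distrC; apply: HN => /=; rewrite leq_maxr.
exists phi; split=> [n|]; first exact: (Hphi n).1.
have h1 := Lp_ae_cvg0 (fun n => (Hphi n).2).
have h2 : {ae mu, forall x, forall n, (u (phi n) - l : Lp) x = u (phi n) x - l x}.
  by apply: ae_foralln => n; exact: LpB.
apply: filterS2 h1 h2 => x xc xB.
apply/subr_cvg0/cvgr0Pnorm_le => e e0.
move/cvgr0Pnorm_le : xc => /(_ e e0); apply: filterS => n.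
rewrite xB /= ger0_norm ?mulr_ge0 ?exprn_ge0//; apply: le_trans.
by rewrite ler_peMl// exprn_ege1// ler1n.
Qed.

End LpNorm.

(** * Completeness of [Lp] *)

Section LpComplete.
Context d (X : measurableType d) (R : realType) (mu : {measure set X -> \bar R}).
Variables (p : R) (p1 : (1 <= p%:E)%E) (E : completeNormedModType R).
Local Notation Lp := (Lp mu p1 E).

Lemma cvgn_geometric (x : nat -> E) (C : R) :
  (forall n, `|x n.+1 - x n| <= C * 2^-1 ^+ n) -> cvgn x.
Proof.
move=> xC.
have C0 : 0 <= C by have := xC 0%N; rewrite expr0 mulr1; apply: le_trans.
have tail n k : `|x (n + k)%N - x n| <= 2 * C * 2^-1 ^+ n.
  have : `|x (n + k)%N - x n| <= 2 * C * (2^-1 ^+ n - 2^-1 ^+ (n + k)).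
    elim: k => [|k IH]; first by rewrite addn0 !subrr normr0 mulr0.
    have -> : x (n + k.+1)%N - x n = (x (n + k).+1 - x (n + k)%N) + (x (n + k)%N - x n).
      by rewrite addnS addrA subrK.
    apply: le_trans (ler_normD _ _) _.
    apply: le_trans (lerD (xC (n + k)%N) IH) _.
    by rewrite addnS exprS le_eqVlt; apply/orP; left; apply/eqP; field.
  move=> /le_trans; apply; rewrite ler_wpM2l ?mulr_ge0//.
  by rewrite gerBl exprn_ge0.
apply: seq_cauchy_cvg => e e0.
have c : (4 * C) * 2^-1 ^+ n @[n --> \oo] --> (0 : R).
  rewrite -(mulr0 (4 * C)); apply: cvgMr.
  have := @cvg_geometric R 1 2^-1; rewrite /geometric /=.
  under eq_fun do rewrite mul1r.
  by apply; rewrite ger0_norm// invf_lt1// ltr1n.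
have /cvgr0Pnorm_le/(_ _ e0)[N _ HN] := c.
exists N => n m Nn Nm.
have -> : x n - x m = (x n - x N) - (x m - x N) by rewrite opprB addrA subrK.
apply: le_trans (ler_normB _ _) _.
have := HN N (leqnn N); rewrite /= ger0_norm ?mulr_ge0 ?exprn_ge0// => h.
have := tail N (n - N)%N; have := tail N (m - N)%N; rewrite !subnKC// => h1 h2.
have -> : e = e / 2 + e / 2 by field.
have e4 : 2 * C * 2^-1 ^+ N <= e / 2 by rewrite ler_pdivlMr//; apply: le_trans h; rewrite le_eqVlt; apply/orP; left; apply/eqP; ring.
by apply: lerD; [exact: le_trans h2 e4 | exact: le_trans h1 e4].
Qed.

(** The Riesz-Fischer argument: a subsequence with geometric increments converges almost everywhere,
    and Fatou's lemma turns the pointwise limit into a limit in norm. *)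
Lemma Lp_complete (u : nat -> Lp) :
  (forall e, 0 < e -> exists N, forall n m, (N <= n)%N -> (N <= m)%N -> `|u n - u m| <= e) ->
  exists l : Lp, u @ \oo --> l.
Proof.
move=> uC.
have [N_ HN] : exists N_ : nat -> nat, forall k n m, (N_ k <= n)%N -> (N_ k <= m)%N ->
    `|u n - u m| <= 4^-1 ^+ k.
  have /choice[f Hf] : forall k, exists N, forall n m, (N <= n)%N -> (N <= m)%N ->
      `|u n - u m| <= 4^-1 ^+ k by move=> k; apply: uC; rewrite exprn_gt0.
  by exists f.
(* Partial sums make [phi] nondecreasing with [N_ k <= phi k]; the successors give [k <= phi k]. *)
pose phi k := (\sum_(0 <= l < k.+1) (N_ l).+1)%N.
have phiN k : (N_ k <= phi k)%N.
  by rewrite /phi big_nat_recr//= (leq_trans (leqnSn _))// leq_addl.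
have phi_ge k : (k <= phi k)%N.
  by elim: k => // k IH; rewrite /phi big_nat_recr//= addnS ltnS (leq_trans IH)// leq_addr.
have phiS k : (phi k <= phi k.+1)%N by rewrite {2}/phi big_nat_recr//= leq_addr.
have phi_mono k l : (k <= l)%N -> (phi k <= phi l)%N.
  by move=> /subnK <-; elim: (l - k)%N => // n /leq_trans; apply; rewrite addSn.
pose v k := u (phi k).
have vS k : `|v k.+1 - v k| <= 4^-1 ^+ k.
  by apply: HN; rewrite ?phiN// (leq_trans (phiN k)).
have h1 := Lp_ae_cvg0 vS.
have h2 : {ae mu, forall x, forall n, (v n.+1 - v n : Lp) x = v n.+1 x - v n x}.
  by apply: ae_foralln => n; exact: LpB.
have cv : {ae mu, forall x, cvgn (fun n => v n x)}.
  apply: filterS2 h1 h2 => x xc xB.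
  have [C HC] : exists C, forall n, 2 ^+ n * `|(v n.+1 - v n : Lp) x| <= C.
    have /cvg_seq_bounded[M [_ HM]] := cvgP _ xc.
    exists (M + 1) => n; have := HM (M + 1) (ltac:(by rewrite ltrDl)) n I.
    by apply: le_trans; exact: ler_norm.
  apply: (@cvgn_geometric _ C) => n.
  have n0 : 0 < 2 ^+ n :> R by rewrite exprn_gt0.
  by rewrite exprVn -xB ler_pdivlMr// mulrC.
have [g [mg vg]] := strongly_measurable_ae_lim (fun n => (Lp_in_Lp (v n)).1) cv.
have close e n k0 : 0 <= e -> (forall k, (k0 <= k)%N -> `|v k - u n| <= e) ->
    exists w : Lp, `|w| <= e /\ {ae mu, forall x, w x = g x - u n x}.
  move=> e0 ve; apply: (Lp_fatou (f := fun k => v (k + k0)%N - u n)) => //.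
  - by apply: strongly_measurable_sub => //; exact: (Lp_in_Lp _).1.
  - by move=> k; apply: ve; rewrite leq_addl.
  have h3 : {ae mu, forall x, forall k, (v k - u n : Lp) x = v k x - u n x}.
    by apply: ae_foralln => k; exact: LpB.
  apply: filterS2 vg h3 => x xc xB c cg.
  have : `|v k x - u n x| @[k --> \oo] --> `|g x - u n x|.
    by apply: cvg_norm; apply: cvgB => //; exact: cvg_cst.
  move=> /cvgrPdist_lt /(_ (`|g x - u n x| - c)); rewrite subr_gt0 => /(_ cg)[N _ HN'].
  exists N => k Nk; rewrite xB.
  have := HN' (k + k0)%N (leq_trans Nk (leq_addr _ _)) => /=.
  by have := ler_norm (`|g x - u n x| - `|v (k + k0)%N x - u n x|); lra.
(* So far [g] is only a measurable map; its class is recovered from that of its difference with one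
   term of the sequence. *)
have [w0 [_ w0g]] : exists w : Lp, `|w| <= 1 /\ {ae mu, forall x, w x = g x - u (phi 0%N) x}.
  apply: (@close _ _ 0%N) => // k _.
  by have := HN 0%N (phi k) (phi 0%N); rewrite expr0; apply; rewrite (leq_trans (phiN 0%N))// phi_mono.
pose l : Lp := w0 + u (phi 0%N).
have lg : {ae mu, forall x, l x = g x}.
  by apply: filterS2 (LpD w0 (u (phi 0%N))) w0g => x -> ->; rewrite subrK.
exists l; apply/cvgrPdist_le => e e0.
have [N HNe] := uC e e0.
exists N => // n /= Nn.
have [|k Nk|w [we wg]] := close e n N; first exact: ltW.
  by apply: HNe => //; rewrite (leq_trans Nk)// phi_ge.
suff -> : l - u n = w by [].
apply: Lp_ae_eq; apply: filterS3 (LpB l (u n)) lg wg => x -> -> ->.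
by [].
Qed.

End LpComplete.

(** * Measurability through sublevel sets *)

Section MeasurableCriteria.
Context d (X : measurableType d) (R : realType).

Lemma measurable_fun_le_sets (f : X -> R) :
  (forall r, measurable [set x | f x <= r]) -> measurable_fun setT f.
Proof.
move=> mf; apply: (measurability _ (RGenOInfty.measurableE R)) => // _ [_ [r ->] <-].
rewrite setTI (_ : _ @^-1` _ = ~` [set x | f x <= r]); first exact: measurableC.
by apply/seteqP; split=> x /=; rewrite in_itv/= andbT ltNge => /negP.
Qed.

Lemma measurable_le_set (f : X -> R) r : measurable_fun setT f ->
  measurable [set x | f x <= r].
Proof.
move=> mf; rewrite (_ : [set x | _] = f @^-1` `]-oo, r]%classic).
  by rewrite -[_ @^-1` _]setTI; apply: mf => //; exact: measurable_itv.
by apply/seteqP; split=> x /=; rewrite in_itv.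
Qed.

(** [f] is only assumed measurable when applied to the [v n]: a bound on the dual norm amounts to
    countably many inequalities along a dense sequence. *)
Lemma measurable_opnorm_sub (E : normedModType R) (v : nat -> E) (f : X -> dual E) (g : dual E) :
  dense_seq v -> (forall n, measurable_fun setT (fun x => f x (v n) : R)) ->
  measurable_fun setT (fun x => `|f x - g|).
Proof.
move=> vd mf; apply: measurable_fun_le_sets => r.
have [r0|r0] := ltP r 0.
  rewrite (_ : [set x | _] = set0)//; apply/seteqP; split=> x //= fr.
  by have := le_lt_trans fr r0; rewrite normr_lt0.
rewrite (_ : [set x | _] = \bigcap_n [set x | `|(f x (v n) : R) - g (v n)| <= r * `|v n|]).
  apply: bigcapT_measurable => n; apply: measurable_le_set.
  by apply: measurableT_comp => //; exact: measurable_funB.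
apply/seteqP; split=> x /=.
  move=> fr n _ /=; apply: le_trans (ler_wpM2r (normr_ge0 _) fr).
  exact: (opnormP (f x - g)).
move=> H; apply: opnorm_le => y y1; apply/ler_addgt0Pr => e e0.
(* [C] exceeds the total coefficient of [|y - v n|] in the estimates below. *)
pose C := r + opnorm (f x - g) + 1.
have C0 : 0 < C by rewrite ltr_wpDl// addr_ge0// opnorm_ge0.
have [n yn] := vd y (e / C) (divr_gt0 e0 C0).
have -> : (f x - g) y = (f x - g) (y - v n) + (f x - g) (v n) by rewrite -linearD/= subrK.
apply: le_trans (ler_normD _ _) _.
have h1 := opnormP (f x - g) (y - v n).
have h2 : `|(f x - g) (v n)| <= r * `|v n| := H n I.
have h3 : `|v n| <= 1 + `|y - v n|.
  rewrite [in leLHS](_ : v n = y - (y - v n)); last by rewrite opprB addrC subrK.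
  by apply: le_trans (ler_normB _ _) _; rewrite lerD2r.
have h4 : r * `|v n| <= r * (1 + `|y - v n|) by rewrite ler_wpM2l.
have h5 : C * `|y - v n| <= e by rewrite mulrC -ler_pdivlMr// ltW.
have h6 := normr_ge0 (y - v n).
move: h5; rewrite /C; lra.
Qed.

End MeasurableCriteria.

Section RealIntegrability.
Context d (X : measurableType d) (R : realType) (mu : {measure set X -> \bar R}).

Lemma Rintegral_dominated (f : nat -> X -> R) (g h : X -> R) :
  (forall n, measurable_fun setT (f n)) ->
  {ae mu, forall x, f n x @[n --> \oo] --> g x} -> measurable_fun setT g ->
  mu.-integrable setT (EFin \o h) -> (forall n x, `|f n x| <= h x) ->
  mu.-integrable setT (EFin \o g) /\ \int[mu]_x f n x @[n --> \oo] --> \int[mu]_x g x.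
Proof.
move=> mf fg mg ih fh.
have [||||ig _ cv] := @dominated_convergence _ _ _ mu _ measurableT
  (fun n => EFin \o f n) (EFin \o g) (EFin \o h) _ _ _ ih.
- by move=> n; exact/measurable_EFinP.
- exact/measurable_EFinP.
- by apply: filterS fg => x xc _; apply: cvg_EFin => //; exact: nearW.
- by apply: nearW => x n _; rewrite /= lee_fin.
split=> //; apply: fine_cvg.
by rewrite -EFin_Rintegral in cv.
Qed.

Lemma integrable_cst_fin (c : R) : (mu setT < +oo)%E ->
  mu.-integrable setT (EFin \o (fun _ : X => c)).
Proof.
move=> mufin; apply/integrableP; split; first exact/measurable_EFinP.
rewrite (eq_integral (fun=> `|c|%:E)); last by [].
by rewrite integral_cst// lte_mul_pinfty// lee_fin.
Qed.

Lemma integrableDR (f g : X -> R) : mu.-integrable setT (EFin \o f) ->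
  mu.-integrable setT (EFin \o g) -> mu.-integrable setT (EFin \o (fun x => f x + g x)).
Proof. by move=> If Ig; have := integrableD measurableT If Ig; apply: eq_integrable. Qed.

Lemma integrableBR (f g : X -> R) : mu.-integrable setT (EFin \o f) ->
  mu.-integrable setT (EFin \o g) -> mu.-integrable setT (EFin \o (fun x => f x - g x)).
Proof. by move=> If Ig; have := integrableB measurableT If Ig; apply: eq_integrable. Qed.

Lemma integrableZR (c : R) (f : X -> R) : mu.-integrable setT (EFin \o f) ->
  mu.-integrable setT (EFin \o (fun x => c * f x)).
Proof. by move=> If; have := integrableZl measurableT c If; apply: eq_integrable. Qed.

Lemma conjugate_young (p : R) (a b : R) : 1 < p -> 0 <= a -> 0 <= b ->
  a * b <= a `^ (p / (p - 1)) + b `^ p.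
Proof.
move=> p1 a0 b0; have p0 : 0 < p by rewrite (lt_trans ltr01).
have q0 : 0 < p / (p - 1) by rewrite divr_gt0// subr_gt0.
have q1 : 1 <= p / (p - 1) by rewrite ler_pdivlMr ?subr_gt0// mul1r gerBl.
have pq : (p / (p - 1))^-1 + p^-1 = 1 by field; rewrite !gt_eqF ?subr_gt0.
apply: le_trans (conjugate_powR a0 b0 q0 p0 pq) _.
by apply: lerD; rewrite ler_pdivrMr// ler_peMr ?powR_ge0// ltW.
Qed.

End RealIntegrability.

(** * The map between [Lp] spaces induced by an embedding *)

Section LpMap.
Context d (X : measurableType d) (R : realType) (mu : {measure set X -> \bar R}).
Variables (p : R) (p1 : (1 <= p%:E)%E) (V H : normedModType R) (i : clin V H).

Lemma Lp_mapE (u : Lp mu p1 V) : {ae mu, forall x, Lp_map i u x = i (u x)}.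
Proof. exact: Lp_repr_pi. Qed.

Lemma Lp_map_linear (a : R) (u v : Lp mu p1 V) :
  Lp_map i (a *: u + v) = a *: Lp_map i u + Lp_map i v.
Proof.
apply: Lp_ae_eq.
have h1 : {ae mu, forall x, Lp_map i (a *: u + v) x = a *: i (u x) + i (v x)}.
  have h : {ae mu, forall x, (a *: u + v : Lp mu p1 V) x = a *: u x + v x}.
    by apply: filterS2 (LpD (a *: u) v) (LpZ a u) => x -> ->.
  by apply: filterS2 (Lp_mapE (a *: u + v)) h => x -> ->; rewrite linearP.
have h2 : {ae mu, forall x, (a *: Lp_map i u + Lp_map i v : Lp mu p1 H) x =
    a *: Lp_map i u x + Lp_map i v x}.
  by apply: filterS2 (LpD (a *: Lp_map i u) (Lp_map i v)) (LpZ a (Lp_map i u)) => x -> ->.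
have h3 : {ae mu, forall x, Lp_map i u x = i (u x) /\ Lp_map i v x = i (v x)}.
  by apply: filterS2 (Lp_mapE u) (Lp_mapE v) => x.
by apply: filterS3 h1 h2 h3 => x -> -> [-> ->].
Qed.

Lemma Lp_map_clin : exists g : clin (Lp mu p1 V) (Lp mu p1 H), forall u, g u = Lp_map i u.
Proof.
have p_ge1 : 1 <= p by move: p1; rewrite lee_fin.
have p0 : 0 < p by exact: lt_le_trans p_ge1.
apply: (@bounded_clin _ _ _ (fun u : Lp mu p1 V => Lp_map i u : Lp mu p1 H) (opnorm i)) => [a u v|u].
  exact: Lp_map_linear.
rewrite Lp_norm_le ?mulr_ge0 ?opnorm_ge0//.
rewrite powRM ?opnorm_ge0// Lp_norm_pow -RintegralZl//; last exact: Lp_integrable.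
apply: le_Rintegral_ae; [exact: Lp_integrable | apply: integrableZR; exact: Lp_integrable |].
apply: filterS (Lp_mapE u) => x ->; rewrite -powRM ?opnorm_ge0//; apply: powR_le; rewrite ?(ltW p0)//.
exact: opnormP.
Qed.

End LpMap.

(** * Closed convex sets of Lp functions *)

Section GelfandLp.
Context d (X : measurableType d) (R : realType) (mu : {measure set X -> \bar R}).
Hypothesis mu_fin : (mu setT < +oo)%E.
Variables (p : R) (p1 : (1 <= p%:E)%E) (p_gt1 : 1 < p).
Context (V H : completeNormedModType R) (ip : {dot H for idfun}).
Hypothesis ip_norm : forall x : H, ip x x = `|x| ^+ 2.
Variable i : clin V H.
Hypotheses (V_reflexive : reflexive_space V) (i_inj : injective i).
Variables (v : nat -> V) (v_dense : dense_seq v).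

Local Notation LpV := (Lp mu p1 V).
Local Notation LpH := (Lp mu p1 H).

Let p0 : 0 < p. Proof. exact: lt_trans ltr01 p_gt1. Qed.

(** Balls of [V] are closed in [H], which gives both the measurability of the limit
   and the bound on its norm. *)
Lemma Lp_map_closed_ball (u : nat -> LpV) (z : LpH) M : 0 <= M ->
  (forall n, `|u n| <= M) -> (fun n => Lp_map i (u n)) @ \oo --> z ->
  exists w : LpV, `|w| <= M /\ Lp_map i w = z.
Proof.
move=> M0 uM uz.
have [phi [_ cphi]] := Lp_ae_subseq uz.
have cv : {ae mu, forall x, i (u (phi n) x) @[n --> \oo] --> z x}.
  have h1 : {ae mu, forall x, forall n, Lp_map i (u (phi n)) x = i (u (phi n) x)}.
    by apply: ae_foralln => n; exact: Lp_mapE.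
  apply: filterS2 cphi h1 => x xc xE.
  by have -> : (fun n => i (u (phi n) x)) = fun n => Lp_map i (u (phi n)) x by apply/funext => n.
have mz : strongly_measurable z := (Lp_in_Lp z).1.
have mball y r : measurable (z @^-1` (i @` [set v | `|v - y| <= r])).
  by apply: measurable_preimage_closed => //; exact: (closed_image_ball ip_norm).
(* [range i] is a countable union of images of balls, each closed in [H]. *)
pose G := z @^-1` range i.
have mG : measurable G.
  rewrite /G (_ : z @^-1` range i = \bigcup_n (z @^-1` (i @` [set v | `|v - 0| <= n%:R]))).
    by apply: bigcupT_measurable => n; exact: mball.
  apply/seteqP; split=> x /=; last by move=> [n _ [y _ yz]]; exists y.
  move=> [y _ yz]; exists (Num.truncn `|y|).+1 => //; exists y => //=.
  by rewrite subr0 ltW// truncnS_gt.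
(* [s] inverts [i] on its range, with default value 0 elsewhere. *)
have [s Hs] := choice (fun y : H => (ltac:(
  have [[y' _ <-]|n] := pselect (range i y);
  [exists y'; split=> // n; exfalso; apply: n; exists y' => //
  |exists 0; split=> //]) : exists y' : V, (range i y -> i y' = y) /\ (~ range i y -> y' = 0))).
pose w x := s (z x).
have wG x : G x -> i (w x) = z x by move=> Gx; exact: (Hs (z x)).1.
have wN x : ~ G x -> w x = 0 by move=> Gx; exact: (Hs (z x)).2.
(* Norms below [c] infinitely often would put [z x] in the closed image of the ball of radius [c].
   Off [G] the condition on [c] is vacuous, so there the norms tend to infinity. *)
have large x c : i (u (phi n) x) @[n --> \oo] --> z x -> (G x -> c < `|w x|) ->
    exists N, forall n, (N <= n)%N -> c <= `|u (phi n) x|.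
  move=> xc xw; apply: contrapT => nN.
  have : (i @` [set v | `|v - 0| <= c]) (z x).
    apply: (closed_image_ball ip_norm V_reflexive i_inj) => B /xc[N _ BN].
    have [n [Nn un]] : exists n, (N <= n)%N /\ `|u (phi n) x| < c.
      apply: contrapT => nn; apply: nN; exists N => n Nn; rewrite leNgt; apply/negP => un.
      by apply: nn; exists n.
    exists (i (u (phi n) x)); split; last exact: BN.
    by exists (u (phi n) x) => //=; rewrite subr0 ltW.
  move=> [y /=]; rewrite subr0 => yc yz.
  have Gx : G x by exists y.
  have := xw Gx; have -> : w x = y by apply: i_inj; rewrite wG.
  by rewrite ltNge yc.
have mw : strongly_measurable w.
  apply: (strongly_measurable_dist (w := v)) => [x e e0|n]; first exact: v_dense.
  apply: measurable_fun_le_sets => r.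
  have -> : [set x | `|w x - v n| <= r] =
      (z @^-1` (i @` [set y | `|y - v n| <= r])) `|` (~` G `&` [set x | `|0 - v n| <= r]).
    apply/seteqP; split=> x /=.
      have [Gx|nGx] := pselect (G x); first by move=> wr; left; exists (w x) => //; exact: wG.
      by rewrite (wN _ nGx); right.
    move=> [[y yr yz]|[nGx]]; last by rewrite (wN _ nGx).
    have Gx : G x by exists y.
    by have -> : w x = y by apply: i_inj; rewrite wG.
  apply: measurableU => //; apply: measurableI; first exact: measurableC.
  have [rr|rr] := boolP (`|0 - v n| <= r).
    by rewrite (_ : [set _ | _] = setT)//; apply/seteqP; split.
  by rewrite (_ : [set _ | _] = set0)//; apply/seteqP; split=> // x /= h'; rewrite h' in rr.
(* Since the norms blow up off [G], Fatou's lemma against [k] times its complement's indicator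
   bounds [k * mu (~] G)[by]M [^ p] for every [k]. *)
have GT : mu (~` G) = 0%E.
  have key (k : nat) : (k%:R%:E * mu (~` G) <= (M `^ p)%:E)%E.
    have := @fatou_le _ _ _ mu (fun n x => `|u (phi n) x| `^ p) (fun x => k%:R * \1_(~` G) x) (M `^ p).
    rewrite (eq_integral (fun x => k%:R%:E * (\1_(~` G) x)%:E)%E); last by [].
    rewrite ge0_integralZl//; last first.
      by apply/measurable_EFinP; exact: measurable_indic (measurableC mG).
    rewrite integral_indic// ?setIT; last exact: measurableC.
    apply => //.
    - by move=> n; exact: measurable_pow_norm (Lp_in_Lp _).1.
    - by apply: measurable_funM => //; exact: measurable_indic (measurableC mG).
    - by move=> n; rewrite -EFin_Rintegral ?lee_fin -?Lp_norm_le//; exact: Lp_integrable.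
    apply: filterS cv => x xc c.
    rewrite indicE; have [xG|nxG] := boolP (x \in ~` G).
      rewrite mulr1 => ck; move: xG; rewrite inE => xG.
      have [N HN] := large x (k%:R `^ p^-1) xc (fun Gx => False_ind _ (xG Gx)).
      exists N => n Nn; apply: le_trans (ltW ck) _; rewrite -[k%:R](powRKV p0)//.
      by apply: powR_le (ltW p0) _ (HN n Nn); exact: powR_ge0.
    by rewrite mulr0 => c0; exists 0%N => n _; rewrite (le_trans (ltW c0))// powR_ge0.
  apply/eqP; rewrite eq_le measure_ge0 andbT.
  have fin : mu (~` G) \is a fin_num.
    rewrite ge0_fin_numE//; apply: le_lt_trans mu_fin; apply: le_measure; rewrite ?inE//.
    exact: measurableC.
  rewrite -(fineK fin) lee_fin leNgt; apply/negP => m0.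
  have := key (Num.truncn (M `^ p / fine (mu (~` G)))).+1.
  rewrite -(fineK fin) -EFinM lee_fin leNgt => /negP; apply.
  by rewrite -ltr_pdivrMr// truncnS_gt.
have [w' [w'M w'E]] : exists w' : LpV, `|w'| <= M /\ {ae mu, forall x, w' x = w x}.
  apply: (Lp_fatou (f := fun n => u (phi n))) => //.
  by apply: filterS cv => x xc c cw; exact: (large x c xc).
exists w'; split=> //; apply: Lp_ae_eq.
have aeG : {ae mu, forall x, G x}.
  by exists (~` G); split=> //; exact: measurableC.
apply: filterS3 (Lp_mapE i w') w'E aeG => x -> -> Gx; exact: wG.
Qed.

End GelfandLp.

(** * The gradient of the [Lp] norm and separation *)

Section WeakClosedness.
Context d (X : measurableType d) (R : realType) (mu : {measure set X -> \bar R}).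
Hypothesis mu_fin : (mu setT < +oo)%E.
Variables (p : R) (p1 : (1 <= p%:E)%E) (p_gt1 : 1 < p).
Context (V H : completeNormedModType R) (ip : {dot H for idfun}).
Hypothesis ip_norm : forall x : H, ip x x = `|x| ^+ 2.
Variable i : clin V H.
Hypotheses (V_reflexive : reflexive_space V) (i_inj : injective i).
Hypothesis Vdual_convex : strictly_convex (dual V).
Variables (v : nat -> V) (v_dense : dense_seq v) (h : nat -> H) (h_dense : dense_seq h).

Local Notation LpV := (Lp mu p1 V).
Local Notation LpH := (Lp mu p1 H).

Let p0 : 0 < p. Proof. exact: lt_trans ltr01 p_gt1. Qed.
Let q := p / (p - 1).
Let q0 : 0 < q. Proof. by rewrite divr_gt0// subr_gt0. Qed.
Let q1 : 1 <= q. Proof. by rewrite ler_pdivlMr ?subr_gt0// mul1r gerBl. Qed.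

(** The Gateaux derivative of the [p]-th power of the norm, that is, [p] times the duality map with
    gauge [t^(p - 1)]. *)
Definition normp_grad (y : V) : dual V := sval (cid (powR_norm_gateaux p_gt1 Vdual_convex y)).

Lemma normp_grad_norm y : `|normp_grad y| <= p * `|y| `^ (p - 1).
Proof. by rewrite /normp_grad; case: cid => f []. Qed.

Lemma normp_grad_self y : (normp_grad y y : R) = p * `|y| `^ p.
Proof. by rewrite /normp_grad; case: cid => f []. Qed.

Lemma normp_grad_cvg y x :
  n.+1%:R * (`|y + n.+1%:R^-1 *: x| `^ p - `|y| `^ p) @[n --> \oo] --> (normp_grad y x : R).
Proof. by rewrite /normp_grad; case: cid => f []. Qed.

Let quot (y x : V) (n : nat) := n.+1%:R * (`|y + n.+1%:R^-1 *: x| `^ p - `|y| `^ p).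

Let strongly_measurable_add (f g : X -> V) (c : R) : strongly_measurable f ->
  strongly_measurable g -> strongly_measurable (fun t => f t + c *: g t).
Proof.
move=> mf mg; have := strongly_measurable_lin c mg mf.
by under eq_fun do rewrite addrC.
Qed.

Let measurable_quot (y x : X -> V) n : strongly_measurable y -> strongly_measurable x ->
  measurable_fun setT (fun t => quot (y t) (x t) n).
Proof.
move=> my mx; apply: measurable_funM => //; apply: measurable_funB; apply: measurable_pow_norm => //.
exact: strongly_measurable_add.
Qed.

Lemma measurable_normp_grad (y x : X -> V) : strongly_measurable y ->
  strongly_measurable x -> measurable_fun setT (fun t => normp_grad (y t) (x t) : R).
Proof.
move=> my mx.
apply: (@measurable_fun_cvg _ _ _ _ (fun n t => quot (y t) (x t) n)) => [n|t _].
  exact: measurable_quot.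
exact: normp_grad_cvg.
Qed.

(** A majorant for dominated convergence, uniform in [n]: the factor [n + 1] cancels the step of the
    increment. *)
Let quot_le y x n : `|quot y x n| <= p * 2 `^ p * (`|y| `^ p + `|x| `^ p).
Proof.
have n0 : 0 < n.+1%:R^-1 :> R by rewrite invr_gt0.
have n1 : n.+1%:R^-1 <= 1 :> R by rewrite invf_le1// ler1n.
have yx : `|y + n.+1%:R^-1 *: x| <= `|y| + `|x|.
  by apply: le_trans (ler_normD _ _) _; rewrite lerD2l normrZ gtr0_norm// ler_piMl.
have d1 : `| `|y + n.+1%:R^-1 *: x| - `|y| | <= n.+1%:R^-1 * `|x|.
  apply: le_trans (ler_dist_dist _ _) _.
  by rewrite addrAC subrr add0r normrZ gtr0_norm.
rewrite /quot normrM ger0_norm//.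
have := powR_diff_le p_gt1 (normr_ge0 _) (normr_ge0 _) d1.
move=> /(ler_wpM2l (ler0n _ n.+1)) /le_trans; apply.
have -> (a : R) : n.+1%:R * (p * a * (n.+1%:R^-1 * `|x|)) = p * (a * `|x|).
  by move: (n.+1%:R : R) (ltr0Sn R n) => r r0; field; rewrite gt_eqF.
rewrite -mulrA ler_wpM2l ?(ltW p0)//.
apply: le_trans (powRD_le p_gt1 (normr_ge0 _) (normr_ge0 _)).
have s0 : 0 <= `|y| + `|x| by rewrite addr_ge0.
rewrite -(mulr_powRB1 s0 p0) mulrC.
apply: ler_pM; rewrite ?powR_ge0 ?lerDr//.
apply: powR_le; [by rewrite subr_ge0 ltW | by rewrite le_max normr_ge0 | by rewrite ge_max yx/= lerDl].
Qed.

(** Dominated convergence of the difference quotients: the pointwise gradient, integrated, is the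
    Gateaux derivative of the [p]-th power of the [Lp] norm. *)
Lemma normp_grad_Rintegral (y x : LpV) :
  mu.-integrable setT (EFin \o (fun t => normp_grad (y t) (x t) : R)) /\
  n.+1%:R * (`|y + n.+1%:R^-1 *: x| `^ p - `|y| `^ p) @[n --> \oo] -->
    \int[mu]_t (normp_grad (y t) (x t) : R).
Proof.
have my := (Lp_in_Lp y).1; have mx := (Lp_in_Lp x).1.
have Iy := Lp_integrable y; have Ix := Lp_integrable x.
have cq : {ae mu, forall t, quot (y t) (x t) n @[n --> \oo] --> (normp_grad (y t) (x t) : R)}.
  by apply: nearW => t; exact: normp_grad_cvg.
have [ig cv] := @Rintegral_dominated _ _ _ mu (fun n t => quot (y t) (x t) n)
  (fun t => normp_grad (y t) (x t) : R) (fun t => p * 2 `^ p * (`|y t| `^ p + `|x t| `^ p))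
  (fun n => measurable_quot n my mx) cq
  (measurable_normp_grad my mx) (integrableZR _ (integrableDR Iy Ix))
  (fun n t => quot_le (y t) (x t) n).
split=> //; apply: cvg_trans cv; apply: near_eq_cvg; apply: nearW => n.
rewrite !Lp_norm_pow.
have aeE : {ae mu, forall t, (y + n.+1%:R^-1 *: x : LpV) t = y t + n.+1%:R^-1 *: x t}.
  by apply: filterS2 (LpD y (n.+1%:R^-1 *: x)) (LpZ n.+1%:R^-1 x) => t -> ->.
have E1 : \int[mu]_t (`|(y + n.+1%:R^-1 *: x : LpV) t| `^ p) =
    \int[mu]_t (`|y t + n.+1%:R^-1 *: x t| `^ p).
  apply: eq_Rintegral_ae.
  - exact: measurable_pow_norm (Lp_in_Lp _).1.
  - by apply: measurable_pow_norm; exact: strongly_measurable_add.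
  by apply: filterS aeE => t ->.
have I1 : mu.-integrable setT (EFin \o (fun t => `|y t + n.+1%:R^-1 *: x t| `^ p)).
  apply: (ae_le_integrable _ (Lp_integrable (y + n.+1%:R^-1 *: x : LpV))).
    by apply: measurable_pow_norm; exact: strongly_measurable_add.
  by apply: filterS aeE => t ->; rewrite ger0_norm ?powR_ge0.
rewrite E1 -RintegralB// -RintegralZl//.
exact: integrableBR.
Qed.

(** The distance in [dual V] from the gradient at [y] to the finite set of 0 and the [pivot (h j)]
    with [j < k]. It tends to 0 because these functionals become dense. *)
Let m_ (y : V) := fix m k : R := if k is j.+1 then
  Num.min (m j) `|normp_grad y - pivot ip_norm i (h j)| else `|normp_grad y|.

Let m_ge0 y k : 0 <= m_ y k.
Proof. by elim: k => //= k IH; rewrite le_min IH normr_ge0. Qed.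

Let m_le y k : m_ y k <= `|normp_grad y|.
Proof. by elim: k => //= k IH; rewrite ge_min IH. Qed.

Let m_cvg y : m_ y k @[k --> \oo] --> 0.
Proof.
apply/cvgr0Pnorm_le => e e0.
have e2 : 0 < e / 2 by rewrite divr_gt0.
have [z zJ] := pivot_dense ip_norm V_reflexive i_inj (normp_grad y) e2.
have o1 : 0 < opnorm i + 1 by rewrite ltr_wpDl// opnorm_ge0.
have [n zn] := h_dense z (divr_gt0 e2 o1).
have mn : `|normp_grad y - pivot ip_norm i (h n)| <= e.
  have -> : normp_grad y - pivot ip_norm i (h n) =
      (normp_grad y - pivot ip_norm i z) + pivot ip_norm i (z - h n).
    by rewrite pivotB addrA subrK.
  apply: le_trans (ler_normD _ _) _.
  have b1 := pivot_norm ip_norm i (z - h n).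
  have b2 : `|z - h n| * opnorm i <= e / 2.
    apply: (@le_trans _ _ (e / 2 / (opnorm i + 1) * (opnorm i + 1))).
      by apply: ler_pM => //; [exact: opnorm_ge0 | exact: ltW | rewrite lerDl].
    by rewrite mulfVK// gt_eqF.
  by move: zJ b1 b2; lra.
exists n.+1 => // k /=; rewrite ger0_norm//.
elim: k => // k IH; rewrite leq_eqVlt => /predU1P[<-|/IH nk] /=.
  by rewrite ge_min mn orbT.
by rewrite ge_min nk.
Qed.

Let measurable_m (y : X -> V) k : strongly_measurable y ->
  measurable_fun setT (fun t => m_ (y t) k).
Proof.
move=> my.
have mJ g : measurable_fun setT (fun t => `|normp_grad (y t) - g|).
  apply: (measurable_opnorm_sub _ v_dense) => n.
  by apply: measurable_normp_grad => //; exact: strongly_measurable_cst.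
elim: k => [|k IH] /=; last exact: measurable_minr.
by under eq_fun do rewrite -[normp_grad _]subr0; exact: mJ.
Qed.

Let c_ k := \sum_(j < k) `|h j|.

(** The gradient splits into an error of norm [m_ y k] and some [pivot (h j)]. Summing all [|h j|]
    in [c_ k] covers whichever [j] is nearest, so no measurable selection in time is made. *)
Let grad_le y x k : `|normp_grad y x : R| <= m_ y k * `|x| + c_ k * `|i x|.
Proof.
elim: k => [|k IH] /=.
  by rewrite /c_ big_ord0 mul0r addr0; exact: opnormP.
have cS : c_ k.+1 = c_ k + `|h k| by rewrite /c_ big_ord_recr.
have c0 : 0 <= c_ k by rewrite sumr_ge0.
rewrite cS mulrDl.
have [le|lt] := leP (m_ y k) `|normp_grad y - pivot ip_norm i (h k)|.
  by apply: le_trans IH _; rewrite lerD2l lerDl mulr_ge0.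
have -> : (normp_grad y x : R) = (normp_grad y - pivot ip_norm i (h k)) x + ip (h k) (i x).
  rewrite -pivotE -[X in X + _]/((normp_grad y x : R) - pivot ip_norm i (h k) x).
  by rewrite subrK.
apply: le_trans (ler_normD _ _) _; apply: lerD; first exact: opnormP.
by apply: le_trans (ip_norm_le ip_norm _ _) _; rewrite lerDr mulr_ge0.
Qed.

(** The error part of the gradient is small in [L^q] for large [k], uniformly over the bounded
    [g n]; with [k] fixed, the other part is controlled by the norm of [g n] in [L^p(mu; H)], which
    tends to 0. *)
Lemma normp_grad_weak (y : LpV) (g : nat -> LpV) M : 0 <= M -> (forall n, `|g n| <= M) ->
  (fun n => Lp_map i (g n)) @ \oo --> (0 : LpH) ->
  \int[mu]_t (normp_grad (y t) (g n t) : R) @[n --> \oo] --> 0.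
Proof.
move=> M0 gM gz.
have my := (Lp_in_Lp y).1.
have Im : \int[mu]_t (m_ (y t) k `^ q) @[k --> \oo] --> 0.
  have [||||| _] := @Rintegral_dominated _ _ _ mu (fun k t => m_ (y t) k `^ q) (fun=> 0)
    (fun t => p `^ q * `|y t| `^ p).
  - move=> k; apply: (measurableT_comp (@measurable_powR R q)); exact: measurable_m.
  - apply: nearW => t; rewrite -[X in _ --> X](powR0 (lt0r_neq0 q0)).
    exact: powR_cvg q0 (lexx 0) (m_ge0 (y t)) (m_cvg (y t)).
  - exact: measurable_cst.
  - exact: integrableZR (Lp_integrable y).
  - move=> k t; rewrite ger0_norm ?powR_ge0//.
    apply: (@le_trans _ _ ((p * `|y t| `^ (p - 1)) `^ q)).
      apply: powR_le; [exact: ltW | exact: m_ge0 | exact: le_trans (m_le _ _) (normp_grad_norm _)].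
    rewrite powRM ?powR_ge0 ?(ltW p0)// -powRrM /q mulrCA divff ?mulr1//.
    by rewrite gt_eqF// subr_gt0.
  by rewrite Rintegral_cst// mul0r.
apply/cvgr0Pnorm_le => e e0.
pose B := M `^ p + fine (mu setT).
have muf : mu setT \is a fin_num by rewrite ge0_fin_numE.
have B0 : 0 <= B by rewrite addr_ge0 ?powR_ge0// fine_ge0.
(* Products are split by Young's inequality after moving a factor [s] across. As [s <= 1], its
   powers [p] and [q] are at most [s], and [s * B] bounds the two terms that do not become small
   through [k] or [n]. *)
pose s := Num.min 1 (e / 4 / (B + 1)).
have B1 : 0 < B + 1 by rewrite ltr_wpDl.
have s0 : 0 < s by rewrite lt_min ltr01/= !divr_gt0.
have s1 : s <= 1 by rewrite ge_min lexx.
have sB : s * B <= e / 4.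
  apply: (@le_trans _ _ (e / 4 / (B + 1) * (B + 1))); last by rewrite mulfVK// gt_eqF.
  apply: ler_pM; rewrite ?(ltW s0)//; last by rewrite lerDl.
  by rewrite /s ge_min lexx orbT.
have sle r : 1 <= r -> s `^ r <= s by move=> r1; apply: ge1r_powR; rewrite ?s0.
have sq0 : 0 < s^-1 `^ q by rewrite powR_gt0// invr_gt0.
have [k mk] : exists k, s^-1 `^ q * \int[mu]_t (m_ (y t) k `^ q) <= e / 4.
  move/cvgr0Pnorm_le : Im => /(_ (e / 4 / s^-1 `^ q)).
  case; first by rewrite !divr_gt0.
  move=> K _ HK; exists K; rewrite mulrC -ler_pdivlMr//.
  by apply: le_trans (ler_norm _) _; exact: HK K (leqnn K).
pose C := (c_ k / s) `^ p.
have C0 : 0 <= C by exact: powR_ge0.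
have [N HN] : exists N, forall n, (N <= n)%N -> C * `|Lp_map i (g n)| `^ p <= e / 4.
  have : C * `|Lp_map i (g n)| `^ p @[n --> \oo] --> 0.
    rewrite -(mulr0 C); apply: cvgMr; rewrite -(powR0 (lt0r_neq0 p0)).
    apply: powR_cvg => //; rewrite -(normr0 LpH); exact: cvg_norm.
  move=> /cvgr0Pnorm_le/(_ (e / 4)); case; first by rewrite divr_gt0.
  move=> N _ HN; exists N => n Nn; apply: le_trans (ler_norm _) _; exact: HN.
exists N => // n /= Nn.
have [Ig _] := normp_grad_Rintegral y (g n).
apply: le_trans (le_normr_Rintegral measurableT Ig) _.
have Imk : mu.-integrable setT (EFin \o (fun t => m_ (y t) k `^ q)).
  apply: (ae_le_integrable _ (integrableZR (p `^ q) (Lp_integrable y))).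
    apply: (measurableT_comp (@measurable_powR R q)); exact: measurable_m.
  apply: nearW => t; rewrite ger0_norm ?powR_ge0//.
  apply: (@le_trans _ _ ((p * `|y t| `^ (p - 1)) `^ q)).
    apply: powR_le; [exact: ltW | exact: m_ge0 | exact: le_trans (m_le _ _) (normp_grad_norm _)].
  rewrite powRM ?powR_ge0 ?(ltW p0)// -powRrM /q mulrCA divff ?mulr1//.
  by rewrite gt_eqF// subr_gt0.
have Ign := Lp_integrable (g n); have Iign := Lp_integrable (Lp_map i (g n)).
have c0 : 0 <= c_ k by rewrite sumr_ge0.
pose bnd t := s^-1 `^ q * m_ (y t) k `^ q + s * `|g n t| `^ p + (s + C * `|Lp_map i (g n) t| `^ p).
have Ic : mu.-integrable setT (EFin \o (fun _ : X => s)) by exact: integrable_cst_fin.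
have I1 := integrableZR (s^-1 `^ q) Imk; have I2 := integrableZR s Ign.
have I3 := integrableZR C Iign.
have I12 := integrableDR I1 I2; have I3c := integrableDR Ic I3.
have Ibnd : mu.-integrable setT (EFin \o bnd) by exact: integrableDR.
apply: (@le_trans _ _ (\int[mu]_t bnd t)).
  apply: le_Rintegral_ae => //; first exact: integrable_norm.
  apply: filterS (Lp_mapE i (g n)) => t iE.
  apply: le_trans (grad_le (y t) (g n t) k) _; rewrite /bnd iE; apply: lerD.
    have -> : m_ (y t) k * `|g n t| = (s^-1 * m_ (y t) k) * (s * `|g n t|).
      by field; rewrite gt_eqF.
    have s10 : 0 <= s^-1 by rewrite invr_ge0 ltW.
    apply: le_trans (conjugate_young p_gt1 _ _) _; rewrite ?mulr_ge0 ?(ltW s0)//.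
    rewrite !powRM ?(ltW s0)// lerD2l ler_wpM2r ?powR_ge0//.
    by apply: sle; exact: ltW.
  have -> : c_ k * `|i (g n t)| = s * (c_ k / s * `|i (g n t)|) by field; rewrite gt_eqF.
  have cs : 0 <= c_ k / s by rewrite divr_ge0 ?(ltW s0).
  apply: le_trans (conjugate_young p_gt1 _ _) _; rewrite ?mulr_ge0 ?invr_ge0 ?(ltW s0)//.
  by rewrite powRM// lerD2r sle.
rewrite /bnd RintegralD// RintegralD// RintegralD// !RintegralZl// Rintegral_cst//.
rewrite -!Lp_norm_pow.
have h1 : s * `|g n| `^ p <= s * M `^ p by rewrite ler_wpM2l ?(ltW s0)// powR_le ?(ltW p0).
have := HN n Nn; move: sB mk h1; rewrite /B; lra.
Qed.

(** Let [a] in [K] almost minimize the distance to [w] (Ekeland). The derivative of the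
   [p]-th power of the norm at [a - w] then separates [w] from [K]; it is continuous
   for bounded sequences converging in [H], because [pivot] has dense range. *)
Lemma closed_convex_Lp_map (K : set LpV) M (u : nat -> LpV) (w : LpV) :
  closed K -> (forall a b t, K a -> K b -> 0 <= t <= 1 -> K ((1 - t) *: a + t *: b)) ->
  0 <= M -> (forall a, K a -> `|a| <= M) -> (forall n, K (u n)) ->
  (fun n => Lp_map i (u n)) @ \oo --> Lp_map i w -> K w.
Proof.
move=> cK convK M0 KM Ku uw; apply: contrapT => nKw.
have [dl dl0 far] : exists2 dl, 0 < dl & forall c, K c -> dl <= `|c - w|.
  apply: contrapT => nd; apply: nKw; apply: cK => B /nbhs_ballP[dl /= dl0 wB].
  apply: contrapT => nB; apply: nd; exists dl => // c Kc; rewrite leNgt; apply/negP => cw.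
  apply: nB; exists c; split=> //; apply: wB; rewrite -ball_normE/=.
  by rewrite distrC.
pose F (c : LpV) := `|c - w| `^ p.
pose e := p * dl `^ p / (4 * (M + 1)).
have dp : 0 < p * dl `^ p by rewrite mulr_gt0// powR_gt0.
have M1 : 0 < M + 1 by rewrite ltr_wpDl.
have e0 : 0 < e by rewrite divr_gt0// mulr_gt0.
have [||a l al|a Ka aw] := @almost_minimizer R LpV K F e (u 0%N) e0 (Ku 0%N).
- by move=> c; exact: powR_ge0.
- move=> a Ka aC; have [l al] := Lp_complete aC.
  by exists l => //; apply: (@closed_cvg _ _ \oo _ a K cK _ l al); exact: nearW.
- apply: powR_cvg => //; apply: cvg_norm; apply: cvgB => //; exact: cvg_cst.
pose y : LpV := a - w; pose g n : LpV := u n - w.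
have gM n : `|g n| <= M + `|w| by apply: le_trans (ler_normB _ _) _; rewrite lerD2r KM.
have gz : (fun n => Lp_map i (g n)) @ \oo --> (0 : LpH).
  have -> : (fun n => Lp_map i (g n)) = fun n => Lp_map i (u n) - Lp_map i w.
    have [I IE] := Lp_map_clin mu p1 i.
    by apply/funext => n; rewrite /g -!IE linearB.
  by rewrite -(subrr (Lp_map i w)); apply: cvgB => //; exact: cvg_cst.
have lim := normp_grad_weak y (addr_ge0 M0 (normr_ge0 w)) gM gz.
(* [g n] is [u n - a] plus [y]. Along the segment from [a] to [u n], near minimality bounds the
   derivative below by [- 2 e M]; along [y] it equals [p |y|^p], at least [p dl^p]. This contradicts
   [lim]. *)
have low n : p * dl `^ p / 2 <= \int[mu]_t (normp_grad (y t) (g n t) : R).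
  have [Ix cx] := normp_grad_Rintegral y (u n - a).
  have [Ig _] := normp_grad_Rintegral y (g n).
  have [Iy _] := normp_grad_Rintegral y y.
  have lx : - (e * (2 * M)) <= \int[mu]_t (normp_grad (y t) ((u n - a : LpV) t) : R).
    apply: (ler_cvg_to (cvg_cst _) cx); apply: nearW => k.
    have k0 : 0 < k.+1%:R^-1 :> R by rewrite invr_gt0.
    have k1 : k.+1%:R^-1 <= 1 :> R by rewrite invf_le1// ler1n.
    pose c := (1 - k.+1%:R^-1) *: a + k.+1%:R^-1 *: u n.
    have cE : c = a + k.+1%:R^-1 *: (u n - a).
      by rewrite /c scalerBl scale1r scalerBr addrAC -addrA.
    have Kc : K c by apply: convK => //; rewrite ltW.
    have := aw c Kc; rewrite /F.
    have -> : c - w = y + k.+1%:R^-1 *: (u n - a) by rewrite cE /y addrAC.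
    have -> : c - a = k.+1%:R^-1 *: (u n - a) by rewrite cE addrAC subrr add0r.
    rewrite normrZ gtr0_norm//.
    have ua : `|u n - a| <= 2 * M.
      by apply: le_trans (ler_normB _ _) _; have := KM _ (Ku n); have := KM _ Ka; lra.
    move=> Hk; rewrite -ler_pdivrMl// mulrN.
    rewrite lerNl opprB lerBlDl; apply: le_trans Hk _; rewrite lerD2l.
    by rewrite mulrCA ler_wpM2l ?(ltW k0)// ler_wpM2l// ltW.
  have -> : \int[mu]_t (normp_grad (y t) (g n t) : R) =
      \int[mu]_t (normp_grad (y t) ((u n - a : LpV) t) : R) + \int[mu]_t (normp_grad (y t) (y t) : R).
    rewrite -RintegralD//; apply: eq_Rintegral_ae.
    - exact: measurable_normp_grad (Lp_in_Lp _).1 (Lp_in_Lp _).1.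
    - by apply: measurable_funD; apply: measurable_normp_grad; exact: (Lp_in_Lp _).1.
    have gE : g n = (u n - a) + y by rewrite /y addrA subrK.
    by rewrite gE; apply: filterS (LpD (u n - a) y) => t ->; rewrite linearD.
  have -> : \int[mu]_t (normp_grad (y t) (y t) : R) = p * `|y| `^ p.
    rewrite Lp_norm_pow -RintegralZl//; last exact: Lp_integrable.
    by apply: eq_Rintegral => t _; exact: normp_grad_self.
  have : p * dl `^ p <= p * `|y| `^ p.
    rewrite ler_wpM2l ?(ltW p0)//; apply: powR_le; rewrite ?(ltW p0) ?(ltW dl0)//.
    exact: far.
  have : e * (2 * M) <= p * dl `^ p / 2.
    have -> : p * dl `^ p / 2 = e * (2 * (M + 1)) by rewrite /e; field; rewrite gt_eqF.
    by rewrite ler_wpM2l ?(ltW e0)// ler_wpM2l// lerDl.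
  by move: lx; lra.
have : p * dl `^ p / 2 <= 0.
  by apply: (ler_cvg_to (cvg_cst _) lim); apply: nearW => n; exact: low.
by lra.
Qed.

End WeakClosedness.

(** * Bounded variation of the elements of Z *)

Section Primitive.
Context (R : realType) (T : R).
Hypothesis T0 : 0 < T.
Local Notation dt := (dt T).

Lemma dtE (A : set R) : dt A = lebesgue_measure (A `&` `]0, T[%classic).
Proof. by []. Qed.

Lemma dtT : dt setT = T%:E.
Proof. by rewrite dtE setTI lebesgue_measure_itv/= lte_fin T0 sube0. Qed.

Lemma dt_fin : (dt setT < +oo)%E. Proof. by rewrite dtT ltry. Qed.

Lemma dt_itv_le (a b : R) : a <= b -> (dt `]a, b]%classic <= (b - a)%:E)%E.
Proof.
move=> ab; rewrite dtE.
apply: (@le_trans _ _ (lebesgue_measure `]a, b]%classic)).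
  by apply: le_measure; rewrite ?inE//; exact: measurableI.
rewrite lebesgue_measure_itv/= lte_fin; case: ifP => // _.
by rewrite lee_fin subr_ge0.
Qed.

Lemma dt_ae_itv : {ae dt, forall t, 0 < t < T}.
Proof.
exists (~` `]0, T[%classic); split.
- exact: measurableC.
- by rewrite dtE setICl measure0.
- by move=> t /= nt; rewrite in_itv/= => /andP[t0 tT]; apply: nt; rewrite t0 tT.
Qed.

Lemma dt_filter : Filter (nbhs (almost_everywhere dt)).
Proof. exact _. Qed.

(** [filterS] specialized to [dt], for which instance search is unreliable. *)
Lemma dt_aeS (P Q : R -> Prop) : (forall t, P t -> Q t) ->
  {ae dt, forall t, P t} -> {ae dt, forall t, Q t}.
Proof. exact: (@filterS _ _ dt_filter P Q). Qed.

Lemma dt_aeS2 (P Q S : R -> Prop) : (forall t, P t -> Q t -> S t) ->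
  {ae dt, forall t, P t} -> {ae dt, forall t, Q t} -> {ae dt, forall t, S t}.
Proof. exact: (@filterS2 _ _ dt_filter P Q S). Qed.

Lemma dt_ae_neq (s : R) : {ae dt, forall t, t != s}.
Proof.
exists [set s]; split=> //.
- rewrite dtE; apply/eqP; rewrite eq_le measure_ge0 andbT.
  rewrite -(lebesgue_measure_set1 s); apply: le_measure; rewrite ?inE//.
  exact: measurableI.
- by move=> t /= /negP; rewrite negbK => /eqP.
Qed.

Lemma integrable_bounded (f : R -> R) C : measurable_fun setT f ->
  (forall t, `|f t| <= C) -> dt.-integrable setT (EFin \o f).
Proof.
move=> mf fC; apply: (@ae_le_integrable _ _ _ dt f (fun=> C) mf (integrable_cst_fin C dt_fin)).
exact: nearW.
Qed.

Definition heaviside (s t : R) : R := (s <= t)%R%:R.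

Lemma measurable_heavisideR (t : R) : measurable_fun setT (fun s => heaviside s t).
Proof.
rewrite (_ : (fun s => _) = \1_`]-oo, t]%classic); last first.
  by apply/funext => s; rewrite /heaviside indicE mem_setE in_itv.
exact: measurable_indic.
Qed.

Lemma measurable_heavisideL (s : R) : measurable_fun setT (heaviside s).
Proof.
rewrite (_ : heaviside s = \1_`[s, +oo[%classic); last first.
  by apply/funext => t; rewrite /heaviside indicE mem_setE in_itv/= andbT.
exact: measurable_indic.
Qed.

Lemma heaviside_norm s t : `|heaviside s t| <= 1.
Proof. by rewrite /heaviside; case: (s <= t); rewrite ?normr1 ?normr0. Qed.

Definition bounded_measurable (f : R -> R) :=
  measurable_fun setT f /\ exists C, forall t, `|f t| <= C.

Lemma bounded_measurable_integrable f : bounded_measurable f ->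
  dt.-integrable setT (EFin \o f).
Proof. by move=> [mf [C fC]]; exact: integrable_bounded fC. Qed.

Lemma bounded_measurableM f g : bounded_measurable f -> bounded_measurable g ->
  bounded_measurable (fun t => f t * g t).
Proof.
move=> [mf [C fC]] [mg [D gD]]; split; first exact: measurable_funM.
exists (C * D) => t; rewrite normrM; exact: ler_pM.
Qed.

Lemma bounded_measurableD f g : bounded_measurable f -> bounded_measurable g ->
  bounded_measurable (fun t => f t + g t).
Proof.
move=> [mf [C fC]] [mg [D gD]]; split; first exact: measurable_funD.
by exists (C + D) => t; apply: le_trans (ler_normD _ _) _; exact: lerD.
Qed.

Lemma bounded_measurable_cst (c : R) : bounded_measurable (fun=> c).
Proof. by split; [exact: measurable_cst | exists `|c|]. Qed.

Lemma bounded_measurableR t : bounded_measurable (fun s => heaviside s t).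
Proof. by split; [exact: measurable_heavisideR | exists 1 => s; exact: heaviside_norm]. Qed.

Lemma bounded_measurableL s : bounded_measurable (heaviside s).
Proof. by split; [exact: measurable_heavisideL | exists 1 => t; exact: heaviside_norm]. Qed.

(** The endpoint enters through a cutoff factor, so that all integrals are over one fixed measure
    space and Fubini's theorem applies directly. *)
Definition primitive (g : R -> R) (t : R) := \int[dt]_s (g s * heaviside s t).

Lemma primitive_lipschitz (g : R -> R) C (s t : R) : measurable_fun setT g -> (forall t, `|g t| <= C) ->
  `|primitive g t - primitive g s| <= C * `|t - s|.
Proof.
move=> mg gC; wlog st : s t / s <= t => [hw|].
  by have [/hw//|/ltW/hw] := leP s t; rewrite distrC [`|s - t|]distrC.
have bg : bounded_measurable g by split=> //; exists C.
have C0 : 0 <= C by apply: le_trans (gC 0).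
have It := bounded_measurable_integrable (bounded_measurableM bg (bounded_measurableR t)).
have Is := bounded_measurable_integrable (bounded_measurableM bg (bounded_measurableR s)).
rewrite /primitive -RintegralB//.
have Ib := integrableBR It Is.
apply: le_trans (le_normr_Rintegral measurableT Ib) _.
have mi : measurable_fun setT (\1_`]s, t]%classic : R -> R) by exact: measurable_indic.
have I1 : dt.-integrable setT (EFin \o (fun r => C * \1_`]s, t]%classic r)).
  apply: (@integrable_bounded _ C); first exact: measurable_funM.
  move=> r; rewrite indicE normrM ger0_norm// ler_piMr//.
  by case: (_ \in _); rewrite ?normr1 ?normr0.
apply: (@le_trans _ _ (\int[dt]_r (C * \1_`]s, t]%classic r))).
  apply: le_Rintegral => //; first exact: integrable_norm.
  move=> r _; rewrite -mulrBr normrM; apply: ler_pM => //.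
  rewrite /heaviside indicE mem_setE in_itv/=.
  have [rs|sr] := leP r s; first by rewrite (le_trans rs st) subrr normr0.
  by rewrite subr0; case: (r <= t); rewrite ?normr1 ?normr0.
rewrite RintegralZl//; last first.
  apply: (@integrable_bounded _ 1) => // r; rewrite indicE.
  by case: (_ \in _); rewrite ?normr1 ?normr0.
rewrite ler_wpM2l// ger0_norm ?subr_ge0// /Rintegral integral_indic// setIT.
have le1 := dt_itv_le st.
rewrite -lee_fin fineK//.
by rewrite ge0_fin_numE ?measure_ge0//; apply: le_lt_trans le1 (ltry _).
Qed.

Lemma primitive_continuous g : bounded_measurable g -> continuous (primitive g).
Proof.
move=> [mg [C gC]] t; apply/cvgrPdist_le => e e0.
have C1 : 0 < C + 1 by rewrite ltr_wpDl// (le_trans _ (gC 0)).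
near=> s.
apply: le_trans (primitive_lipschitz s t mg gC) _.
apply: (@le_trans _ _ ((C + 1) * `|t - s|)); first by rewrite ler_wpM2r// lerDl.
rewrite mulrC -ler_pdivlMr//; near: s.
apply: cvgr_dist_le; [exact: cvg_id | exact: divr_gt0].
Unshelve. all: by end_near. Qed.

Lemma ae_eq0_Rintegral (f : R -> R) : measurable_fun setT f ->
  {ae dt, forall t, f t = 0} -> \int[dt]_t f t = 0.
Proof.
move=> mf f0; rewrite (@eq_Rintegral_ae _ _ _ dt f (fun=> 0))//.
by rewrite Rintegral_cst// mul0r.
Qed.

Lemma primitive0 g : bounded_measurable g -> primitive g 0 = 0.
Proof.
move=> bg; apply: ae_eq0_Rintegral.
  by have [] := bounded_measurableM bg (bounded_measurableR 0).
apply: dt_aeS dt_ae_itv => t /andP[t0 _].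
by rewrite /heaviside leNgt t0 mulr0.
Qed.

Lemma primitive_bounded_measurable g : bounded_measurable g ->
  bounded_measurable (primitive g).
Proof.
move=> bg; split.
  by apply: continuous_measurable_fun; exact: primitive_continuous.
have [mg [C gC]] := bg.
have C0 : 0 <= C by apply: le_trans (gC 0).
exists (C * T) => t.
have It := bounded_measurable_integrable (bounded_measurableM bg (bounded_measurableR t)).
apply: le_trans (le_normr_Rintegral measurableT It) _.
apply: (@le_trans _ _ (\int[dt]_s C)).
  apply: le_Rintegral => //; [exact: integrable_norm | exact: integrable_cst_fin dt_fin |].
  move=> s _; rewrite normrM -[leRHS]mulr1; apply: ler_pM => //; exact: heaviside_norm.
by rewrite Rintegral_cst// dtT.
Qed.

Lemma primitive_swap f g : bounded_measurable f -> bounded_measurable g ->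
  \int[dt]_t (f t * primitive g t) = \int[dt]_s (g s * \int[dt]_t (f t * heaviside s t)).
Proof.
move=> bf bg; have [mf [C fC]] := bf; have [mg [D gD]] := bg.
have moo : (lebesgue_measure (`]0%R, T[%classic : set R) < +oo)%E.
  by rewrite lebesgue_measure_itv/= lte_fin T0 sube0 ltry.
(* [dt] with the structure of a finite measure, over which the bounded [F] is integrable on the
   product. *)
pose m : {finite_measure set (measurableTypeR R) -> \bar R} :=
  @mfrestr _ (measurableTypeR R) R _ lebesgue_measure (measurable_itv `]0%R, T[) moo.
have mE : m = dt :> (set R -> \bar R) by [].
pose F (z : R * R) : R := f z.1 * (g z.2 * heaviside z.2 z.1).
have mh : measurable_fun setT (fun z : R * R => heaviside z.2 z.1).
  have mA : measurable [set z : R * R | z.2 <= z.1].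
    have := measurable_fun_ler (@measurable_snd _ _ R R) (@measurable_fst _ _ R R).
    by move=> /(_ measurableT [set true] I); rewrite setTI.
  rewrite (_ : (fun z => _) = \1_[set z : R * R | z.2 <= z.1]); first exact: measurable_indic.
  by apply/funext => z; rewrite /heaviside indicE mem_setE.
have mF : measurable_fun setT F.
  apply: measurable_funM; first exact: measurableT_comp mf measurable_fst.
  by apply: measurable_funM => //; exact: measurableT_comp mg measurable_snd.
have IF : (m \x m)%E.-integrable setT (EFin \o F).
  apply: measurable_bounded_integrable => //.
    rewrite (_ : setT = [set: measurableTypeR R] `*` [set: measurableTypeR R]); last by rewrite setXTT.
    have E := @product_measure1E _ _ (measurableTypeR R) (measurableTypeR R) R m m setT setT measurableT measurableT.
    apply: le_lt_trans (_ : (m setT * m setT < +oo)%E); first by rewrite -E.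
    rewrite lte_mul_pinfty//.
    - by rewrite ge0_fin_numE// mE; exact: dt_fin.
    - by rewrite mE; exact: dt_fin.
  exists (C * (D * 1)); split; first exact: num_real.
  move=> M CM z _; apply: le_trans (ltW CM).
  rewrite /F normrM; apply: ler_pM => //; rewrite normrM; apply: ler_pM => //.
  exact: heaviside_norm.
have E1 t : f t * primitive g t = \int[dt]_s F (t, s).
  rewrite /F /= RintegralZl//.
  exact: bounded_measurable_integrable (bounded_measurableM bg (bounded_measurableR t)).
have E2 s : g s * \int[dt]_t (f t * heaviside s t) = \int[dt]_t F (t, s).
  rewrite -RintegralZl//; last first.
    exact: bounded_measurable_integrable (bounded_measurableM bf (bounded_measurableL s)).
  by apply: eq_Rintegral => t _; rewrite /F /= mulrCA.
have : (\int[dt]_x \int[dt]_y (EFin \o F) (x, y) = \int[dt]_y \int[dt]_x (EFin \o F) (x, y))%E := Fubini IF.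
have -> : (fun x => \int[dt]_y (EFin \o F) (x, y))%E = fun t => (f t * primitive g t)%:E.
  apply/funext => t; rewrite E1 EFin_Rintegral//.
  apply: bounded_measurable_integrable.
  apply: (@bounded_measurableM (fun=> f t) (fun s => g s * heaviside s t)).
    exact: bounded_measurable_cst.
  exact: bounded_measurableM bg (bounded_measurableR t).
have -> : (fun y => \int[dt]_x (EFin \o F) (x, y))%E =
    fun s => (g s * \int[dt]_t (f t * heaviside s t))%:E.
  apply/funext => s; rewrite E2 EFin_Rintegral//.
  apply: bounded_measurable_integrable.
  apply: (@bounded_measurableM f (fun t => g s * heaviside s t)) => //.
  exact: bounded_measurableM (bounded_measurable_cst _) (bounded_measurableL s).
by rewrite /Rintegral => ->.
Qed.

Lemma primitive_compl f s : bounded_measurable f ->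
  \int[dt]_t (f t * heaviside s t) = \int[dt]_t f t - primitive f s.
Proof.
move=> bf; have [mf _] := bf.
rewrite /primitive -RintegralB//; last 2 first.
- exact: bounded_measurable_integrable.
- exact: bounded_measurable_integrable (bounded_measurableM bf (bounded_measurableR s)).
apply: (@eq_Rintegral_ae _ _ _ dt).
- by have [] := bounded_measurableM bf (bounded_measurableL s).
- by apply: measurable_funB => //; have [] := bounded_measurableM bf (bounded_measurableR s).
(* The two cutoffs add up to 1 except at [t = s], a null set. *)
apply: dt_aeS (dt_ae_neq s) => t ts; rewrite /heaviside.
have [st|ts'|tE] := ltgtP s t; first by rewrite mulr1 mulr0 subr0.
  by rewrite mulr0 mulr1 subrr.
by rewrite tE eqxx in ts.
Qed.

(** By Fubini the integral equals [(\int g)^2] minus itself. *)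
Lemma primitive_orth g : bounded_measurable g -> \int[dt]_t g t = 0 ->
  \int[dt]_t (g t * primitive g t) = 0.
Proof.
move=> bg g0.
have bp := primitive_bounded_measurable bg.
have : \int[dt]_t (g t * primitive g t) = - \int[dt]_t (g t * primitive g t).
  rewrite {1}primitive_swap// -[RHS]mulN1r -RintegralZl//; last first.
    exact: bounded_measurable_integrable (bounded_measurableM bg bp).
  apply: eq_Rintegral => s _.
  by rewrite primitive_compl// g0 sub0r mulN1r mulrN.
by move=> /eqP; rewrite -subr_eq0 opprK -mulr2n mulrn_eq0/= => /eqP.
Qed.

End Primitive.

(** * Integration by parts against test functions *)

Section TestFunctions.
Context (R : realType) (T : R).
Hypothesis T0 : 0 < T.
Local Notation dt := (dt T).

Lemma test_function_continuous (phi : R -> R) : test_function T phi ->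
  continuous phi /\ continuous (phi^`())%classic.
Proof.
move=> [dphi _]; split=> t; apply: differentiable_continuous; apply/derivable1_diffP.
  exact: (dphi 0%N).
exact: (dphi 1%N).
Qed.

Lemma test_function0 (phi : R -> R) t : test_function T phi -> t \notin `]0, T[ -> phi t = 0.
Proof.
move=> [_ supp] nt; apply/eqP; apply: contraNT nt => pt; apply: supp.
exact: subset_closure.
Qed.

Lemma bounded_measurable_continuous (f : R -> R) : continuous f ->
  bounded_measurable (fun t => f t * \1_`[0, T]%classic t).
Proof.
move=> cf; split.
  by apply: measurable_funM; [exact: continuous_measurable_fun | exact: measurable_indic].
have cw : {within `[0, T], continuous (fun t => `|f t|)}.
  apply: continuous_subspaceT => t; apply: continuous_comp; [exact: cf | exact: norm_continuous].
have [c _ fc] := EVT_max (ltW T0) cw.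
exists `|f c| => t; rewrite indicE mem_setE; have [tT|_] := boolP (t \in `[0, T]).
  by rewrite mulr1 fc.
by rewrite mulr0 normr0.
Qed.

Lemma Rintegral_dt (f : R -> R) : measurable_fun setT f ->
  \int[dt]_t f t = \int[lebesgue_measure]_(t in `]0, T[) f t.
Proof.
move=> mf.
have mD : measurable (`]0, T[%classic : set R) by exact: measurable_itv.
transitivity (\int[dt]_(t in `]0, T[) f t).
  rewrite [RHS]Rintegral_mkcond; apply: (@eq_Rintegral_ae _ _ _ dt) => //.
    by apply/(measurable_restrictT _ _).1 => //; exact: measurable_funTS.
  apply: dt_aeS (dt_ae_itv T) => t tT; rewrite patchE mem_setE.
  by rewrite in_itv/= tT.
congr fine; apply: eq_measure_integral => A mA AD; rewrite dtE.
by rewrite setIidl.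
Qed.

Lemma test_function_FTC (phi : R -> R) s : test_function T phi -> 0 < s < T ->
  \int[dt]_t ((phi^`())%classic t * heaviside s t) = - phi s.
Proof.
move=> tphi /andP[s0 sT].
have [cphi cdphi] := test_function_continuous tphi.
have mdphi : measurable_fun setT (phi^`())%classic by exact: continuous_measurable_fun.
rewrite Rintegral_dt; last first.
  by apply: measurable_funM => //; exact: measurable_heavisideL.
have -> : \int[lebesgue_measure]_(t in `]0, T[) ((phi^`())%classic t * heaviside s t) =
    \int[lebesgue_measure]_(t in `[s, T[) (phi^`())%classic t.
  have -> : `[s, T[%classic = `]0, T[%classic `&` `[s, +oo[%classic :> set R.
    apply/seteqP; split=> t /=; rewrite !in_itv/= andbT.
      by move=> /andP[st tT]; rewrite st tT (lt_le_trans s0 st).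
    by move=> [/andP[_ ->] ->].
  rewrite Rintegral_mkcondr; apply: eq_Rintegral => t _.
  rewrite patchE mem_setE in_itv/= andbT /heaviside.
  by case: (s <= t); rewrite ?mulr1 ?mulr0.
have Iphi : lebesgue_measure.-integrable `[s, T] (EFin \o (phi^`())%classic).
  apply: continuous_compact_integrable; first exact: segment_compact.
  exact: continuous_subspaceT.
rewrite Rintegral_itv_bndo_bndc; last first.
  apply: integrableS Iphi => //.
  by move=> t /=; rewrite !in_itv/= => /andP[-> /ltW].
rewrite /Rintegral (@continuous_FTC2 _ _ phi)//.
- by rewrite (@test_function0 phi T)// ?in_itv/= ?ltxx ?andbF// sub0r.
- exact: continuous_subspaceT.
split.
- by move=> x _; case: tphi => /(_ 0%N).
- by apply: cvg_at_right_filter; exact: cphi.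
- by apply: cvg_at_left_filter; exact: cphi.
Qed.

(** As [g] is merely bounded and measurable, the fundamental theorem of calculus is applied to [phi]
    instead of the primitive, after exchanging the integrals. *)
Lemma primitive_by_parts (g phi : R -> R) : bounded_measurable g -> test_function T phi ->
  \int[dt]_t ((phi^`())%classic t * primitive T g t) = - \int[dt]_t (phi t * g t).
Proof.
move=> bg tphi; have [cphi cdphi] := test_function_continuous tphi.
have bphi := bounded_measurable_continuous cphi.
have bdphi := bounded_measurable_continuous cdphi.
have bp := primitive_bounded_measurable T0 bg.
have [mg _] := bg; have [mp _] := bp.
have mdphi : measurable_fun setT (phi^`())%classic by exact: continuous_measurable_fun.
have mphi : measurable_fun setT phi by exact: continuous_measurable_fun.
have ind : {ae dt, forall t, \1_`[0, T]%classic t = 1 :> R}.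
  apply: dt_aeS (dt_ae_itv T) => t /andP[t0 tT]; rewrite indicE mem_setE in_itv/=.
  by rewrite !ltW.
(* Cut off to a compact interval, the continuous derivative of [phi] is bounded. *)
pose f t := (phi^`())%classic t * \1_`[0, T]%classic t.
transitivity (\int[dt]_t (f t * primitive T g t)).
  apply: (@eq_Rintegral_ae _ _ _ dt).
  - exact: measurable_funM.
  - by apply: measurable_funM => //; case: bdphi.
  by apply: dt_aeS ind => t e; rewrite /f e mulr1.
have Ipg : dt.-integrable setT (EFin \o (fun t => phi t * g t)).
  have := bounded_measurable_integrable T0 (bounded_measurableM bphi bg).
  apply: eq_integrable => // t _ /=; congr (_%:E); rewrite indicE mem_setE.
  have [|nt] := boolP (t \in `[0, T]); first by rewrite mulr1.
  rewrite (test_function0 tphi) ?mul0r//; apply: contra nt.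
  by rewrite !in_itv/= => /andP[t0 tT]; rewrite !ltW.
rewrite primitive_swap// -[RHS]mulN1r -RintegralZl//.
apply: (@eq_Rintegral_ae _ _ _ dt).
- apply: measurable_funM => //.
  rewrite (_ : (fun s => _) = fun s => \int[dt]_t f t - primitive T f s).
    by apply: measurable_funB => //; have [] := primitive_bounded_measurable T0 bdphi.
  by apply/funext => s; exact: primitive_compl.
- by apply: measurable_funM => //; exact: measurable_funM.
apply: dt_aeS (dt_ae_itv T) => s sT; rewrite mulN1r -mulNr mulrC; congr (_ * _).
rewrite -(test_function_FTC tphi sT); apply: (@eq_Rintegral_ae _ _ _ dt).
- by have [] := bounded_measurableM bdphi (bounded_measurableL s).
- by apply: measurable_funM => //; exact: measurable_heavisideL.
by apply: dt_aeS ind => t e; rewrite /f e mulr1.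
Qed.

Lemma in_Lp_bounded (E : normedModType R) (f : R -> E) C r : 0 < r -> strongly_measurable f ->
  (forall t, `|f t| <= C) -> in_Lp dt r%:E f.
Proof.
move=> r0 mf fC; have C0 : 0 <= C by apply: le_trans (fC 0).
apply: integrable_in_Lp => //.
apply: (@integrable_bounded _ T T0 _ (C `^ r)); first exact: measurable_pow_norm.
move=> t; rewrite ger0_norm ?powR_ge0//; apply: powR_le => //; exact: ltW.
Qed.

End TestFunctions.

(** * The variational inequality tested on scalar multiples of one vector *)

Section Variation.
Context (R : realType) (T : R).
Hypothesis T0 : 0 < T.
Context (V W H : completeNormedModType R) (ip : {dot H for idfun}).
Hypothesis ip_norm : forall x : H, ip x x = `|x| ^+ 2.
Variables (i : clin V H) (j : clin W V) (p : R) (p_gt1 : 1 < p).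
Local Notation dt := (dt T).
Local Notation LpV := (Lp dt (lee1_EFin p_gt1) V).
Let q := p / (p - 1).
Let p0 : 0 < p. Proof. exact: lt_trans ltr01 p_gt1. Qed.
Let q0 : 0 < q. Proof. by rewrite divr_gt0// subr_gt0. Qed.
Let q1 : (1 <= q%:E)%E.
Proof. by rewrite lee_fin ler_pdivlMr ?subr_gt0// mul1r gerBl. Qed.

Lemma Lp_pair_integrable (f : R -> dual V) (u : R -> V) : in_Lp dt q%:E f -> in_Lp dt p%:E u ->
  dt.-integrable setT (EFin \o (fun t => f t (u t) : R)).
Proof.
move=> ff uu.
have If := in_Lp_integrable q1 ff; have Iu := in_Lp_integrable (lee1_EFin p_gt1) uu.
have mfu : measurable_fun setT (fun t => f t (u t) : R) := measurable_apply ff.1 uu.1.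
apply: (@ae_le_integrable _ _ _ dt _ _ mfu (integrableDR If Iu)).
apply: nearW => t; apply: le_trans (opnormP (f t) (u t)) _.
by apply: conjugate_young => //; exact: opnorm_ge0.
Qed.

Lemma restriction_clin : exists g : clin (dual V) (dual W), forall f, g f = clin_comp f j.
Proof.
apply: (@bounded_clin _ _ _ (fun f : dual V => (clin_comp f j : dual W)) (opnorm j)) => [a f g|f].
  exact/val_inj/funext.
apply: opnorm_le => w w1; apply: le_trans (opnormP f (j w)) _; rewrite mulrC.
by rewrite ler_wpM2r ?opnorm_ge0// opnorm_ub.
Qed.

Lemma bochner_norm1_Rintegral (E : normedModType R) (f : R -> E) M : strongly_measurable f ->
  (bochner_norm dt 1 f <= M%:E)%E ->
  dt.-integrable setT (EFin \o (fun t => `|f t|)) /\ \int[dt]_t `|f t| <= M.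
Proof.
move=> mf fM; apply: Rintegral_le_cst => //; first exact: measurable_normr_strongly.
move: fM; rewrite -[1%E]/(1%:E)%E bochner_normE invr1 poweRe1; last first.
  by apply: integral_ge0 => t _; rewrite lee_fin powR_ge0.
by under eq_integral do rewrite powRr1//.
Qed.

(** Zero mean says that the primitive vanishes at [T], as it does at 0. *)
Definition admissible (b : R) (g : R -> R) :=
  [/\ bounded_measurable g, \int[dt]_t g t = 0 &
      forall t, t \in `[0, T] -> `|primitive T g t| <= b].

(** [<u, w>] has variation at most [C (|w| + 1) / kappa], the supremum of its
   pairings with derivatives [psi' = g] of Lipschitz functions. *)
Lemma Z_variation kappa M0 u0 (u : LpV) w g : 0 < kappa -> 0 < M0 ->
  Z T ip i j p_gt1 kappa M0 u0 u -> admissible (kappa / (`|w| + 1)) g ->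
  \int[dt]_t (g t * ip (i (j w)) (i (u t))) <= M0 + kappa * M0 + 2^-1 * `|u0| ^+ 2.
Proof.
move=> k0 M00 [_ _ [f [ff fu fW test]]] [bg g0 gk'].
have w1 : 0 < `|w| + 1 by rewrite ltr_wpDl.
have gk t : t \in `[0, T] -> `|primitive T g t| * `|w| <= kappa.
  move=> tT; apply: (@le_trans _ _ (kappa / (`|w| + 1) * (`|w| + 1))).
    by apply: ler_pM => //; [exact: gk' | rewrite lerDl].
  by rewrite mulfVK// gt_eqF.
have [mg [C gC]] := bg.
have bp := primitive_bounded_measurable T0 bg; have [mp [D pD]] := bp.
have [L LE] : exists L : dual V, forall v, (L v : R) = ip (i (j w)) (i v).
  by exists (pivot ip_norm i (i (j w))) => v; exact: pivotE.
pose psi := primitive T g.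
pose eta t := psi t *: j w; pose eta' t := g t *: L; pose etaH t := psi t *: i (j w).
have inp : in_Lp dt p%:E eta.
  apply: (in_Lp_bounded T0 p0 (C := D * `|j w|)) => [|t].
    apply: (@strongly_measurable_scale _ (measurableTypeR R)) => //; exact: strongly_measurable_cst.
  by rewrite normrZ ler_wpM2r.
have inq : in_Lp dt q%:E eta'.
  apply: (in_Lp_bounded T0 q0 (C := C * `|L|)) => [|t].
    apply: (@strongly_measurable_scale _ (measurableTypeR R)) => //; exact: strongly_measurable_cst.
  by rewrite normrZ ler_wpM2r.
have Ivv (h1 h2 : R -> R) (c : R) : dt.-integrable setT (EFin \o (fun t => h1 t * h2 t)) ->
    \int[dt]_t (h1 t * (h2 t * c)) = \int[dt]_t (h1 t * h2 t) * c.
  move=> I12; rewrite -RintegralZr//; apply: eq_Rintegral => t _; ring.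
have td : is_time_derivative T ip i eta eta'.
  move=> phi tphi v.
  have [cphi cdphi] := test_function_continuous tphi.
  have bphi := bounded_measurable_continuous T0 cphi.
  have bdphi := bounded_measurable_continuous T0 cdphi.
  have Idphi (h1 h2 : R -> R) : continuous h1 -> bounded_measurable h2 ->
      dt.-integrable setT (EFin \o (fun t => h1 t * h2 t)).
    move=> ch bh.
    have b1 := bounded_measurable_integrable T0
      (bounded_measurableM (bounded_measurable_continuous T0 ch) bh).
    apply: (@ae_le_integrable _ _ _ dt _ _ _ (integrable_norm b1)).
      by apply: measurable_funM; [exact: continuous_measurable_fun | case: bh].
    apply: dt_aeS (dt_ae_itv T) => t /andP[t0 tT].
    by rewrite /= indicE mem_setE in_itv/= (ltW t0) (ltW tT)/= mulr1.
  have -> : \int[dt]_t ((phi^`())%classic t * ip (i (eta t)) (i v)) =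
      \int[dt]_t ((phi^`())%classic t * (psi t * L v)).
    by apply: eq_Rintegral => t _; rewrite /eta linearZ/= linearZl_LR/= LE.
  have -> : \int[dt]_t (phi t * eta' t v) = \int[dt]_t (phi t * (g t * L v)) by [].
  rewrite !Ivv; [|exact: Idphi|exact: Idphi].
  by rewrite primitive_by_parts// mulNr.
have cv : is_continuous_version T i eta etaH.
  split.
    apply: continuous_subspaceT => t; apply: cvgZ; last exact: cvg_cst.
    exact: (primitive_continuous T0 bg).
  by apply: nearW => t; rewrite /eta linearZ.
have ball t : t \in `[0, T] -> exists2 w' : W, `|w'| <= kappa & etaH t = i (j w').
  move=> tT; exists (psi t *: w); first by rewrite normrZ gk.
  by rewrite !linearZ.
have := test eta eta' etaH inp inq td cv ball.
have uL := Lp_in_Lp u.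
(* The right-hand side of the inequality reduces to half of [|u0| ^+ 2]. *)
have e0 : etaH 0 = 0 by rewrite /etaH /psi primitive0// scale0r.
rewrite e0 subr0.
pose a t : R := ip (i (j w)) (i (u t)).
have I1 : dt.-integrable setT (EFin \o (fun t => g t * a t)).
  have := Lp_pair_integrable inq uL; apply: eq_integrable => // t _.
  by rewrite -[LHS]/((g t * (L (u t) : R))%:E) LE.
have I2 := Lp_pair_integrable ff uL.
have I3 : dt.-integrable setT (EFin \o (fun t => g t * psi t)).
  by have := bounded_measurable_integrable T0 (bounded_measurableM bg bp).
have I4 : dt.-integrable setT (EFin \o (fun t => psi t * (f t (j w) : R))).
  have := Lp_pair_integrable ff inp; apply: eq_integrable => // t _ /=.
  by rewrite /eta linearZ.
(* [c] is the squared norm of [i (j w)]; it multiplies the integral of [g * psi], which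
   [primitive_orth] annihilates. *)
pose c : R := L (j w).
have -> : \int[dt]_t (eta' t - f t) (u t - eta t) =
    \int[dt]_t ((g t * a t - (f t (u t) : R)) - (c * (g t * psi t) - psi t * (f t (j w) : R))).
  apply: eq_Rintegral => t _.
  rewrite -[LHS]/(g t * (L (u t - eta t) : R) - (f t (u t - eta t) : R)) !linearB/= /eta.
  rewrite !linearZ/= LE -/c.
  by rewrite /GRing.scale/= /a; ring.
have I3c := integrableZR c I3.
rewrite RintegralB//; [|exact: integrableBR|exact: integrableBR].
rewrite !RintegralB// RintegralZl// primitive_orth// mulr0 sub0r opprK => Htest.
have mfW : strongly_measurable (fun t => clin_comp (f t) j).
  have [h hE] := restriction_clin.
  rewrite (_ : (fun t => _) = h \o f); last by apply/funext => t; rewrite /= hE.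
  by apply: strongly_measurable_comp ff.1; exact: clin_continuous.
have [IW fW'] := bochner_norm1_Rintegral mfW fW.
(* [f] meets only [psi t *: w], of norm at most [kappa] in [W], so its [L^1] bound in [dual W]
   suffices. *)
have b4 : `|\int[dt]_t (psi t * (f t (j w) : R))| <= kappa * M0.
  apply: le_trans (le_normr_Rintegral measurableT I4) _.
  apply: (@le_trans _ _ (\int[dt]_t (kappa * `|clin_comp (f t) j|))).
    apply: (@le_Rintegral_ae _ _ _ dt); [exact: integrable_norm | exact: integrableZR |].
    apply: dt_aeS (dt_ae_itv T) => t /andP[t0 tT].
    have tT' : t \in `[0, T] by rewrite in_itv/= !ltW.
    rewrite normrM; apply: (@le_trans _ _ (`|psi t| * (`|clin_comp (f t) j| * `|w|))).
      by rewrite ler_wpM2l//; exact: (opnormP (clin_comp (f t) j) w).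
    by rewrite mulrCA mulrC ler_wpM2r// gk.
  by rewrite RintegralZl// ler_wpM2l// ltW.
have := ler_norm (- \int[dt]_t (psi t * (f t (j w) : R))); rewrite normrN.
by move: Htest fu b4; rewrite -/q -/a; lra.
Qed.

End Variation.

(** * Approximation in [L^1] by integrals over the cells of a grid *)

Section Grid.
Context (R : realType) (T : R).
Hypothesis T0 : 0 < T.
Local Notation dt := (dt T).

Lemma Rintegral_sum (n : nat) (f : nat -> R -> R) :
  (forall l, dt.-integrable setT (EFin \o f l)) ->
  dt.-integrable setT (EFin \o (fun t => \sum_(l < n) f l t)) /\
  \int[dt]_t (\sum_(l < n) f l t) = \sum_(l < n) \int[dt]_t f l t.
Proof.
move=> If; elim: n => [|n [IH1 IH2]].
  rewrite big_ord0; split.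
    by under eq_fun do rewrite big_ord0; exact: integrable_cst_fin (dt_fin T0).
  by under eq_Rintegral do rewrite big_ord0; rewrite Rintegral_cst// mul0r.
split.
  rewrite (_ : (fun t => _) = fun t => \sum_(l < n) f l t + f n t); first exact: integrableDR.
  by apply/funext => t; rewrite big_ord_recr.
by under eq_Rintegral do rewrite big_ord_recr/=; rewrite RintegralD// big_ord_recr/= IH2.
Qed.

Definition cell (m l : nat) : R -> R := \1_`](l%:R * (T / m%:R)), (l.+1%:R * (T / m%:R))]%classic.

Lemma cell_bounded_measurable m l : bounded_measurable (cell m l).
Proof.
split; first exact: measurable_indic.
by exists 1 => t; rewrite /cell indicE; case: (_ \in _); rewrite ?normr1 ?normr0.
Qed.

Lemma cell_ge0 m l t : 0 <= cell m l t.
Proof. by rewrite /cell indicE. Qed.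

Lemma cellE m l t : cell m l t = (l%:R * (T / m%:R) < t <= l.+1%:R * (T / m%:R))%R%:R.
Proof. by rewrite /cell indicE mem_setE in_itv. Qed.

Lemma cell_sum m t : (0 < m)%N -> 0 < t < T -> \sum_(l < m) cell m l t = 1.
Proof.
move=> m0 /andP[t0 tT].
have m0' : 0 < m%:R :> R by rewrite ltr0n.
have h0 : 0 < T / m%:R by rewrite divr_gt0.
(* The sum over the first [n] cells telescopes to the condition [t <= n T / m]. *)
have key n : \sum_(l < n) cell m l t = (t <= n%:R * (T / m%:R))%R%:R.
  elim: n => [|n IH]; first by rewrite big_ord0 mul0r leNgt t0.
  rewrite big_ord_recr/= IH cellE.
  have [tn|nt] := leP t (n%:R * (T / m%:R)); last by rewrite add0r.
  rewrite addr0 (le_trans tn)// ler_wpM2r ?ltW//; last by rewrite ltr_nat.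
by rewrite key mulrC divfK ?gt_eqF// (ltW tT).
Qed.

Lemma cell_Rintegral_le m l : (0 < m)%N -> 0 <= \int[dt]_t cell m l t <= T / m%:R.
Proof.
move=> m0; rewrite Rintegral_ge0//=.
have h0 : 0 <= T / m%:R by rewrite divr_ge0// ltW.
have le1 : l%:R * (T / m%:R) <= l.+1%:R * (T / m%:R) :> R by rewrite ler_wpM2r// ler_nat.
have := dt_itv_le T le1; rewrite -mulrBl -natrB// subSnn mul1r => dl.
rewrite /Rintegral integral_indic// setIT -lee_fin fineK//.
by rewrite ge0_fin_numE ?measure_ge0//; apply: le_lt_trans dl (ltry _).
Qed.

(** The test function is proportional to [sgn c] minus its average on each cell: its
   primitive vanishes at the nodes of the grid, so it is at most [2 T / m]. *)
Lemma admissible_L1 (b C : R) (m : nat) (c : R -> R) : 0 < b -> (0 < m)%N ->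
  measurable_fun setT c -> dt.-integrable setT (EFin \o c) ->
  (forall g, admissible T b g -> \int[dt]_t (g t * c t) <= C) ->
  \int[dt]_t `|c t| <=
    2 * (T / m%:R) / b * C + \sum_(l < m) `|\int[dt]_t (cell m l t * c t)|.
Proof.
move=> b0 m0 mc Ic cC.
have m0' : 0 < m%:R :> R by rewrite ltr0n.
set h := T / m%:R; have h0 : 0 < h by rewrite divr_gt0.
(* A sign of [c], equal to 1 where [c] vanishes; the set is a sublevel set of [- c], hence
   measurable. *)
pose sg t : R := 2 * \1_[set t | - c t <= 0] t - 1.
have sg1 t : `|sg t| <= 1.
  by rewrite /sg indicE; case: (_ \in _); rewrite ?mulr1 ?mulr0 ?sub0r ?normrN ?normr1// ger0_norm; lra.
have sgc t : sg t * c t = `|c t|.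
  rewrite /sg indicE (_ : (t \in [set t | - c t <= 0]) = (0 <= c t)); last first.
    by apply/idP/idP; rewrite inE /= oppr_le0.
  have [c0|c0] := leP 0 (c t).
    by rewrite mulr1 ger0_norm//; ring.
  by rewrite mulr0 ltr0_norm//; ring.
have bsg : bounded_measurable sg.
  split; last by exists 1.
  apply: measurable_funB => //; apply: measurable_funM => //.
  by apply: measurable_indic; apply: (@measurable_le_set _ (measurableTypeR R)); exact: measurableT_comp.
have bcell := cell_bounded_measurable m.
pose mu_ l := \int[dt]_t cell m l t.
(* The average of the sign over a cell. For [l] beyond the grid the cell is null and the quotient is
   0, consistently with its numerator. *)
pose s_ l := \int[dt]_t (sg t * cell m l t) / mu_ l.
have mu0 l : 0 <= mu_ l by have /andP[] := cell_Rintegral_le l m0.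
have muh l : mu_ l <= h by have /andP[] := cell_Rintegral_le l m0.
have Isg l : dt.-integrable setT (EFin \o (fun t => sg t * cell m l t)).
  by have := bounded_measurable_integrable T0 (bounded_measurableM bsg (bcell l)).
have Icell l : dt.-integrable setT (EFin \o cell m l).
  exact: bounded_measurable_integrable.
have sgmu l : `|\int[dt]_t (sg t * cell m l t)| <= mu_ l.
  apply: le_trans (le_normr_Rintegral measurableT (Isg l)) _.
  apply: le_Rintegral => //; first exact: integrable_norm.
  by move=> t _; rewrite normrM [`|cell m l t|]ger0_norm ?cell_ge0// ler_piMl ?cell_ge0.
have s1 l : `|s_ l| <= 1.
  have [mu00|mu00] := eqVneq (mu_ l) 0; first by rewrite /s_ mu00 invr0 mulr0 normr0.
  have mupos : 0 < mu_ l by rewrite lt_neqAle eq_sym mu00 mu0.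
  by rewrite normrM normfV [`|mu_ l|]ger0_norm// ler_pdivrMr// mul1r.
have smu l : s_ l * mu_ l = \int[dt]_t (sg t * cell m l t).
  have [mu00|mu00] := eqVneq (mu_ l) 0; last by rewrite /s_ divfK.
  by rewrite mu00 mulr0; have := sgmu l; rewrite mu00 normr_le0 => /eqP.
pose G l t := (sg t - s_ l) * cell m l t.
have bG l : bounded_measurable (G l).
  apply: bounded_measurableM => //.
  by have := bounded_measurableD bsg (bounded_measurable_cst (- s_ l)).
have IG l := bounded_measurable_integrable T0 (bG l).
have G2 l t : `|G l t| <= 2 * cell m l t.
  rewrite normrM [`|cell m l t|]ger0_norm ?cell_ge0// ler_wpM2r ?cell_ge0//.
  by apply: le_trans (ler_normB _ _) _; have := sg1 t; have := s1 l; lra.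
have G0 l : \int[dt]_t G l t = 0.
  rewrite (_ : (fun t => G l t) = fun t => sg t * cell m l t - s_ l * cell m l t).
    by rewrite RintegralB// ?RintegralZl// ?smu ?subrr//; exact: integrableZR.
  by apply/funext => t; rewrite /G mulrBl.
pose g t := \sum_(l < m) G l t.
have bg n : bounded_measurable (fun t => \sum_(l < n) G l t).
  elim: n => [|n IH].
    by under eq_fun do rewrite big_ord0; exact: bounded_measurable_cst.
  rewrite (_ : (fun t => _) = fun t => \sum_(l < n) G l t + G n t).
    exact: bounded_measurableD.
  by apply/funext => t; rewrite big_ord_recr.
(* [G l] lives on one cell and has zero mean there. *)
have primG l t : primitive T (G l) t != 0 -> l%:R * h < t < l.+1%:R * h.
  move=> pn; rewrite !ltNge; apply/andP; split; apply: contraNN pn => tl; apply/eqP.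
    rewrite /primitive; under eq_Rintegral.
      move=> s _; rewrite (_ : _ * _ = 0); first over.
      rewrite /G cellE /heaviside -/h.
      by have [st|] := leP s t; rewrite ?mulr0// ltNge (le_trans st tl)/= mulr0 mul0r.
    by rewrite Rintegral_cst// mul0r.
  rewrite -(G0 l) /primitive; apply: eq_Rintegral => s _.
  rewrite /G cellE /heaviside -/h.
  have [st|ts] := leP s t; first by rewrite mulr1.
  by rewrite [_ <= _ * h]leNgt (le_lt_trans tl ts) andbF !mulr0.
have primG2 l t : `|primitive T (G l) t| <= 2 * h.
  have IGt : dt.-integrable setT (EFin \o (fun s => G l s * heaviside s t)).
    by have := bounded_measurable_integrable T0 (bounded_measurableM (bG l) (bounded_measurableR t)).
  apply: le_trans (le_normr_Rintegral measurableT IGt) _.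
  apply: (@le_trans _ _ (\int[dt]_s (2 * cell m l s))).
    apply: le_Rintegral => //; [exact: integrable_norm | exact: integrableZR |].
    move=> s _; rewrite normrM; apply: le_trans (G2 l s).
    by rewrite ler_piMr// heaviside_norm.
  by rewrite RintegralZl// ler_wpM2l//; exact: muh.
have prim_g t : primitive T g t = \sum_(l < m) primitive T (G l) t.
  rewrite /primitive /g; under eq_Rintegral do rewrite mulr_suml.
  have IGt l : dt.-integrable setT (EFin \o (fun s => G l s * heaviside s t)).
    by have := bounded_measurable_integrable T0 (bounded_measurableM (bG l) (bounded_measurableR t)).
  exact: (Rintegral_sum m IGt).2.
(* Open cells are disjoint, so at most one term is nonzero at [t], and the bound does not grow with
   [m]. *)
have prim_le t : `|primitive T g t| <= 2 * h.
  rewrite prim_g.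
  have [/existsP[l0 nz]|/existsPn z] := boolP [exists l : 'I_m, primitive T (G l) t != 0].
    rewrite (bigD1 l0)//= big1 ?addr0//.
    move=> l ll0; apply/eqP; apply: contraNT ll0 => nzl; apply/eqP/val_inj => /=.
    have /andP[a1 a2] := primG _ _ nz; have /andP[b1 b2] := primG _ _ nzl.
    have := lt_trans a1 b2; have := lt_trans b1 a2; rewrite !ltr_pM2r// !ltr_nat !ltnS => x y.
    by apply/eqP; rewrite eqn_leq x y.
  rewrite big1; first by rewrite normr0 mulr_ge0// ltW.
  move=> l _.
  by apply/eqP; have := z l; rewrite negbK.
have adm : admissible T b (fun t => b / (2 * h) * g t).
  have I := bounded_measurable_integrable T0 (bg m).
  split.
  - exact: bounded_measurableM (bounded_measurable_cst _) (bg m).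
  - rewrite RintegralZl// (Rintegral_sum m IG).2 big1 ?mulr0// => l _; exact: G0.
  move=> t _.
  have -> : primitive T (fun t => b / (2 * h) * g t) t = b / (2 * h) * primitive T g t.
    rewrite /primitive -RintegralZl//.
      by apply: eq_Rintegral => s _; rewrite mulrA.
    by have := bounded_measurable_integrable T0 (bounded_measurableM (bg m) (bounded_measurableR t)).
  have bh : 0 < b / (2 * h) by rewrite divr_gt0// mulr_gt0.
  rewrite normrM (gtr0_norm bh) -ler_pdivlMl// invf_div.
  by rewrite divfK ?gt_eqF.
have Ibc (f : R -> R) : bounded_measurable f -> dt.-integrable setT (EFin \o (fun t => f t * c t)).
  move=> [mf [D fD]].
  have D0 : 0 <= D by apply: le_trans (fD 0).
  apply: (@ae_le_integrable _ _ _ dt _ (fun t => D * `|c t|)).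
  - exact: measurable_funM.
  - by apply: integrableZR; exact: integrable_norm.
  by apply: nearW => t; rewrite normrM ler_wpM2r.
have := cC _ adm.
under eq_Rintegral do rewrite -mulrA.
rewrite RintegralZl//; last exact: Ibc (bg m).
have Igc l := Ibc _ (bG l).
have -> : \int[dt]_t (g t * c t) = \sum_(l < m) \int[dt]_t (G l t * c t).
  by rewrite -(Rintegral_sum m Igc).2; apply: eq_Rintegral => t _; rewrite mulr_suml.
have Isc l : dt.-integrable setT (EFin \o (fun t => cell m l t * `|c t|)).
  apply: (@ae_le_integrable _ _ _ dt _ (fun t => `|c t|)); last first.
  - apply: nearW => t; rewrite normrM normr_id [`|cell m l t|]ger0_norm ?cell_ge0//.
    by rewrite ler_piMl// cellE; case: (_ && _).
  - exact: integrable_norm.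
  - by apply: measurable_funM; [case: (bcell l) | exact: measurableT_comp].
have Icc l := Ibc _ (bcell l).
have EG l : \int[dt]_t (G l t * c t) =
    \int[dt]_t (cell m l t * `|c t|) - s_ l * \int[dt]_t (cell m l t * c t).
  rewrite -RintegralZl// -RintegralB//; last exact: integrableZR.
  by apply: eq_Rintegral => t _; rewrite -sgc /G; ring.
under eq_bigr do rewrite EG.
rewrite sumrB -(Rintegral_sum m Isc).2.
have -> : \int[dt]_t (\sum_(l < m) (cell m l t * `|c t|)) = \int[dt]_t `|c t|.
  apply: (@eq_Rintegral_ae _ _ _ dt).
  - by apply/measurable_EFinP; exact: measurable_int (Rintegral_sum m Isc).1.
  - exact: measurableT_comp.
  by apply: dt_aeS (dt_ae_itv T) => t tT; rewrite -mulr_suml cell_sum// mul1r.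
have le2 : \sum_(l < m) s_ l * \int[dt]_t (cell m l t * c t) <=
    \sum_(l < m) `|\int[dt]_t (cell m l t * c t)|.
  apply: ler_sum => l _; apply: le_trans (ler_norm _) _; rewrite normrM.
  by rewrite ler_piMl.
have bh : 0 < b / (2 * h) by rewrite divr_gt0// mulr_gt0.
rewrite -ler_pdivlMl// invf_div => H.
by rewrite -[2 * h / b * C]/(2 * h / b * C); lra.
Qed.

End Grid.

(** * Compactness *)

(** The image ultrafilter lives on a compact interval, so it has a cluster point, and an ultrafilter
    contains every preimage of a ball around it. *)
Lemma ultra_small_oscillation (T : Type) (R : realType) (F : set_system T) (l : T -> R) (B : R) :
  UltraFilter F -> F [set x | `|l x| <= B] ->
  forall e, 0 < e -> exists2 A, F A & forall x y, A x -> A y -> `|l x - l y| <= e.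
Proof.
move=> FU FB e e0.
have [r [_ rc]] : `[- B, B]%classic `&` cluster (l @ F) !=set0.
  apply: (@segment_compact R (- B) B); apply: filterS FB => x xB.
  by rewrite /= in_itv/= -ler_norml; exact: xB.
have e2 : 0 < e / 2 by rewrite divr_gt0.
exists (l @^-1` ball r (e / 2)).
  have [//|FC] := in_ultra_setVsetC (l @^-1` ball r (e / 2)) FU.
  have [y [/= ny yb]] := rc (~` ball r (e / 2)) (ball r (e / 2)) FC (nbhsx_ballx r _ e2).
  by [].
move=> x y; rewrite -ball_normE /= => hx hy.
have -> : l x - l y = (r - l y) - (r - l x) by ring.
by apply: le_trans (ler_normB _ _) _; lra.
Qed.

(** Total boundedness is expressed by every ultrafilter on [K] being Cauchy, which replaces the
    construction of finite nets. *)
Lemma compact_cauchy_ultra (R : realType) (E : normedModType R) (K : set E) :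
  closed K ->
  (forall u : nat -> E, (forall e, 0 < e ->
     exists N, forall n m, (N <= n)%N -> (N <= m)%N -> `|u n - u m| <= e) ->
     exists l : E, u @ \oo --> l) ->
  (forall F, UltraFilter F -> F K -> forall e, 0 < e ->
     exists2 A, F A & forall x y, A x -> A y -> `|x - y| <= e) ->
  compact K.
Proof.
move=> cK complete cauchyF; rewrite compact_ultra => F FU FK.
have /choice[A HA] : forall n : nat, exists A, F A /\ forall x y, A x -> A y -> `|x - y| <= n.+1%:R^-1.
  move=> n; have n0 : 0 < n.+1%:R^-1 :> R by rewrite invr_gt0.
  by have [A FA HA] := cauchyF F FU FK _ n0; exists A.
pose B n := K `&` [set x | forall k : 'I_n.+1, A k x].
have FB n : F (B n).
  by apply: filterI => //; apply: filter_forall => k; exact: (HA k).1.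
have /choice[u Bu] : forall n, exists x, B n x by move=> n; exact: filter_ex (FB n).
have Au n k : (n <= k)%N -> A n (u k).
  by move=> nk; have [_] := Bu k; move=> /(_ (Ordinal (nk : (n < k.+1)%N))).
have [l ul] : exists l : E, u @ \oo --> l.
  apply: complete => e e0; have [N _ HN] := near_infty_natSinv_lt (PosNum e0).
  exists N => n m Nn Nm; apply: (@le_trans _ _ N.+1%:R^-1); first by apply: (HA N).2; exact: Au.
  exact/ltW/(HN N (leqnn N)).
exists l; split.
  by apply: (@closed_cvg _ _ \oo _ u K cK _ l ul); apply: nearW => n; exact: (Bu n).1.
move=> U /nbhs_ballP[e /= e0 lU].
have e2 : 0 < e / 2 by rewrite divr_gt0.
have [N _ HN] := near_infty_natSinv_lt (PosNum e2).
have /cvgrPdist_lt/(_ _ e2)[M _ HM] := ul.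
apply: filterS (HA N).1 => x ANx; apply: lU; rewrite -ball_normE /=.
pose k := maxn M N.
have -> : l - x = (l - u k) + (u k - x) by rewrite addrA subrK.
apply: le_lt_trans (ler_normD _ _) _.
have h1 : `|l - u k| < e / 2 by apply: HM; rewrite /= leq_maxl.
have h2 : `|u k - x| <= N.+1%:R^-1 by apply: (HA N).2 => //; apply: Au; rewrite leq_maxr.
have h3 : N.+1%:R^-1 < e / 2 := HN N (leqnn N).
by rewrite (splitr e) ltrD// (le_lt_trans h2 h3).
Qed.

(** * Pairings with scalar weights as continuous functionals *)

Section Pairing.
Context (R : realType) (T : R).
Hypothesis T0 : 0 < T.
Context (H : completeNormedModType R) (ip : {dot H for idfun}).
Hypothesis ip_norm : forall x : H, ip x x = `|x| ^+ 2.
Variables (p : R) (p_gt1 : 1 < p).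
Local Notation dt := (dt T).
Local Notation LpH := (Lp dt (lee1_EFin p_gt1) H).

Lemma pairing_integrable (g : R -> R) (h : H) (z : LpH) : bounded_measurable g ->
  dt.-integrable setT (EFin \o (fun t => g t * ip h (z t))).
Proof.
move=> [mg [C gC]].
have [L LE] := riesz_clin ip_norm h.
have q0 : 0 < p / (p - 1) by rewrite divr_gt0 ?subr_gt0// (lt_trans ltr01).
have inq : in_Lp dt (p / (p - 1))%:E (fun t => g t *: L).
  apply: (in_Lp_bounded T0 q0 (C := C * `|L|)) => [|t].
    by apply: (@strongly_measurable_scale _ (measurableTypeR R)) => //; exact: strongly_measurable_cst.
  by rewrite normrZ ler_wpM2r.
have := Lp_pair_integrable p_gt1 inq (Lp_in_Lp z); apply: eq_integrable => // t _.
by rewrite -[LHS]/((g t * (L (z t) : R))%:E) LE.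
Qed.

Lemma pairing_clin (g : R -> R) (h : H) : bounded_measurable g ->
  exists l : dual LpH, forall z : LpH, (l z : R) = \int[dt]_t (g t * ip h (z t)).
Proof.
move=> bg; have [mg [C gC]] := bg.
have Ig z := pairing_integrable h z bg.
pose f (z : LpH) : R := \int[dt]_t (g t * ip h (z t)).
have fl a z z' : f (a *: z + z') = a * f z + f z'.
  rewrite /f -RintegralZl// -RintegralD//; last exact: integrableZR.
  apply: (@eq_Rintegral_ae _ _ _ dt).
  - by apply/measurable_EFinP; exact: measurable_int (Ig _).
  - by apply: measurable_funD; [apply: measurable_funM => //|]; apply/measurable_EFinP; exact: measurable_int (Ig _).
  apply: dt_aeS2 (LpD (a *: z) z') (LpZ a z) => t -> ->.
  by rewrite linearPr/=; ring.
have C0 : 0 <= C by apply: le_trans (gC 0).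
(* From [|z| <= 1 + |z|^p], whose integral is at most [T + 1] on the unit ball. *)
pose B := C * `|h| * (T + 1).
have B0 : 0 <= B by rewrite mulr_ge0 ?mulr_ge0 ?addr_ge0// ltW.
have f1 (z : LpH) : `|z| <= 1 -> `|f z| <= B.
  move=> z1; apply: le_trans (le_normr_Rintegral measurableT (Ig z)) _.
  have I1 : dt.-integrable setT (EFin \o (fun t => 1 + `|z t| `^ p)).
    by apply: integrableDR; [exact: integrable_cst_fin (dt_fin T0) | exact: Lp_integrable].
  apply: (@le_trans _ _ (\int[dt]_t (C * `|h| * (1 + `|z t| `^ p)))).
    apply: le_Rintegral => //; [exact: integrable_norm | exact: integrableZR |].
    move=> t _; rewrite normrM -mulrA; apply: ler_pM => //.
    apply: le_trans (ip_norm_le ip_norm _ _) _; rewrite ler_wpM2l//.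
    have [z01|z01] := leP `|z t| 1; first by rewrite (le_trans z01)// lerDl powR_ge0.
    by rewrite (le_trans (le1r_powR (ltW z01) (ltW p_gt1)))// lerDr.
  rewrite RintegralZl// ler_wpM2l ?mulr_ge0//.
  rewrite RintegralD//; [|exact: integrable_cst_fin (dt_fin T0)|exact: Lp_integrable].
  rewrite Rintegral_cst// dtT// mul1r lerD2l -Lp_norm_pow.
  have : `|z| `^ p <= 1 `^ p by apply: powR_le => //; exact: ltW (lt_trans ltr01 p_gt1).
  by rewrite powR1.
have fC z : `|f z| <= B * `|z|.
  have [->|z0] := eqVneq z 0.
    have f0 : f 0 = 0 by have := fl (-1) 0 0; rewrite scaler0 addr0 mulN1r addNr.
    by rewrite f0 !normr0 mulr0.
  have nz : 0 < `|z| by rewrite normr_gt0.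
  have := f1 (`|z|^-1 *: z); rewrite normrZ normfV normr_id mulVf ?gt_eqF// => /(_ (lexx _)).
  have f0 : f 0 = 0 by have := fl (-1) 0 0; rewrite scaler0 addr0 mulN1r addNr.
  have := fl (`|z|^-1) z 0; rewrite addr0 f0 addr0 => ->.
  by rewrite normrM normfV normr_id ler_pdivrMl// mulrC.
exact: (@bounded_clin _ LpH R^o f B fl fC).
Qed.

End Pairing.

(** * Closed convex sets of functions of bounded variation *)

Section Compactness.
Context (R : realType) (T : R).
Hypothesis T0 : 0 < T.
Context (V W H : completeNormedModType R) (ip : {dot H for idfun}).
Hypothesis ip_norm : forall x : H, ip x x = `|x| ^+ 2.
Variables (i : clin V H) (j : clin W V) (p : R) (p_gt1 : 1 < p).
Variables (kappa M0 C0 : R).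
Hypotheses (kappa0 : 0 < kappa) (M00 : 0 < M0) (C00 : 0 <= C0).
Local Notation dt := (dt T).
Local Notation LpV := (Lp dt (lee1_EFin p_gt1) V).
Local Notation LpH := (Lp dt (lee1_EFin p_gt1) H).
Let p0 : 0 < p. Proof. exact: lt_trans ltr01 p_gt1. Qed.

(** What remains of [Z] once [f] is eliminated: a norm bound, a pointwise bound and bounds on linear
    functionals, each defining a closed convex set. *)
Definition bounded_variation : set LpV := [set u | [/\ `|u| <= M0,
  {ae dt, forall t, `|Lp_map i u t| <= M0} &
  forall w g, admissible T (kappa / (`|w| + 1)) g ->
    \int[dt]_t (g t * ip (i (j w)) (Lp_map i u t)) <= C0]].

Lemma bounded_variation_closed : closed bounded_variation.
Proof.
move=> u /closure_seq[u_ [Ku uu]].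
have [I IE] := Lp_map_clin dt (lee1_EFin p_gt1) i.
have iu : (fun n => Lp_map i (u_ n)) @ \oo --> Lp_map i u.
  rewrite -IE; have -> : (fun n => Lp_map i (u_ n)) = I \o u_ by apply/funext => n; rewrite /= IE.
  by apply: continuous_cvg uu; exact: clin_continuous.
split.
- apply: (ler_cvg_to (cvg_norm uu) (cvg_cst M0)); apply: nearW => n.
  by have [] := Ku n.
- have [phi [_ cphi]] := Lp_ae_subseq iu.
  have bd : {ae dt, forall t, forall n, `|Lp_map i (u_ (phi n)) t| <= M0}.
    by apply: ae_foralln => n; have [] := Ku (phi n).
  apply: dt_aeS2 cphi bd => t ct bt.
  by apply: (ler_cvg_to (cvg_norm ct) (cvg_cst M0)); apply: nearW.
move=> w g adm; have [bg _ _] := adm.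
have [l lE] := pairing_clin T0 ip_norm p_gt1 (i (j w)) bg.
rewrite -lE.
have cl : (fun n => l (Lp_map i (u_ n)) : R) @ \oo --> (l (Lp_map i u) : R).
  by apply: continuous_cvg iu; exact: clin_continuous.
apply: (ler_cvg_to cl (cvg_cst C0)); apply: nearW => n; rewrite lE.
by have [_ _ h] := Ku n; exact: h.
Qed.

Lemma bounded_variation_convex (a b : LpV) s : bounded_variation a -> bounded_variation b ->
  0 <= s <= 1 -> bounded_variation (s *: a + (1 - s) *: b).
Proof.
move=> [a1 a2 a3] [b1 b2 b3] /andP[s0 s1].
have s1' : 0 <= 1 - s by rewrite subr_ge0.
have cvx (E : normedModType R) (x y : E) : `|x| <= M0 -> `|y| <= M0 -> `|s *: x + (1 - s) *: y| <= M0.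
  move=> x1 y1; apply: le_trans (ler_normD _ _) _.
  rewrite !normrZ (ger0_norm s0) (ger0_norm s1').
  have h1 : s * `|x| <= s * M0 by rewrite ler_wpM2l.
  have h2 : (1 - s) * `|y| <= (1 - s) * M0 by rewrite ler_wpM2l.
  by lra.
have mapE : Lp_map i (s *: a + (1 - s) *: b) = s *: Lp_map i a + (1 - s) *: Lp_map i b.
  have lin0 (c : R) (x : LpV) : Lp_map i (c *: x) = c *: Lp_map i x.
    have [I IE] := Lp_map_clin dt (lee1_EFin p_gt1) i.
    by rewrite -!IE linearZ.
  by rewrite Lp_map_linear lin0.
split; first exact: cvx.
- have h : {ae dt, forall t, Lp_map i (s *: a + (1 - s) *: b) t =
      s *: Lp_map i a t + (1 - s) *: Lp_map i b t}.
    rewrite mapE.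
    have h1 : {ae dt, forall t, (s *: Lp_map i a : LpH) t = s *: Lp_map i a t /\
        ((1 - s) *: Lp_map i b : LpH) t = (1 - s) *: Lp_map i b t}.
      by apply: dt_aeS2 (LpZ s (Lp_map i a)) (LpZ (1 - s) (Lp_map i b)) => t.
    by apply: dt_aeS2 (LpD (s *: Lp_map i a) ((1 - s) *: Lp_map i b)) h1 => t -> [-> ->].
  have h2 : {ae dt, forall t, `|Lp_map i a t| <= M0 /\ `|Lp_map i b t| <= M0}.
    by apply: dt_aeS2 a2 b2 => t.
  by apply: dt_aeS2 h h2 => t -> [x y]; exact: cvx.
move=> w g adm; have [bg _ _] := adm.
have [l lE] := pairing_clin T0 ip_norm p_gt1 (i (j w)) bg.
rewrite -lE mapE linearD/= !linearZ/= !lE.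
have h1 := ler_wpM2l s0 (a3 w g adm); have h2 := ler_wpM2l s1' (b3 w g adm).
by rewrite /GRing.scale/=; lra.
Qed.

Lemma admissibleN b g : admissible T b g -> admissible T b (fun t => - g t).
Proof.
move=> [bg g0 gb]; have Ig := bounded_measurable_integrable T0 bg.
have EN (f : R -> R) : dt.-integrable setT (EFin \o f) -> \int[dt]_t (- f t) = - \int[dt]_t f t.
  by move=> If; rewrite -[RHS]mulN1r -RintegralZl//; apply: eq_Rintegral => t _; rewrite mulN1r.
split.
- have := bounded_measurableM (bounded_measurable_cst (-1)) bg.
  by under eq_fun do rewrite mulN1r.
- by rewrite EN// g0 oppr0.
move=> t tT; have := gb t tT; rewrite /primitive.
under [X in _ -> `|X| <= _]eq_Rintegral do rewrite mulNr.
rewrite EN ?normrN//.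
by have := bounded_measurable_integrable T0 (bounded_measurableM bg (bounded_measurableR t)).
Qed.

Variable w : nat -> W.
Let h n := i (j (w n)).
Hypotheses (i_compact : compact_operator i) (h_dense : dense_seq h).

(** Ehrling's inequality bounds [|z t|] by finitely many [|ip (h k) (z t)|], and each of
   these, having bounded variation, is close in [L^1] to its averages over cells. *)
Lemma bounded_variation_close dl : 0 < dl -> exists N m eta, [/\ (0 < m)%N, 0 < eta &
  forall u u' : LpV, bounded_variation u -> bounded_variation u' ->
  (forall (k : 'I_N) (l : 'I_m), `|\int[dt]_t (cell T m l t * ip (h k) (Lp_map i u t)) -
     \int[dt]_t (cell T m l t * ip (h k) (Lp_map i u' t))| <= eta) ->
  `|Lp_map i u - Lp_map i u'| <= dl].
Proof.
move=> dl0.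
(* Since [|z| <= 2 M0] almost everywhere, [|z|^p <= D |z|], and an [L^1] bound by [tau] suffices. A
   third of [tau] goes to Ehrling's error through [e], a third to the oscillation within cells
   through [m], and a third to the differences of cell integrals through [eta]. *)
pose D := (2 * M0) `^ (p - 1); have D0 : 0 < D by rewrite powR_gt0// mulr_gt0.
pose tau := dl `^ p / D; have tau0 : 0 < tau by rewrite divr_gt0// powR_gt0.
(* [Q] bounds the integral of [1 + |u - u'|^p], which dominates that of [|u - u'|] in Ehrling's
   inequality. *)
pose Q := T + (2 * M0) `^ p; have Q0 : 0 < Q by rewrite ltr_pwDl// powR_ge0.
pose e := tau / (3 * Q); have e0 : 0 < e by rewrite divr_gt0// mulr_gt0.
have [N HN] := ehrling ip_norm i_compact h_dense e0.
pose b k := kappa / (`|w k| + 1).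
have b0 k : 0 < b k by rewrite divr_gt0// ltr_wpDl.
pose S := \sum_(k < N) (4 * C0 * T / b k).
have S0 : 0 <= S by rewrite sumr_ge0// => k _; rewrite divr_ge0 ?(ltW (b0 k))// mulr_ge0 ?(ltW T0)// mulr_ge0.
pose m := (Num.truncn (3 * N%:R * S / tau)).+1.
have m0 : 0 < m%:R :> R by rewrite ltr0n.
have mS : N%:R * (S / m%:R) <= tau / 3.
  have : 3 * N%:R * S / tau < m%:R by rewrite truncnS_gt.
  rewrite ltr_pdivrMr// => h1.
  rewrite mulrA ler_pdivrMr// -(ler_pM2l (ltr0Sn R 2)).
  by rewrite mulrA (le_trans (ltW h1))// mulrC le_eqVlt; apply/orP; left; apply/eqP; field.
pose eta := tau / (3 * (N%:R * N%:R * m%:R + 1)).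
have B0 : 0 < N%:R * N%:R * m%:R + 1 :> R by rewrite ltr_wpDl// !mulr_ge0.
have eta0 : 0 < eta by rewrite divr_gt0// mulr_gt0.
exists N, m, eta; split=> // u u' [u1 u2 u3] [v1 v2 v3] close.
pose z : LpH := Lp_map i u - Lp_map i u'.
have iB : Lp_map i (u - u') = z.
  have [I IE] := Lp_map_clin dt (lee1_EFin p_gt1) i.
  by rewrite /z -!IE linearB.
have mz := (Lp_in_Lp z).1.
have mnz : measurable_fun setT (fun t => `|z t|) := measurable_normr_strongly mz.
have z2 : {ae dt, forall t, `|z t| <= 2 * M0}.
  have h2 : {ae dt, forall t, `|Lp_map i u t| <= M0 /\ `|Lp_map i u' t| <= M0}.
    by apply: dt_aeS2 u2 v2 => t.
  apply: dt_aeS2 (LpB (Lp_map i u) (Lp_map i u')) h2 => t -> [x y].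
  by apply: le_trans (ler_normB _ _) _; lra.
have Inz : dt.-integrable setT (EFin \o (fun t => `|z t|)).
  apply: (@ae_le_integrable _ _ _ dt _ _ mnz (integrable_cst_fin (2 * M0) (dt_fin T0))).
  by apply: dt_aeS z2 => t; rewrite normr_id.
pose c k t : R := ip (h k) (z t).
have one : bounded_measurable (fun _ : R => (1 : R)) by exact: bounded_measurable_cst.
have Ic k : dt.-integrable setT (EFin \o c k).
  have := pairing_integrable T0 ip_norm (h k) z one; apply: eq_integrable => // t _ /=.
  by rewrite mul1r.
have mc k : measurable_fun setT (c k) by apply/measurable_EFinP; exact: measurable_int (Ic k).
have cdiff k (g : R -> R) : bounded_measurable g -> \int[dt]_t (g t * c k t) =
    \int[dt]_t (g t * ip (h k) (Lp_map i u t)) - \int[dt]_t (g t * ip (h k) (Lp_map i u' t)).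
  move=> bg; have [l lE] := pairing_clin T0 ip_norm p_gt1 (h k) bg.
  by rewrite /c -!lE /z linearB.
have c1 k : \int[dt]_t `|c k t| <= (4 * C0 * T / b k) / m%:R +
    \sum_(l < m) `|\int[dt]_t (cell T m l t * c k t)|.
  (* [- g] is admissible as well, so each of the two functions contributes [C0]. *)
  have hC g : admissible T (b k) g -> \int[dt]_t (g t * c k t) <= 2 * C0.
    move=> adm; have [bg _ _] := adm.
    rewrite cdiff//; have := u3 _ _ adm; have := v3 _ _ (admissibleN adm).
    have -> : \int[dt]_t (- g t * ip (i (j (w k))) (Lp_map i u' t)) =
        - \int[dt]_t (g t * ip (h k) (Lp_map i u' t)).
      rewrite -[RHS]mulN1r -RintegralZl//; last exact: pairing_integrable.
      by apply: eq_Rintegral => t _; rewrite mulN1r mulNr.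
    by rewrite -/(h k); lra.
  have := admissible_L1 T0 (b0 k) (ltn0Sn _ : (0 < m)%N) (mc k) (Ic k) hC.
  move=> /le_trans; apply; rewrite lerD2r le_eqVlt; apply/orP; left; apply/eqP.
  by field; rewrite !gt_eqF.
have c2 (k : 'I_N) : \sum_(l < m) `|\int[dt]_t (cell T m l t * c k t)| <= m%:R * eta.
  rewrite -[m in m%:R]card_ord -sum1_card natr_sum mulr_suml; apply: ler_sum => l _.
  rewrite mul1r cdiff; last exact: cell_bounded_measurable.
  exact: close.
have z1 : \int[dt]_t `|z t| <= tau.
  have Iuu := Lp_integrable (u - u').
  have mnu : measurable_fun setT (fun t => `|(u - u' : LpV) t|).
    exact: measurable_normr_strongly (Lp_in_Lp _).1.
  have I1 : dt.-integrable setT (EFin \o (fun t => 1 + `|(u - u' : LpV) t| `^ p)).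
    by apply: integrableDR Iuu; exact: integrable_cst_fin (dt_fin T0).
  have Isum := @Rintegral_sum R T T0 N (fun k t => `|c k t|) (fun k => integrable_norm (Ic k)).
  apply: (@le_trans _ _ (\int[dt]_t (e * (1 + `|(u - u' : LpV) t| `^ p) +
      N%:R * \sum_(k < N) `|c k t|))).
    apply: (@le_Rintegral_ae _ _ _ dt) => //.
      by apply: integrableDR; apply: integrableZR => //; exact: Isum.1.
    have mE := Lp_mapE i (u - u'); rewrite iB in mE.
    apply: dt_aeS mE => t zE; rewrite /c zE; apply: le_trans (HN _) _.
    rewrite lerD2r ler_wpM2l ?(ltW e0)//.
    have [x1|x1] := leP `|(u - u' : LpV) t| 1; first by rewrite (le_trans x1)// lerDl powR_ge0.
    by rewrite (le_trans (le1r_powR (ltW x1) (ltW p_gt1)))// lerDr.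
  rewrite RintegralD//; [|exact: integrableZR|apply: integrableZR; exact: Isum.1].
  rewrite RintegralZl// RintegralZl//; last exact: Isum.1.
  rewrite RintegralD//; last exact: integrable_cst_fin (dt_fin T0).
  rewrite Rintegral_cst// dtT// mul1r -Lp_norm_pow Isum.2.
  have uu : `|u - u'| `^ p <= (2 * M0) `^ p.
    apply: powR_le; rewrite ?(ltW p0)//; apply: le_trans (ler_normB _ _) _; lra.
  have t1 : e * (T + `|u - u'| `^ p) <= tau / 3.
    apply: (@le_trans _ _ (e * Q)); first by rewrite ler_wpM2l ?(ltW e0)// lerD2l.
    by rewrite /e le_eqVlt; apply/orP; left; apply/eqP; field; rewrite gt_eqF.
  have t2 : \sum_(k < N) \int[dt]_t `|c k t| <= S / m%:R + N%:R * (m%:R * eta).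
    apply: (@le_trans _ _ (\sum_(k < N) ((4 * C0 * T / b k) / m%:R + m%:R * eta))).
      by apply: ler_sum => k _; apply: le_trans (c1 k) _; rewrite lerD2l.
    by rewrite big_split/= -mulr_suml sumr_const card_ord -[_ *+ N]mulr_natl.
  have t3 : N%:R * (N%:R * (m%:R * eta)) <= tau / 3.
    apply: (@le_trans _ _ ((N%:R * N%:R * m%:R + 1) * eta)).
      by rewrite 2!mulrA ler_wpM2r ?(ltW eta0)// lerDl.
    by rewrite /eta le_eqVlt; apply/orP; left; apply/eqP; field; rewrite gt_eqF.
  have t4 := ler_wpM2l (ler0n R N) t2.
  by rewrite mulrDr in t4; rewrite [fine _]/=; lra.
rewrite -/z Lp_norm_le ?(ltW dl0)//.
apply: (@le_trans _ _ (\int[dt]_t (D * `|z t|))).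
  apply: (@le_Rintegral_ae _ _ _ dt); [exact: Lp_integrable | exact: integrableZR |].
  apply: dt_aeS z2 => t zt; rewrite -(mulr_powRB1 (normr_ge0 (z t)) p0) mulrC.
  by rewrite ler_wpM2r// /D powR_le// subr_ge0 ltW.
rewrite RintegralZl//; apply: le_trans (ler_wpM2l (ltW D0) z1) _.
by rewrite /tau mulrC divfK// gt_eqF.
Qed.

Hypotheses (V_reflexive : reflexive_space V) (i_inj : injective i).
Hypothesis Vdual_convex : strictly_convex (dual V).
Hypothesis v_dense : dense_seq (j \o w).

(** The image is closed by lifting limits to [LpV] and then into [K]. An ultrafilter on it is Cauchy
    because finitely many cell integrals, bounded on [K], control the distance. *)
Lemma compact_Lp_map_image (K : set LpV) : closed K ->
  (forall a b s, K a -> K b -> 0 <= s <= 1 -> K ((1 - s) *: a + s *: b)) ->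
  K `<=` bounded_variation -> compact (Lp_map i @` K).
Proof.
move=> cK convK KB.
have KM a : K a -> `|a| <= M0 by move=> /KB[].
apply: compact_cauchy_ultra.
- move=> z /closure_seq[z_ [Kz zz]].
  have /choice[u Hu] : forall n, exists u, K u /\ Lp_map i u = z_ n.
    by move=> n; have [u Ku <-] := Kz n; exists u.
  have uz : (fun n => Lp_map i (u n)) @ \oo --> z.
    by have -> : (fun n => Lp_map i (u n)) = z_ by apply/funext => n; exact: (Hu n).2.
  have [a [_ az]] := Lp_map_closed_ball (dt_fin T0) p_gt1 ip_norm V_reflexive i_inj v_dense
    (ltW M00) (fun n => KM _ (Hu n).1) uz.
  exists a => //; rewrite -az in uz.
  exact: (closed_convex_Lp_map (dt_fin T0) p_gt1 ip_norm V_reflexive i_inj Vdual_convex v_dense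
    h_dense cK convK (ltW M00) KM (fun n => (Hu n).1) uz).
- by move=> u uC; exact: Lp_complete.
move=> F FU FK e e0.
have [N [m [eta [m0 eta0 close]]]] := bounded_variation_close e0.
have [I IE] := Lp_map_clin dt (lee1_EFin p_gt1) i.
have /choice[A HA] : forall kl : 'I_N * 'I_m, exists A, F A /\ forall x y : LpH, A x -> A y ->
    `|\int[dt]_t (cell T m kl.2 t * ip (h kl.1) (x t)) -
      \int[dt]_t (cell T m kl.2 t * ip (h kl.1) (y t))| <= eta.
  move=> [k l] /=.
  have [L LE] := pairing_clin T0 ip_norm p_gt1 (h k) (cell_bounded_measurable T m l).
  have FB : F [set x | `|L x : R| <= opnorm L * (opnorm I * M0)].
    apply: filterS FK => _ [u Ku <-] /=; apply: le_trans (opnormP L _) _.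
    rewrite ler_wpM2l ?opnorm_ge0// -IE; apply: le_trans (opnormP I u) _.
    by rewrite ler_wpM2l ?opnorm_ge0// KM.
  have [A FA HA] := ultra_small_oscillation FU FB eta0.
  by exists A; split=> // x y Ax Ay; rewrite -!LE; exact: HA.
exists (Lp_map i @` K `&` [set x | forall kl, A kl x]).
  by apply: filterI => //; apply: filter_forall => kl; exact: (HA kl).1.
move=> _ _ [[u Ku <-] Au] [[u' Ku' <-] Au'].
apply: close; [exact: KB | exact: KB |] => k l.
exact: (HA (k, l)).2 (Au (k, l)) (Au' (k, l)).
Qed.

End Compactness.

Lemma Z_bounded_variation (R : realType) (V W H : completeNormedModType R)
    (ip : {dot H for idfun}) (ip_norm : forall x : H, ip x x = `|x| ^+ 2)
    (i : clin V H) (j : clin W V) (p : R) (p_gt1 : 1 < p) (T : R) (T_gt0 : 0 < T)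
    (kappa M0 : R) (kappa_gt0 : 0 < kappa) (M0_gt0 : 0 < M0) (u0 : H) :
  Z T ip i j p_gt1 kappa M0 u0 `<=`
  bounded_variation ip i j kappa M0 (M0 + kappa * M0 + 2^-1 * `|u0| ^+ 2).
Proof.
move=> u Zu; have [u1 u2 _] := Zu.
have mapE := Lp_mapE i u.
split=> //.
  have h : {ae dt T, forall t, `|i (u t)| <= M0}.
    have mT : (0 < dt T setT)%E by rewrite dtT ?ltW// lte_fin.
    move: u2; rewrite /bochner_norm unlock /Lnorm mT => /ess_supP; apply: dt_aeS => t /=.
    by rewrite lee_fin !normr_id.
  by apply: dt_aeS2 mapE h => t ->.
move=> w g adm; have := Z_variation T_gt0 ip_norm kappa_gt0 M0_gt0 Zu adm.
apply: le_trans; rewrite le_eqVlt; apply/orP; left; apply/eqP.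
have [bg _ _] := adm; have [mg _] := bg.
have I1 := pairing_integrable T_gt0 ip_norm (i (j w)) (Lp_map i u) bg.
apply: (@eq_Rintegral_ae _ _ _ (dt T)).
- by apply/measurable_EFinP; exact: measurable_int I1.
- have [L LE] := riesz_clin ip_norm (i (j w)); apply: measurable_funM => //.
  under eq_fun do rewrite -LE; apply: measurable_fun_strongly.
  apply: (strongly_measurable_comp (@clin_continuous _ _ _ (clin_comp L i))).
  exact: (Lp_in_Lp u).1.
by apply: dt_aeS mapE => t ->.
Qed.

Theorem theorem2p1 (R : realType)
    (V W H : completeNormedModType R)
    (ip : {dot H for idfun}) (ip_norm : forall x : H, ip x x = `|x| ^+ 2)
    (i : clin V H) (j : clin W V)
    (V_reflexive : reflexive_space V) (W_reflexive : reflexive_space W)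
    (W_separable : separable_space W)
    (V_convex : strictly_convex V) (Vdual_convex : strictly_convex (dual V))
    (W_convex : strictly_convex W) (Wdual_convex : strictly_convex (dual W))
    (i_dense : dense_embedding i) (i_compact : compact_operator i)
    (j_dense : dense_embedding j)
    (p : R) (p_gt1 : 1 < p) (T : R) (T_gt0 : 0 < T)
    (kappa M0 : R) (kappa_gt0 : 0 < kappa) (M0_gt0 : 0 < M0) (u0 : H) :
  precompact (Lp_map i @` Z T ip i j p_gt1 kappa M0 u0) /\
  compact (Lp_map i @` closed_convex_hull (Z T ip i j p_gt1 kappa M0 u0)).
Proof.
(* One dense sequence of [W] yields dense sequences of [V] and [H], so the vectors in Ehrling's
   inequality are images of elements of [W], on which variation is controlled. *)
have [w w_dense] := separable_dense_seq W_separable.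
have v_dense := dense_seq_comp j_dense.2 w_dense.
have h_dense := dense_seq_comp i_dense.2 v_dense.
pose C0 := M0 + kappa * M0 + 2^-1 * `|u0| ^+ 2.
have C00 : 0 <= C0 by rewrite !addr_ge0 ?(ltW M0_gt0)// mulr_ge0// ltW.
set Z0 := Z T ip i j p_gt1 kappa M0 u0.
have Zsub : Z0 `<=` closed_convex_hull Z0 by exact: sub_smallest.
have cK : compact (Lp_map i @` closed_convex_hull Z0).
  apply: (compact_Lp_map_image T_gt0 ip_norm kappa_gt0 M0_gt0 C00 i_compact h_dense
    V_reflexive i_dense.1 Vdual_convex v_dense).
  - by apply: closed_bigI => B [[]].
  - move=> a b s Ka Kb /andP[s0 s1] B [[cB convB] ZB].
    have Ba : a \in B by rewrite inE; apply: Ka.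
    have Bb : b \in B by rewrite inE; apply: Kb.
    have s0' : 0 <= 1 - s by rewrite subr_ge0.
    have s1' : 1 - s <= 1 by rewrite gerBl.
    have := convB a b (Itv01 s0' s1') Ba Bb.
    by rewrite inE -[X in _ -> B (_ + X *: b)](subKr 1).
  (* The hull inherits the bounds because [bounded_variation] is itself closed and convex. *)
  apply: smallest_sub; last exact: Z_bounded_variation.
  split; first exact: bounded_variation_closed.
  move=> a b s; rewrite !inE => Ba Bb; apply: bounded_variation_convex => //.
  by rewrite ge0 le1.
(* The image of [Z0] is contained in the compact image of its hull. *)
split=> //.
apply: precompact_subset (image_subset _ Zsub) _.
by apply: compact_precompact => //; exact: norm_hausdorff.
Qed.
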